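(* Let $p(\cdot), q(\cdot)\in\mathbb{P}_{0}(0,\infty)$. Then, for any $1<r<\infty$ and any $\tau\in(0,\min\{1,p_{-},q_{-}\})$, there exists a positive constant $C$ such that for all sequences $\{f_j\}_{j=1}^{\infty}$ of measurable functions on $\mathbb{R}^n$ \[ \left\|\left(\sum_{j=1}^{\infty}(Mf_j)^r\right)^{1/r}\right\|_{\mathfrak{L}^{p(\cdot)/\tau,\,q(\cdot)/\tau}(\mathbb{R}^n)}\le C\left\|\left(\sum_{j=1}^{\infty}|f_j|^r\right)^{1/r}\right\|_{\mathfrak{L}^{p(\cdot)/\tau,\,q(\cdot)/\tau}(\mathbb{R}^n)}, \] where $M$ is the Hardy–Littlewood maximal operator.
   Context: A variable exponent on $(0,\infty)$ is a measurable function $p(\cdot):(0,\infty)\to(0,\infty)$; put $p_{-}=\operatorname{ess\,inf}_{t\in(0,\infty)}p(t)$ and $p_{+}=\operatorname{ess\,sup}_{t\in(0,\infty)}p(t)$. $\mathbb{P}_0(0,\infty)$ is the class of variable exponents with $0<p_{-}\le p_{+}<\infty$ for which the limits $p(0)=\lim_{t\to0^+}p(t)$ and $p(\infty)=\lim_{t\to\infty}p(t)$ exist and, for some constant $C>0$, $|p(t)-p(0)|\le \frac{C}{-\log t}$ for $0<t<\frac12$ and $|p(t)-p(\infty)|\le\frac{C}{\log(e+t)}$ for $0<t<\infty$. For measurable $f$ on $\mathbb{R}^n$, the non-increasing rearrangement is $f^{*}(t)=\inf\{s\ge 0: |\{x\in\mathbb{R}^n:|f(x)|>s\}|\le t\}$,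 $0<t<\infty$. Put $\rho_{p(\cdot),q(\cdot)}(f)=\int_0^\infty t^{\frac{q(t)}{p(t)}-1}[f^{*}(t)]^{q(t)}\,dt$. The variable Lorentz space $\mathfrak{L}^{p(\cdot),q(\cdot)}(\mathbb{R}^n)$ is the set of measurable $f$ with $\rho_{p(\cdot),q(\cdot)}(f)<\infty$, equipped with $\|f\|_{\mathfrak{L}^{p(\cdot),q(\cdot)}}=\inf\{\lambda>0:\rho_{p(\cdot),q(\cdot)}(f/\lambda)\le 1\}$ (equal to $\infty$ if no such $\lambda$ exists). The Hardy–Littlewood maximal function is $Mf(x)=\sup_{Q\ni x}\frac{1}{|Q|}\int_Q|f(y)|\,dy$, the supremum being over all cubes $Q\subset\mathbb{R}^n$ containing $x$. *)

(* Defs.v *)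
From HB Require Import structures.
From mathcomp Require Import all_boot all_order all_algebra.
From mathcomp Require Import all_classical all_reals all_analysis.
From mathcomp Require Import measurable_realfun ess_sup_inf.
Set Implicit Arguments.
Unset Strict Implicit.
Unset Printing Implicit Defensive.
Import Order.TTheory GRing.Theory Num.Theory.
Import numFieldNormedType.Exports.
Local Open Scope classical_set_scope.
Local Open Scope ring_scope.
Local Open Scope ereal_scope.

Definition tcons (R : realType) n
    (xy : measurableTypeR R * n.-tuple (measurableTypeR R)) :
    n.+1.-tuple (measurableTypeR R) :=
  [the n.+1.-tuple _ of xy.1 :: xy.2].

Lemma measurable_tcons (R : realType) n :
  measurable_fun [set: _] (@tcons R n).
Proof. exact: measurable_cons. Qed.

Section borel_lebesgueS.
Context (R : realType) (n : nat).
Variable mu : {sigma_finite_measure set (n.-tuple (measurableTypeR R)) -> \bar R}.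

Definition borel_lebesgueS : set (n.+1.-tuple (measurableTypeR R)) -> \bar R :=
  pushforward (@lebesgue_measure R \x mu) (@tcons R n).

Let mpre A : measurable A -> measurable (@tcons R n @^-1` A).
Proof. by move=> mA; rewrite -[X in measurable X]setTI; exact: measurable_tcons. Qed.

Let m0 : borel_lebesgueS set0 = 0.
Proof. by rewrite /borel_lebesgueS /pushforward preimage_set0 measure0. Qed.

Let m_ge0 A : 0 <= borel_lebesgueS A.
Proof. by rewrite /borel_lebesgueS /pushforward measure_ge0. Qed.

Let m_sigma_additive : semi_sigma_additive borel_lebesgueS.
Proof.
move=> F mF tF mUF; rewrite /borel_lebesgueS/pushforward preimage_bigcup.
apply: measure_semi_sigma_additive.
- by move=> k; exact: mpre.
- apply/trivIsetP => /= i j _ _ ij; rewrite -preimage_setI.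
  by move/trivIsetP : tF => /(_ _ _ _ _ ij) ->//; rewrite preimage_set0.
- by rewrite -preimage_bigcup; exact: mpre.
Qed.

HB.instance Definition _ :=
  isMeasure.Build _ _ _ borel_lebesgueS m0 m_ge0 m_sigma_additive.

Let uncons (x : n.+1.-tuple (measurableTypeR R)) :
    measurableTypeR R * n.-tuple (measurableTypeR R) :=
  (thead x, [tuple of behead x]).

Let tconsK : cancel (@tcons R n) uncons.
Proof.
case=> a x; rewrite /uncons /tcons /=; congr pair; exact/val_inj.
Qed.

Let unconsK : cancel uncons (@tcons R n).
Proof. by move=> x; apply/val_inj => /=; rewrite [in RHS](tuple_eta x). Qed.

Let measurable_uncons : measurable_fun setT uncons.
Proof.
apply/measurable_fun_pairP; split.
  exact: measurable_tnth.
exact: measurable_behead.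
Qed.

Let m_sigma_finite : sigma_finite setT borel_lebesgueS.
Proof.
have /sigma_finiteP[F [TF ndF Foo]] := sigma_finiteT (@lebesgue_measure R).
have /sigma_finiteP[G [TG ndG Goo]] := sigma_finiteT mu.
exists (fun k => uncons @^-1` (F k `*` G k)).
  rewrite -preimage_bigcup (_ : \bigcup_i _ = setT) ?preimage_setT//.
  rewrite -setXTT TF TG predeqE => -[x y]; split.
    by move=> [k _ []/= ? ?]; split; exists k.
  move=> [/= [k _ Fx] [l _ Gy]]; exists (maxn k l) => //; split.
  - by move: x Fx; exact/subsetPset/ndF/leq_maxl.
  - by move: y Gy; exact/subsetPset/ndG/leq_maxr.
move=> k; have [mF Fk] := Foo k; have [mG Gk] := Goo k; split.
  by rewrite -[X in measurable X]setTI; apply: measurable_uncons => //; exact: measurableX.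
rewrite /borel_lebesgueS /pushforward -comp_preimage.
rewrite (_ : _ \o _ = idfun) ?preimage_id; last exact/funext/tconsK.
by rewrite product_measure1E// lte_mul_pinfty// ge0_fin_numE.
Qed.

HB.instance Definition _ :=
  Measure_isSigmaFinite.Build _ _ _ borel_lebesgueS m_sigma_finite.

End borel_lebesgueS.

(* Lebesgue measure on the Borel sets of R^n, as an iterated product; see
   borel_lebesgue_box. *)
Fixpoint borel_lebesgue (R : realType) (n : nat) :
    {sigma_finite_measure set (n.-tuple (measurableTypeR R)) -> \bar R} :=
  match n with
  | 0%N => dirac [tuple]
  | m.+1 => borel_lebesgueS (borel_lebesgue R m)
  end.

(* R^n with the sigma-algebra of Lebesgue measurable sets (the Caratheodory
   sets of Lebesgue outer measure), not only the Borel sets. *)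
Definition euclid (R : realType) (n : nat) :=
  caratheodory_type ((borel_lebesgue R n)^*)%mu.

HB.instance Definition _ R n :=
  Measurable.copy (euclid R n) (caratheodory_type ((borel_lebesgue R n)^*)%mu).

Definition leb (R : realType) (n : nat) : set (euclid R n) -> \bar R :=
  @completed_measure_extension _ _ _ (borel_lebesgue R n).

HB.instance Definition _ R n := Measure.on (@leb R n).

Lemma leb_sigma_finite (R : realType) (n : nat) : sigma_finite setT (@leb R n).
Proof.
exact/completed_measure_extension_sigma_finite/sigma_finiteT.
Qed.

HB.instance Definition _ (R : realType) (n : nat) :=
  Measure_isSigmaFinite.Build _ _ _ (@leb R n) (@leb_sigma_finite R n).

Section box.
Context (R : realType).

Definition box n (a b : n.-tuple R) : set (euclid R n) :=
  [set x | forall i, tnth a i <= tnth x i <= tnth b i]%R.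

Lemma measurable_borel_box n (a b : n.-tuple R) :
  measurable (box a b : set (n.-tuple (measurableTypeR R))).
Proof.
rewrite (_ : box a b = \bigcap_(i in [set: 'I_n])
    ((fun x : n.-tuple (measurableTypeR R) => tnth x i) @^-1`
       `[tnth a i, tnth b i])); last first.
  apply/seteqP; split=> [x abx i _|x abx i]; first by rewrite /= in_itv /= abx.
  by have := abx i I; rewrite /= in_itv.
apply: fin_bigcap_measurable => [|i _]; first exact: finite_finset.
by rewrite -[X in measurable X]setTI; exact: measurable_tnth.
Qed.

Lemma borel_lebesgue_box n (a b : n.-tuple R) :
  (forall i, tnth a i <= tnth b i)%R ->
  borel_lebesgue R n (box a b) = (\prod_(i < n) (tnth b i - tnth a i))%:E.
Proof.
elim: n a b => [|n IH] a b ab /=.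
  by rewrite big_ord0 diracE mem_set// => -[].
rewrite /borel_lebesgueS /pushforward.
pose a' := [tuple of behead a]; pose b' := [tuple of behead b].
have a'E i : tnth a' i = tnth a (lift ord0 i).
  by rewrite tnth_behead; congr tnth; apply/val_inj; rewrite /= inordK// ltnS.
have b'E i : tnth b' i = tnth b (lift ord0 i).
  by rewrite tnth_behead; congr tnth; apply/val_inj; rewrite /= inordK// ltnS.
rewrite (_ : _ @^-1` _ = `[tnth a ord0, tnth b ord0] `*` box a' b').
  rewrite product_measure1E//=; last exact: measurable_borel_box.
  rewrite IH => [|i]; last by rewrite a'E b'E.
  rewrite lebesgue_measure_itv /= lte_fin big_ord_recl EFinM.
  congr (_ * _); last by congr EFin; apply: eq_bigr => i _; rewrite a'E b'E.
  by case: ltgtP (ab ord0) => // -> _; rewrite subrr.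
apply/seteqP; split=> [[x y] abx|[x y] [/= + aby] i].
  split; first by have := abx ord0; rewrite /= in_itv.
  by move=> i; have := abx (lift ord0 i); rewrite /= a'E b'E tnthS.
rewrite in_itv /= => abx; have [->//|i0] := eqVneq i ord0.
have [j ->] : exists j, i = lift ord0 j.
  by case: (unliftP ord0 i) i0 => [j ->|->]; [exists j|rewrite eqxx].
by have := aby j; rewrite a'E b'E tnthS.
Qed.

Lemma leb_box n (a b : n.-tuple R) :
  (forall i, tnth a i <= tnth b i)%R ->
  leb (box a b) = (\prod_(i < n) (tnth b i - tnth a i))%:E.
Proof.
move=> ab; rewrite -(borel_lebesgue_box ab).
by apply: measurable_mu_extE; exact: measurable_borel_box.
Qed.

End box.

Section variable_exponent.
Context (R : realType).

Local Notation lebR := (@completed_lebesgue_measure R).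
Local Notation TR := (caratheodory_type
  ((@wlength R (idfun : R -> R))^*)%mu).

Lemma measurable_itv_cara (i : interval R) : measurable ([set` i] : set TR).
Proof. by apply: sub_caratheodory; exact: measurable_itv. Qed.

(* Functions on (0, +oo) are represented by total functions on R whose values
   on ]-oo, 0] are never used; measurability is with respect to the Lebesgue
   measurable subsets of ]0, +oo[. *)
Definition variable_exponent (p : R -> R) :=
  measurable_fun (`]0%R, +oo[%classic : set TR) (p : TR -> R) /\
  (forall t, 0 < t -> 0 < p t)%R.

Definition half_line_measure :=
  mrestr lebR (measurable_itv_cara `]0%R, +oo[).

Definition exponent_inf (p : R -> R) : \bar R :=
  ess_inf half_line_measure (EFin \o p).

Definition exponent_sup (p : R -> R) : \bar R :=
  ess_sup half_line_measure (EFin \o p).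

Definition class_P0 (p : R -> R) :=
  [/\ variable_exponent p,
      0 < exponent_inf p, exponent_inf p <= exponent_sup p,
      exponent_sup p < +oo &
      exists p0 poo C : R,
      [/\ p t @[t --> 0%R^'+] --> p0,
          p t @[t --> +oo%R] --> poo,
          (0 < C)%R,
          (forall t, 0 < t < 2^-1 -> `|p t - p0| <= C / - ln t)%R &
          (forall t, 0 < t -> `|p t - poo| <= C / ln (expR 1 + t))%R]].
End variable_exponent.

Section variable_lorentz.
Context (R : realType) (n : nat).
Implicit Types (f : euclid R n -> \bar R) (p q : R -> R).

(* Functions take values in \bar R because maximal functions and l^r sums may
   be infinite; ereal_inf set0 = +oo gives f^*(t) = +oo, resp. an infinite
   norm, when there is no admissible s, resp. lambda. *)
Definition rearrangement f (t : R) : \bar R :=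
  ereal_inf [set s%:E | s in
    [set s : R | (0 <= s)%R /\ leb [set x | s%:E < `|f x|] <= t%:E]].

Definition lorentz_modular p q f : \bar R :=
  \int[@completed_lebesgue_measure R]_(t in `]0%R, +oo[)
    ((t `^ (q t / p t - 1))%R%:E * rearrangement f t `^ q t).

Definition lorentz_norm p q f : \bar R :=
  ereal_inf [set lambda%:E | lambda in
    [set lambda : R | (0 < lambda)%R /\
       lorentz_modular p q (fun x => f x / lambda%:E) <= 1]].

(* Cubes are closed, nondegenerate, with sides parallel to the axes. *)
Definition cube (a : n.-tuple R) (l : R) : set (euclid R n) :=
  [set x | forall i, tnth a i <= tnth x i <= tnth a i + l]%R.

Definition maximal f (x : euclid R n) : \bar R :=
  ereal_sup [set (leb Q)^-1 * \int[@leb R n]_(y in Q) `|f y| | Q in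
    [set Q | (exists a l, (0 < l)%R /\ Q = cube a l) /\ Q x]].

End variable_lorentz.

(* Main.v *)
(* The rearrangement only sees distribution functions, so the estimate is
   reduced to one level set at a time. If F = |(f_j)|_(l^r) satisfies
   |{F > B a^i}| <= t / 2^i and |{F > B b^-i}| <= t 2^i for all i, with a < 2 and
   b > 1, split the f_j at the height F = B: the upper part is integrable and
   the lower part is in L^s for s large, so the vector-valued weak (1,1) and
   (s,s) bounds give |{|(M f_j)|_(l^r) > C B}| <= t. These bounds are proved for
   the maximal functions of finitely many shifted dyadic filtrations, which
   dominate M, by the Fefferman-Stein duality inequality and a stopping-time
   decomposition.

   On the dyadic block [2^k, 2^(k+1)) the log-Hoelder conditions allow p / tau and
   q / tau to be replaced by their limits at 0 (k < 0) or at oo (k >= 0), up to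
   terms that are summable in k. Hence modular <= 1 means, up to constants,
   F^*(2^k) = 2^(- psi k) x_k with sum_k x_k^(q_k) bounded, where psi k = k / p_k.
   As p_k > 1, the slopes of psi lie in ]0, 1[; smearing x with a geometric
   kernel gives Y such that the level 2^(- psi k) Y_k satisfies the two
   conditions above with t = 2^k, and Y obeys the same summability. *)
Require Import Defs.
From mathcomp Require Import all_boot all_order all_algebra.
From mathcomp Require Import all_classical all_reals all_analysis.
From mathcomp Require Import measurable_realfun ess_sup_inf zify ring lra.
Set Implicit Arguments.
Unset Strict Implicit.
Unset Printing Implicit Defensive.
Import Order.TTheory GRing.Theory Num.Theory.
Import numFieldNormedType.Exports.
Local Open Scope classical_set_scope.
Local Open Scope ring_scope.
Local Open Scope ereal_scope.

(** * Conditional expectations on an atomic filtration *)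

(** Both exponents vary, so interpolation between fixed spaces is replaced by one endpoint pair,
    (1,1) and (s,s), at each level [B = 2 ^ (- psi k) * Y k]. The slopes of [psi] must lie strictly
    inside ]0, 1[ because the geometric smearing itself costs a slope [e] on both sides. The largest
    slope plus [e] is still below 1, which gives [a < 2] and makes the upper part summable with
    ratio [a / 2]. The smallest slope minus [e] is still positive, which gives [b > 1]. Since [b]
    may be close to 1, [s] must be taken large, so that [b ^ s >= 4].

    Log-Hoelder continuity enters as the boundedness of [2 ^ (k / (1 + k))]: an exponent error of
    order [1 / k] is harmless for quantities between [2 ^ (- k)] and a constant, and anything
    smaller is absorbed in a summable term.

    Each filtration has a coarsest generation and is used on finitely many generations, so first
    crossings exist and stopped averages are finite sums. The constants do not depend on that
    number, which is removed by monotone limits. The weak (1,1) bound requires averages over the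
    coarsest cells to lie below the level; this is arranged by making those cells large. *)

Section nnm.
Context d (T : measurableType d) (R : realType).
Implicit Types f g : T -> \bar R.

(** Bundles the two side conditions that Tonelli-type lemmas ask for. *)
Definition nnm f := measurable_fun [set: T] f /\ forall x, 0 <= f x.

Lemma nnm_measurable f (D : set T) : nnm f -> measurable_fun D f.
Proof. by move=> [mf _]; exact: measurable_funTS. Qed.

Lemma nnm_cst (c : \bar R) : 0 <= c -> nnm (fun=> c).
Proof. by move=> c0; split. Qed.

Lemma nnmD f g : nnm f -> nnm g -> nnm (fun x => f x + g x).
Proof.
move=> [mf f0] [mg g0]; split; first exact: emeasurable_funD.
by move=> x; exact: adde_ge0.
Qed.

Lemma nnmM f g : nnm f -> nnm g -> nnm (fun x => f x * g x).
Proof.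
move=> [mf f0] [mg g0]; split; first exact: emeasurable_funM.
by move=> x; exact: mule_ge0.
Qed.

Lemma nnmZ (c : R) f : (0 <= c)%R -> nnm f -> nnm (fun x => c%:E * f x).
Proof. by move=> c0; apply: nnmM; apply: nnm_cst; rewrite lee_fin. Qed.

Lemma nnm_max f g : nnm f -> nnm g -> nnm (fun x => maxe (f x) (g x)).
Proof.
move=> [mf f0] [mg g0]; split; first exact: measurable_maxe.
by move=> x; rewrite le_max f0.
Qed.

Lemma nnm_sum (I : Type) (s : seq I) (P : pred I) (h : I -> T -> \bar R) :
  (forall i, nnm (h i)) -> nnm (fun x => \sum_(i <- s | P i) h i x).
Proof.
move=> hh; split; last by move=> x; apply: sume_ge0 => i _; exact: (hh i).2.
elim: s => [|i s IH].
  by under eq_fun do rewrite big_nil; exact: measurable_cst.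
case Pi: (P i); under eq_fun do rewrite big_cons Pi; last exact: IH.
exact: emeasurable_funD (hh i).1 IH.
Qed.

Lemma nnm_series (h : nat -> T -> \bar R) :
  (forall i, nnm (h i)) -> nnm (fun x => \sum_(0 <= i <oo) h i x).
Proof.
move=> hh; split; last first.
  by move=> x; apply: nneseries_ge0 => i _ _; exact: (hh i).2.
apply: (@ge0_emeasurable_sum _ _ _ _ _ xpredT) => [i x _ _|i _].
- exact: (hh i).2.
- exact: (hh i).1.
Qed.

Lemma nnm_pow (r : R) f : nnm f -> nnm (fun x => f x `^ r).
Proof.
move=> [mf f0]; split; last by move=> x; exact: poweR_ge0.
exact: (measurableT_comp (measurable_poweR r)).
Qed.

Lemma nnm_bigmax (I : Type) (s : seq I) (P : pred I) (h : I -> T -> \bar R) :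
  (forall i, nnm (h i)) -> nnm (fun x => \big[maxe/0]_(i <- s | P i) h i x).
Proof.
move=> hh; elim: s => [|i s IH].
  by under eq_fun do rewrite big_nil; exact: nnm_cst.
case Pi: (P i); under eq_fun do rewrite big_cons Pi; last exact: IH.
exact: nnm_max.
Qed.

Definition ind (A : set T) (x : T) : \bar R := (\1_A x)%:E.

Lemma nnm_ind A : measurable A -> nnm (ind A).
Proof.
move=> mA; split; last by move=> x; rewrite lee_fin.
by apply/measurable_EFinP; exact: measurable_indic.
Qed.

Lemma indT A x : A x -> ind A x = 1.
Proof. by move=> Ax; rewrite /ind indicE mem_set. Qed.

Lemma indF A x : ~ A x -> ind A x = 0.
Proof. by move=> Ax; rewrite /ind indicE memNset. Qed.

Lemma ind_le1 A x : ind A x <= 1.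
Proof. by rewrite lee_fin indicE; case: (_ \in _). Qed.

Lemma nnm_gt f (y : \bar R) : nnm f -> measurable [set x | y < f x].
Proof. by move=> [mf _]; rewrite -[X in measurable X]setTI; exact: emeasurable_fun_o_infty. Qed.

Lemma nnm_le f (y : \bar R) : nnm f -> measurable [set x | f x <= y].
Proof. by move=> [mf _]; rewrite -[X in measurable X]setTI; exact: emeasurable_fun_infty_c. Qed.

Variable mu : {measure set T -> \bar R}.

Lemma nnm_int_ge0 f (A : set T) : nnm f -> 0 <= \int[mu]_(x in A) f x.
Proof. by move=> hf; apply: integral_ge0 => x _; exact: hf.2. Qed.

Lemma nnm_intD f g : nnm f -> nnm g ->
  \int[mu]_x (f x + g x) = \int[mu]_x f x + \int[mu]_x g x.
Proof.
by move=> hf hg; rewrite ge0_integralD// => [x _||x _|]; first [exact: hf.2|exact: hg.2|exact: hf.1|exact: hg.1].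
Qed.

Lemma nnm_int_setZ (A : set T) (c : \bar R) f : measurable A -> 0 <= c -> nnm f ->
  \int[mu]_(x in A) (c * f x) = c * \int[mu]_(x in A) f x.
Proof.
move=> mA c0 hf; rewrite ge0_integralZl// => [|x _]; last exact: hf.2.
exact: nnm_measurable.
Qed.

Lemma nnm_intZ (c : \bar R) f : 0 <= c -> nnm f ->
  \int[mu]_x (c * f x) = c * \int[mu]_x f x.
Proof.
by move=> c0 hf; rewrite ge0_integralZl// => [|x _]; [exact: hf.1|exact: hf.2].
Qed.

Lemma nnm_int_le f g : nnm f -> nnm g -> (forall x, f x <= g x) ->
  \int[mu]_x f x <= \int[mu]_x g x.
Proof.
move=> hf hg fg; apply: ge0_le_integral => //.
- by move=> x _; exact: hf.2.
- exact: hf.1.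
- exact: hg.1.
Qed.

Lemma nnm_int_sum (I : Type) (s : seq I) (h : I -> T -> \bar R) :
  (forall i, nnm (h i)) ->
  \int[mu]_x (\sum_(i <- s) h i x) = \sum_(i <- s) \int[mu]_x h i x.
Proof.
by move=> hh; rewrite ge0_integral_sum// => [i|i x _]; [exact: (hh i).1|exact: (hh i).2].
Qed.

Lemma nnm_int_series (h : nat -> T -> \bar R) :
  (forall i, nnm (h i)) ->
  \int[mu]_x (\sum_(0 <= i <oo) h i x) = \sum_(0 <= i <oo) \int[mu]_x h i x.
Proof.
by move=> hh; rewrite integral_nneseries// => [i|i x _]; [exact: (hh i).1|exact: (hh i).2].
Qed.

Lemma nnm_int_ind f A : measurable A -> nnm f ->
  \int[mu]_x (ind A x * f x) = \int[mu]_(x in A) f x.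
Proof.
move=> mA hf; rewrite [RHS]integral_mkcond; apply: eq_integral => x _.
rewrite patchE; case: ifPn => [/set_mem Ax|/negP xA].
  by rewrite indT// mul1e.
by rewrite indF ?mul0e// => Ax; apply: xA; exact: mem_set.
Qed.

Lemma nnm_int_indT A : measurable A -> \int[mu]_x ind A x = mu A.
Proof. by move=> mA; rewrite integral_indic// setIT. Qed.

End nnm.
Arguments ind {d T R} A x.

(** * Nonnegative sums over the integers *)

Section zsum.
Context (R : realType).
Implicit Types a b : int -> \bar R.

(** The two constructors of [int] give two one-sided series, so that the theory of nonnegative
    series over [nat] applies to each half. *)
Definition zsum a : \bar R :=
  \sum_(0 <= m <oo) a (Posz m) + \sum_(0 <= m <oo) a (Negz m).

Lemma zsum_ge0 a : (forall k, 0 <= a k) -> 0 <= zsum a.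
Proof. by move=> a0; apply: adde_ge0; apply: nneseries_ge0. Qed.

Lemma zsum_le a b : (forall k, 0 <= a k) -> (forall k, a k <= b k) ->
  zsum a <= zsum b.
Proof. by move=> a0 ab; apply: leeD; apply: lee_nneseries. Qed.

Lemma eq_zsum a b : a =1 b -> zsum a = zsum b.
Proof. by move=> /funext ->. Qed.

Lemma zsumZ (c : R) a : (0 <= c)%R -> (forall k, 0 <= a k) ->
  zsum (fun k => c%:E * a k) = c%:E * zsum a.
Proof.
move=> c0 a0; rewrite /zsum !nneseriesZl//.
by rewrite ge0_muleDr//; exact: nneseries_ge0.
Qed.

Lemma zsumD a b : (forall k, 0 <= a k) -> (forall k, 0 <= b k) ->
  zsum (fun k => a k + b k) = zsum a + zsum b.
Proof.
by move=> a0 b0; rewrite /zsum !nneseriesD// addeACA.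
Qed.

Lemma nneseries_ge_term (u : nat -> \bar R) m :
  (forall i, 0 <= u i) -> u m <= \sum_(0 <= i <oo) u i.
Proof.
move=> u0; rewrite (@nneseriesD1 _ _ m)//.
by rewrite leeDl//; apply: nneseries_ge0.
Qed.

Lemma zsum_ge_term a k : (forall k, 0 <= a k) -> a k <= zsum a.
Proof.
move=> a0; case: k => m.
- rewrite (le_trans (@nneseries_ge_term (fun m => a (Posz m)) m _))//.
  by rewrite leeDl// nneseries_ge0.
- rewrite (le_trans (@nneseries_ge_term (fun m => a (Negz m)) m _))//.
  by rewrite leeDr// nneseries_ge0.
Qed.

(** The factor may be [+oo]: below it is a pointwise value such as [w x]. Either all terms vanish,
    or one positive term already makes both sides infinite. *)
Lemma nneseriesZr (u : nat -> \bar R) (c : \bar R) : 0 <= c -> (forall i, 0 <= u i) ->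
  \sum_(0 <= i <oo) (u i * c) = (\sum_(0 <= i <oo) u i) * c.
Proof.
move=> + u0; case: c => [c|_|//]; first rewrite lee_fin => c0.
  by rewrite muleC -nneseriesZl//; apply: eq_eseriesr => i _; rewrite muleC.
have [u00|] := pselect (forall i, u i = 0).
  by rewrite !eseries0 ?mul0e// => i _ _; rewrite u00 mul0e.
move=> /existsNP[i /eqP ui]; have {}ui : 0 < u i by rewrite lt0e ui u0.
rewrite (gt0_muley (lt_le_trans ui (nneseries_ge_term i u0))).
apply/eqP; rewrite eq_le leey/=.
have := @nneseries_ge_term (fun i => u i * +oo) i; rewrite gt0_muley//; apply.
by move=> j; exact: mule_ge0.
Qed.

Lemma zsumZr a (c : \bar R) : 0 <= c -> (forall k, 0 <= a k) ->
  zsum (fun k => a k * c) = zsum a * c.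
Proof.
by move=> c0 a0; rewrite /zsum !nneseriesZr// ge0_muleDl//; exact: nneseries_ge0.
Qed.

Lemma nneseries_recS (u : nat -> \bar R) : (forall i, 0 <= u i) ->
  \sum_(0 <= i <oo) u i = u 0%N + \sum_(0 <= i <oo) u i.+1.
Proof.
move=> u0; rewrite (@nneseries_split _ _ 0 1)// big_nat1; congr (_ + _).
rewrite -(@nneseries_addn _ _ 1)//.
by apply: eq_eseriesr => i _; rewrite addn1.
Qed.

(** The shift moves the single term [a 0] into the [Negz] half. *)
Lemma zsum_shift1 a : (forall k, 0 <= a k) ->
  zsum (fun k => a (k + 1)%R) = zsum a.
Proof.
move=> a0; rewrite /zsum (@nneseries_recS (fun m => a (Posz m)))//.
rewrite [X in _ + X](@nneseries_recS (fun m => a (Negz m + 1)%R))//.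
rewrite addeCA addeA; congr (_ + _ + _).
  by apply: eq_eseriesr => i _; rewrite -PoszD addn1.
by apply: eq_eseriesr => i _; rewrite !NegzE -addn1 PoszD opprD addrNK.
Qed.

Lemma zsum_shift a n : (forall k, 0 <= a k) ->
  zsum (fun k => a (k + n)%R) = zsum a.
Proof.
have H b m : (forall k, 0 <= b k) -> zsum (fun k => b (k + m%:Z)%R) = zsum b.
  move=> b0; elim: m => [|m IH]; first by apply: eq_zsum => k; rewrite addr0.
  rewrite -IH -(@zsum_shift1 (fun k => b (k + m%:Z)%R))//.
  by apply: eq_zsum => k; rewrite -addrA -PoszD add1n.
move=> a0; case: n => m; first exact: H.
rewrite -(H (fun k => a (k + Negz m)%R) m.+1)//.
by apply: eq_zsum => k; rewrite NegzE addrK.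
Qed.

Lemma zsum_interchange (a : int -> int -> \bar R) : (forall k l, 0 <= a k l) ->
  zsum (fun k => zsum (a k)) = zsum (fun l => zsum (a ^~ l)).
Proof.
move=> a0; rewrite /zsum.
have s0 (f : nat -> \bar R) : (forall i, 0 <= f i) -> forall n, (0 <= n)%N -> true -> 0 <= f n by [].
rewrite !nneseriesD; try by move=> *; apply: nneseries_ge0.
rewrite addeACA; congr (_ + _ + (_ + _)); exact: nneseries_interchange.
Qed.

Lemma nneseries_geometric (q : R) : (0 <= q < 1)%R ->
  \sum_(0 <= m <oo) (q ^+ m)%:E = ((1 - q)^-1)%:E.
Proof.
move=> /andP[q0 q1]; apply/cvg_lim => //.
under eq_fun do rewrite sumEFin; apply: cvg_EFin; first exact: nearW.
have := @cvg_geometric_series R 1 q; rewrite ger0_norm// => /(_ q1).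
rewrite mul1r; apply: cvg_trans; apply: near_eq_cvg; apply: nearW => n /=.
by apply: eq_bigr => i _; rewrite /geometric /= mul1r.
Qed.

Lemma zsum_geometric (q : R) : (0 <= q < 1)%R ->
  zsum (fun k => (q ^+ `|k|%N)%:E) = ((1 - q)^-1 * (1 + q))%:E.
Proof.
move=> /andP[q0 q1]; rewrite /zsum nneseries_geometric ?q0//.
rewrite (_ : \sum_(0 <= m <oo) _ = q%:E * \sum_(0 <= m <oo) (q ^+ m)%:E).
  by rewrite nneseries_geometric ?q0// -EFinM -EFinD; congr EFin; rewrite mulrDr mulr1 mulrC.
rewrite -nneseriesZl//; last by move=> i _; rewrite lee_fin exprn_ge0.
by apply: eq_eseriesr => i _; rewrite -EFinM -exprS.
Qed.

Context d (T : measurableType d) (mu : {measure set T -> \bar R}).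

Lemma nnm_zsum (h : int -> T -> \bar R) : (forall k, nnm (h k)) ->
  nnm (fun x => zsum (h ^~ x)).
Proof. by move=> hh; apply: nnmD; exact: nnm_series. Qed.

Lemma nnm_int_zsum (h : int -> T -> \bar R) : (forall k, nnm (h k)) ->
  \int[mu]_x zsum (h ^~ x) = zsum (fun k => \int[mu]_x h k x).
Proof.
move=> hh; rewrite nnm_intD; [|exact: nnm_series..].
by rewrite !nnm_int_series.
Qed.

End zsum.

Lemma ind_gt d (T : measurableType d) (R : realType) (f : T -> \bar R) (a : \bar R) x :
  ind [set x | a < f x] x = if a < f x then 1 else 0 :> \bar R.
Proof. by case: ifPn => [h|/negP h]; [rewrite indT|rewrite indF]. Qed.

(** * Dyadic layer decompositions of a power *)

Section dyadic.
Context (R : realType).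
Implicit Types (y : \bar R) (r : R).

Lemma pow2_bracket (y : R) : (0 < y -> exists j : int, 2 ^ j <= y < 2 ^ (j + 1))%R.
Proof.
move=> y0; have l2 : (0 < ln 2 :> R)%R by rewrite ln_gt0// ltr1n.
have pw (k : int) : (2 ^ k = expR (k%:~R * ln 2) :> R)%R.
  by rewrite -powR_intmul// /powR pnatr_eq0.
exists (Num.floor (ln y / ln 2)).
rewrite !pw -{2 3}(@lnK _ y)// ler_expR ltr_expR.
by rewrite -ler_pdivlMr// -ltr_pdivrMr// Num.Theory.floor_le Num.Theory.floorD1_gt.
Qed.

Lemma poweR_le r (x y : \bar R) : (0 <= r)%R -> 0 <= x -> x <= y -> x `^ r <= y `^ r.
Proof.
move=> r0 x0 xy; apply: gt0_ler_poweR => //; rewrite in_itv/= leey andbT//.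
exact: le_trans xy.
Qed.

(** One term suffices: if [2 ^ j <= y < 2 ^ (j + 1)], then [k = j - 2] satisfies
    [2 * 2 ^ k < y < 8 * 2 ^ k]. The threshold is doubled to match [fmax_weak_trunc]. *)
Lemma dyadic_ge r y : (0 < r)%R -> 0 <= y ->
  y `^ r <= zsum (fun k : int => (8 `^ r * (2 ^ k) `^ r)%:E *
                      (if (2 * 2 ^ k)%:E < y then 1 else 0)).
Proof.
move=> r0; pose a (y : \bar R) (k : int) : \bar R := (8 `^ r * (2 ^ k) `^ r)%:E *
  (if (2 * 2 ^ k)%:E < y then 1 else 0).
rewrite -/(a y).
have a0 y' k : 0 <= a y' k.
  by rewrite /a; case: ifPn; rewrite ?mule0 ?mule1// lee_fin mulr_ge0// powR_ge0.
have fin (t : R) : (0 <= t)%R -> t%:E `^ r <= zsum (a t%:E).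
  rewrite le_eqVlt => /orP[/eqP <-|t0].
    by rewrite poweR0r ?gt_eqF//; exact: zsum_ge0.
  have [j /andP[jt tj]] := pow2_bracket t0.
  apply: le_trans (zsum_ge_term (j - 2) (a0 _)).
  have E : (2 ^ j = 4 * 2 ^ (j - 2) :> R)%R.
    by rewrite expfzDr// mulrCA (_ : 2 ^ (-2) = 4^-1)%R ?mulfV ?mulr1// -exprz_inv -exprnP exprVn; congr (_^-1)%R; ring.
  have p0 : (0 < 2 ^ (j - 2) :> R)%R by rewrite exprz_gt0.
  rewrite /a lte_fin ifT; last first.
    by apply: lt_le_trans jt; rewrite E ltr_pM2r//; lra.
  rewrite mule1 -powRM ?lee_fin ?(ltW p0)//.
  apply: ge0_ler_powR; rewrite ?nnegrE ?(ltW r0) ?(ltW t0)//.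
    by rewrite mulr_ge0// ltW.
  rewrite (le_trans (ltW tj))// expfzDr// E expr1z; lra.
case: y => [t| _|//]; first exact: fin.
(* For [y = +oo] every indicator is 1, so the sum dominates the one for the [r]-th root of any real
   [M]. *)
rewrite poweRyr ?gt_eqF// leye_eq; apply/eqP/eqyP => M M0.
rewrite -[M]powRr1 ?(ltW M0)// -(mulVf (lt0r_neq0 r0)) powRrM -poweR_EFin.
apply: le_trans (fin _ (powR_ge0 _ _)) _.
apply: zsum_le => // k; rewrite /a ltry.
by rewrite lee_wpmul2l ?lee_fin ?mulr_ge0 ?powR_ge0//; case: ifP; rewrite ?lexx ?lee_fin.
Qed.

(** The terms with [2 ^ k < y] form a geometric progression whose largest term is at most the [r]-th
    power of [y]. They are bounded by a two-sided geometric series centred at the index [j] of [y],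
    whose sum is the constant. *)
Lemma dyadic_le r : (0 < r)%R -> exists C : R, (0 < C)%R /\ forall y, 0 <= y ->
  zsum (fun k : int => ((2 ^ k) `^ r)%:E * (if (2 ^ k)%:E < y then 1 else 0))
  <= C%:E * y `^ r.
Proof.
move=> r0; pose q : R := (2 `^ r)^-1%R.
have p1 : (1 < 2 `^ r)%R.
  by have := @gt0_ltr_powR R r r0 1%R 2%R; rewrite powR1; apply; rewrite ?nnegrE ?ltr1n.
have q01 : (0 < q < 1)%R.
  by rewrite invr_gt0 powR_gt0//= invf_lt1// powR_gt0.
have /andP[q0 q1] := q01.
exists ((1 - q)^-1 * (1 + q))%R; split.
  by rewrite mulr_gt0 ?invr_gt0 ?subr_gt0// addr_gt0.
have C0 : (0 < (1 - q)^-1 * (1 + q))%R by rewrite mulr_gt0 ?invr_gt0 ?subr_gt0// addr_gt0.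
case=> [t| _|//]; last first.
  by rewrite poweRyr ?gt_eqF// gt0_muley ?leey// lte_fin.
rewrite lee_fin le_eqVlt => /orP[/eqP <-|t0].
  rewrite poweR0r ?gt_eqF// mule0 (_ : (fun _ => _) = fun=> 0).
    by rewrite /zsum !eseries0 ?adde0.
  apply/funext => k; rewrite ifF ?mule0//.
  by apply/negbTE; rewrite -leNgt lee_fin exprz_ge0.
have [j /andP[jt tj]] := pow2_bracket t0.
have j0 : (0 < 2 ^ j :> R)%R by rewrite exprz_gt0.
apply: (@le_trans _ _ (zsum (fun k : int => ((2 ^ j) `^ r)%:E * (q ^+ `|k - j|%N)%:E))).
  apply: zsum_le => k.
    by case: ifP; rewrite ?mule0 ?mule1// lee_fin powR_ge0.
  case: ifPn => [kt|_]; last by rewrite mule0 -EFinM lee_fin mulr_ge0 ?powR_ge0// exprn_ge0// ltW.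
  have kj : (k <= j)%R.
    by rewrite -ltzD1 -(@ltr_eXz2l R 2)//; [exact: lt_trans tj|lra].
  rewrite mule1 -EFinM lee_fin.
  have [m ->] : exists m : nat, j = (k + m%:Z)%R.
    by exists `|j - k|%N; rewrite gez0_abs ?subr_ge0// addrCA subrr addr0.
  rewrite opprD addrA subrr add0r abszN absz_nat expfzDr// powRM ?exprz_ge0//.
  rewrite -mulrA -exprnP -(powR_mulrn m (ler0n R 2)) powRAC powR_mulrn ?powR_ge0//.
  by rewrite /q exprVn mulfV ?mulr1// expf_neq0// gt_eqF// powR_gt0.
rewrite zsumZ ?powR_ge0//; last by move=> k; rewrite lee_fin exprn_ge0// ltW.
rewrite (@zsum_shift _ (fun k => (q ^+ `|k|%N)%:E) (- j)%R); last first.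
  by move=> k; rewrite lee_fin exprn_ge0// ltW.
rewrite zsum_geometric ?(ltW q0)// muleC lee_wpmul2l ?lee_fin ?(ltW C0)//.
apply: ge0_ler_powR; rewrite ?nnegrE ?(ltW r0) ?(ltW t0)// ltW//.
Qed.

End dyadic.

(* The cells of generation [k] are the fibres of [fcell k]. *)
Record filtration d (T : measurableType d) (R : realType)
    (mu : {measure set T -> \bar R}) := Filtration {
  fcell : nat -> T -> nat ;
  fvol : nat -> R ;
  fdbl : R ;
  measurable_fcell : forall k a, measurable [set x | fcell k x = a] ;
  fcellS : forall k x y, fcell k.+1 x = fcell k.+1 y -> fcell k x = fcell k y ;
  fvol_gt0 : forall k, (0 < fvol k)%R ;
  measure_fcell : forall k x, mu [set y | fcell k y = fcell k x] = (fvol k)%:E ;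
  fvolS : forall k, (fvol k <= fdbl * fvol k.+1)%R }.

Section filtration.
Context d (T : measurableType d) (R : realType).
Variable mu : {measure set T -> \bar R}.
Variable F : filtration mu.
Local Notation cell := (fcell F).
Local Notation v := (fvol F).
Implicit Types f g h w : T -> \bar R.

(** Measurability with respect to generation [k]: the sigma-algebra is atomic, so this is constancy
    on cells. Countability of the cells then gives measurability in [T], see [lvl_set]. *)
Definition lvl U k (h : T -> U) := forall x y, cell k x = cell k y -> h x = h y.

Lemma cell_le k l x y : (k <= l)%N -> cell l x = cell l y -> cell k x = cell k y.
Proof.
move=> /subnK <-; elim: (l - k)%N => [//|m IH]; rewrite addSn => /fcellS.
exact: IH.
Qed.

Lemma lvl_le U k l (h : T -> U) : (k <= l)%N -> lvl k h -> lvl l h.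
Proof. by move=> kl hk x y /(cell_le kl); exact: hk. Qed.

Lemma lvl_set k (A : set T) : lvl k A -> measurable A.
Proof.
move=> hA; rewrite (_ : A = \bigcup_(a in [set a | exists x, cell k x = a /\ A x])
    [set x | cell k x = a]).
  by apply: bigcup_measurable => a _; exact: measurable_fcell.
apply/seteqP; split => [x Ax|x [a [y [<- Ay]] /= xy]].
  by exists (cell k x) => //; exists x.
by rewrite (hA _ _ xy).
Qed.

Lemma lvl_measurable k h : lvl k h -> measurable_fun [set: T] h.
Proof.
move=> hh _ B mB; rewrite setTI; apply: (@lvl_set k) => x y xy.
by rewrite /preimage/= (hh _ _ xy).
Qed.

Lemma lvl_nnm k h : lvl k h -> (forall x, 0 <= h x) -> nnm h.
Proof. by move=> hh h0; split => //; exact: (@lvl_measurable k). Qed.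

Lemma int_cells k h : nnm h ->
  \int[mu]_x h x = \sum_(0 <= a <oo) \int[mu]_(x in [set x | cell k x = a]) h x.
Proof.
move=> hh; have TE : [set: T] = \bigcup_a [set x | cell k x = a].
  by apply/seteqP; split => // x _; exists (cell k x).
rewrite {1}TE ge0_integral_bigcup//.
- by move=> a; exact: measurable_fcell.
- exact: nnm_measurable.
- by move=> x _; exact: hh.2.
- by apply/trivIsetP => i j _ _ /eqP ij; apply/seteqP; split => // x [/= -> /ij].
Qed.

Definition cE k f x : \bar R :=
  (v k)^-1%:E * \int[mu]_(y in [set y | cell k y = cell k x]) f y.

Lemma cE_lvl k f : lvl k (cE k f).
Proof. by move=> x y xy; rewrite /cE xy. Qed.

Lemma cE_ge0 k f x : (forall x, 0 <= f x) -> 0 <= cE k f x.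
Proof.
move=> f0; apply: mule_ge0; first by rewrite lee_fin invr_ge0 ltW ?fvol_gt0.
exact: integral_ge0.
Qed.

Lemma nnm_cE k f : nnm f -> nnm (cE k f).
Proof.
move=> hf; apply: (@lvl_nnm k); first exact: cE_lvl.
by move=> x; apply: cE_ge0; exact: hf.2.
Qed.

(** On one cell both sides integrate to the product of the two integrals divided by the volume. *)
Lemma cE_adj k f g : nnm f -> nnm g ->
  \int[mu]_x (cE k f x * g x) = \int[mu]_x (f x * cE k g x).
Proof.
move=> hf hg; rewrite !(@int_cells k); [|by apply: nnmM => //; exact: nnm_cE..].
apply: eq_eseriesr => a _.
pose I f := \int[mu]_(y in [set y | cell k y = a]) f y.
have I0 h : nnm h -> 0 <= I h by exact: nnm_int_ge0.
have vI0 h : nnm h -> 0 <= (v k)^-1%:E * I h.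
  by move=> hh; apply: mule_ge0 (I0 _ hh); rewrite lee_fin invr_ge0 ltW ?fvol_gt0.
have mC : measurable [set y | cell k y = a] by exact: measurable_fcell.
transitivity ((v k)^-1%:E * I f * I g).
  rewrite /I -(nnm_int_setZ mu mC (vI0 f hf) hg).
  by apply: eq_integral => x /set_mem /= xa; rewrite /cE xa.
rewrite -muleA [I f * _]muleC muleA -(nnm_int_setZ mu mC (vI0 g hg) hf).
by apply: eq_integral => x /set_mem /= xa; rewrite /cE xa muleC.
Qed.

Lemma cE_pull k f h : nnm f -> lvl k h -> (forall x, 0 <= h x) ->
  forall x, cE k (fun y => h y * f y) x = h x * cE k f x.
Proof.
move=> hf hh h0 x; rewrite /cE muleCA; congr (_ * _).
rewrite -(nnm_int_setZ mu (measurable_fcell F k _) (h0 x) hf).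
by apply: eq_integral => y /set_mem /= /hh ->.
Qed.

Lemma cE_cst k c x : 0 <= c -> cE k (fun=> c) x = c.
Proof.
move=> c0; rewrite /cE integral_cst; last exact: measurable_fcell.
by rewrite measure_fcell muleC -muleA -EFinM mulfV ?mule1 ?gt_eqF ?fvol_gt0.
Qed.

Lemma cE_id k h x : lvl k h -> (forall x, 0 <= h x) -> cE k h x = h x.
Proof.
move=> hh h0; have := @cE_pull k (fun=> 1) h (nnm_cst _ lee01) hh h0 x.
by rewrite cE_cst// mule1 => <-; congr (cE k _ x); apply/funext => y; rewrite mule1.
Qed.

Lemma cE_le k f g x : nnm f -> nnm g -> (forall y, f y <= g y) ->
  cE k f x <= cE k g x.
Proof.
move=> hf hg fg; apply: lee_wpmul2l; first by rewrite lee_fin invr_ge0 ltW ?fvol_gt0.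
apply: ge0_le_integral => //.
- exact: measurable_fcell.
- by move=> y _; exact: hf.2.
- exact: nnm_measurable.
- exact: nnm_measurable.
Qed.

Lemma cED k f g x : nnm f -> nnm g ->
  cE k (fun y => f y + g y) x = cE k f x + cE k g x.
Proof.
move=> hf hg; rewrite /cE ge0_integralD//.
- by rewrite ge0_muleDr//; exact: nnm_int_ge0.
- exact: measurable_fcell.
- by move=> y _; exact: hf.2.
- exact: nnm_measurable.
- by move=> y _; exact: hg.2.
- exact: nnm_measurable.
Qed.

Lemma cEZ k f c x : nnm f -> 0 <= c ->
  cE k (fun y => c * f y) x = c * cE k f x.
Proof. by move=> hf c0; rewrite (@cE_pull k f (fun=> c)). Qed.

Lemma cE_sum k (I : Type) (s : seq I) (h : I -> T -> \bar R) x :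
  (forall i, nnm (h i)) ->
  cE k (fun y => \sum_(i <- s) h i y) x = \sum_(i <- s) cE k (h i) x.
Proof.
move=> hh; rewrite /cE ge0_integral_sum//.
- rewrite ge0_sume_distrr// => i _.
  exact: nnm_int_ge0.
- exact: measurable_fcell.
- by move=> i; exact: nnm_measurable.
- by move=> i y _; exact: (hh i).2.
Qed.

(** The indicator of the coarse cell is [lvl l], so [cE l] fixes it, and self-adjointness removes
    [cE l] from [f]. *)
Lemma cE_tower k l f x : nnm f -> (k <= l)%N -> cE k (cE l f) x = cE k f x.
Proof.
move=> hf kl; rewrite /cE; congr (_ * _).
set C := [set y | cell k y = cell k x].
have mC : measurable C by exact: measurable_fcell.
have hC : nnm (@ind _ T R C) by exact: nnm_ind.
rewrite -(nnm_int_ind mu mC (nnm_cE l hf)) -(nnm_int_ind mu mC hf).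
have CC : lvl l (@ind _ T R C).
  apply: lvl_le kl _ => y z yz; rewrite /ind !indicE (_ : (y \in C) = (z \in C))//.
  by apply/idP/idP => /set_mem h; apply/mem_set; move: h; rewrite /C/= yz.
rewrite -(cE_adj l hC hf).
by apply: eq_integral => y _; rewrite cE_id//; exact: hC.2.
Qed.

End filtration.

(** * The maximal function of a filtration *)

Section filtration_maximal.
Context d (T : measurableType d) (R : realType).
Variable mu : {measure set T -> \bar R}.
Variable F : filtration mu.
Local Notation cE := (cE F).
Local Notation lvl := (lvl F).
Implicit Types f g h w : T -> \bar R.

(** Truncated to generations up to [L], so that a first crossing can be read off a finite maximum.
    The bounds below are uniform in [L]. *)
Definition fmax L f x : \bar R := \big[maxe/0]_(k < L.+1) cE k f x.

Lemma nnm_fmax L f : nnm f -> nnm (fmax L f).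
Proof. by move=> hf; apply: nnm_bigmax => k; exact: nnm_cE. Qed.

Lemma le_fmax L k f x : (k <= L)%N -> cE k f x <= fmax L f x.
Proof.
move=> kL; have := le_bigmax 0 (fun i : 'I_L.+1 => cE i f x) (Ordinal (kL : (k < L.+1)%N)).
exact.
Qed.

Lemma fmax_ge0 L f x : 0 <= fmax L f x.
Proof. exact: bigmax_ge_id. Qed.

Lemma fmax_le L f x y : 0 <= y -> (forall k, (k <= L)%N -> cE k f x <= y) ->
  fmax L f x <= y.
Proof. by move=> y0 fy; apply/bigmax_leP; split => // i _; apply: fy; rewrite -ltnS. Qed.

Lemma fmax_gt L f x y : 0 <= y -> y < fmax L f x ->
  exists2 k, (k <= L)%N & y < cE k f x.
Proof.
move=> y0 yf; apply/not_exists2P => H; move: yf; rewrite ltNge => /negP; apply.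
apply: fmax_le => // k kL; rewrite leNgt; apply/negP => yk.
by have [] := H k.
Qed.

Lemma fmax_cst L c x : 0 <= c -> fmax L (fun=> c) x = c.
Proof.
move=> c0; apply/eqP; rewrite eq_le; apply/andP; split.
  by apply: fmax_le => // k _; rewrite cE_cst.
by rewrite -{1}(@cE_cst _ _ _ _ F 0 c x c0); exact: le_fmax.
Qed.

Lemma fmax_mono L f g x : nnm f -> nnm g -> (forall y, f y <= g y) ->
  fmax L f x <= fmax L g x.
Proof.
move=> hf hg fg; apply: fmax_le; first exact: fmax_ge0.
by move=> k kL; apply: le_trans (le_fmax _ _ kL); exact: cE_le.
Qed.

Lemma fmaxD L f g x : nnm f -> nnm g ->
  fmax L (fun y => f y + g y) x <= fmax L f x + fmax L g x.
Proof.
move=> hf hg; apply: fmax_le; first by apply: adde_ge0; exact: fmax_ge0.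
by move=> k kL; rewrite cED//; apply: leeD; exact: le_fmax.
Qed.

(** The cells of generation [k] in the Calderon-Zygmund decomposition of [f] at height [y]. These
    sets are disjoint for different [k], and each is a union of cells of its generation. *)
Definition stop (y : \bar R) f k : set T :=
  [set x | y < cE k f x /\ forall i, (i < k)%N -> cE i f x <= y].

Lemma stop_lvl y f k : lvl k (stop y f k).
Proof.
move=> x x' xx'; rewrite /stop/= (cE_lvl f xx'); congr (_ /\ _).
apply/propext; split => H i ik; have := H i ik;
  by rewrite (cE_lvl f (cell_le (ltnW ik) xx')).
Qed.

Lemma measurable_stop y f k : measurable (stop y f k).
Proof. exact: lvl_set (@stop_lvl y f k). Qed.
Hint Resolve measurable_stop : core.

Lemma ind_stop_lvl y f k : lvl k (@ind _ T R (stop y f k)).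
Proof.
move=> x x' xx'; rewrite /ind !indicE.
rewrite (_ : (x \in stop y f k) = (x' \in stop y f k))//.
by apply/idP/idP => /set_mem h; apply/mem_set; move: h; rewrite (stop_lvl y f xx').
Qed.

Lemma stop_uniq y f k l x : stop y f k x -> stop y f l x -> k = l.
Proof.
move=> [yk Hk] [yl Hl]; apply/eqP; rewrite eqn_leq; apply/andP; split;
  rewrite leqNgt; apply/negP => H.
- by have := Hk _ H; rewrite leNgt yl.
- by have := Hl _ H; rewrite leNgt yk.
Qed.

Lemma fmax_stop L f x y : 0 <= y -> y < fmax L f x ->
  exists2 k, (k <= L)%N & stop y f k x.
Proof.
move=> y0 /(fmax_gt y0)[k kL yk].
have ex : exists k, y < cE k f x by exists k.
exists (ex_minn ex).
  by case: ex_minnP => m _ /(_ _ yk) mk; exact: leq_trans kL.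
case: ex_minnP => m ym H; split => // i im; rewrite leNgt; apply/negP => yi.
by have := H _ yi; rewrite leqNgt im.
Qed.

(* Splitting [fmax > y] at the first generation where the average of [f] exceeds
   [y], self-adjointness of [cE] moves that average onto [w]. *)
Lemma fmax_weak L f w (y : R) : (0 <= y)%R -> nnm f -> nnm w ->
  y%:E * \int[mu]_(x in [set x | y%:E < fmax L f x]) w x
  <= \int[mu]_x (f x * fmax L w x).
Proof.
move=> y0 hf hw.
have hi k : nnm (@ind _ T R (stop y%:E f k)) by exact: nnm_ind.
have hE k g : nnm g -> nnm (cE k g) by exact: nnm_cE.
have mM : measurable [set x | y%:E < fmax L f x] by apply: nnm_gt; exact: nnm_fmax.
rewrite -(nnm_int_ind mu mM hw) -nnm_intZ ?lee_fin//; last first.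
  by apply: nnmM => //; exact: nnm_ind.
apply: (@le_trans _ _ (\int[mu]_x \sum_(k < L.+1)
    (y%:E * (ind (stop y%:E f k) x * w x)))).
  apply: nnm_int_le.
  - by apply: nnmZ => //; apply: nnmM => //; exact: nnm_ind.
  - by apply: nnm_sum => k; apply: nnmZ => //; apply: nnmM.
  move=> x; rewrite -ge0_sume_distrr; last first.
    by move=> k _; apply: mule_ge0; [exact: (hi k).2|exact: hw.2].
  rewrite lee_wpmul2l ?lee_fin// -ge0_sume_distrl; last by move=> k _; exact: (hi k).2.
  apply: lee_wpmul2r; first exact: hw.2.
  have [yx|yx] := boolP (y%:E < fmax L f x); last first.
    by rewrite ind_gt (negbTE yx); apply: sume_ge0 => k _; exact: (hi k).2.
  have [k kL sk] := fmax_stop (y0 : 0 <= y%:E) yx.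
  rewrite ind_gt yx (bigD1 (inord k : 'I_L.+1))//= inordK ?ltnS// indT// leeDl//.
  by apply: sume_ge0 => i _; exact: (hi i).2.
rewrite nnm_int_sum; last by move=> k; apply: nnmZ => //; apply: nnmM.
apply: (@le_trans _ _ (\sum_(k < L.+1) \int[mu]_x
    (f x * (ind (stop y%:E f k) x * cE k w x)))).
  apply: lee_sum => k _.
  rewrite nnm_intZ ?lee_fin//; last exact: nnmM.
  have -> : \int[mu]_x (ind (stop y%:E f k) x * w x) =
            \int[mu]_x (ind (stop y%:E f k) x * cE k w x).
    rewrite -(@cE_adj _ _ _ _ F)//; apply: eq_integral => x _.
    by rewrite cE_id//; [exact: ind_stop_lvl|exact: (hi k).2].
  have hiw : nnm (fun x => ind (stop y%:E f k) x * cE k w x) by apply: nnmM => //; exact: hE.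
  rewrite -nnm_intZ ?lee_fin//.
  (* On the stopping set [y] is below the average of [f]; adjointness then turns that average back
     into [f]. *)
  apply: (@le_trans _ _ (\int[mu]_x (cE k f x * (ind (stop y%:E f k) x * cE k w x)))).
    apply: nnm_int_le; [exact: nnmZ|by apply: nnmM => //; exact: hE|] => x.
    have [sx|sx] := pselect (stop y%:E f k x); last by rewrite indF// mul0e !mule0.
    apply: lee_wpmul2r; first exact: hiw.2.
    by case: sx => /ltW.
  rewrite cE_adj//.
  apply: nnm_int_le; [by apply: nnmM => //; exact: hE|exact: nnmM|] => x.
  apply: lee_wpmul2l; first exact: hf.2.
  rewrite (@cE_pull _ _ _ _ F k (cE k w)) //.
  - by rewrite cE_tower.
  - exact: hE.
  - exact: ind_stop_lvl.
  - exact: (hi k).2.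
have hiw k : nnm (fun x => ind (stop y%:E f k) x * cE k w x) by apply: nnmM => //; exact: hE.
rewrite -nnm_int_sum; last by move=> k; exact: nnmM.
apply: nnm_int_le; [by apply: nnm_sum => k; exact: nnmM|by apply: nnmM => //; exact: nnm_fmax|] => x.
rewrite -ge0_sume_distrr; last by move=> k _; exact: (hiw k).2.
apply: lee_wpmul2l; first exact: hf.2.
(* At most one generation stops at [x], so the sum reduces to at most one average of [w]. *)
have [[k sk]|ns] := pselect (exists k : 'I_L.+1, stop y%:E f k x).
  rewrite (bigD1 k)//= big1 ?adde0; last first.
    move=> i ik; rewrite indF ?mul0e// => si.
    by move/eqP: ik; apply; apply/val_inj; exact: stop_uniq si sk.
  by rewrite indT// mul1e; apply: le_fmax; rewrite -ltnS.
rewrite big1 ?fmax_ge0// => i _; rewrite indF ?mul0e// => si.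
by apply: ns; exists i.
Qed.

(** The part of [f] not above [y] has averages at most [y], so where [fmax L f] exceeds [2 * y], the
    maximal function of the part above [y] still exceeds [y]. *)
Lemma fmax_weak_trunc L f w (y : R) : (0 < y)%R -> nnm f -> nnm w ->
  y%:E * \int[mu]_(x in [set x | (2 * y)%:E < fmax L f x]) w x
  <= \int[mu]_x (ind [set x | y%:E < f x] x * (f x * fmax L w x)).
Proof.
move=> y0 hf hw.
have hi : nnm (@ind _ T R [set x | y%:E < f x]) by apply: nnm_ind; exact: nnm_gt.
pose b x := ind [set x | y%:E < f x] x * f x.
have hb : nnm b by exact: nnmM.
rewrite [leRHS](_ : _ = \int[mu]_x (b x * fmax L w x)); last first.
  by apply: eq_integral => x _; rewrite muleA.
apply: le_trans (fmax_weak L (ltW y0) hb hw).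
apply: lee_wpmul2l; first by rewrite lee_fin ltW.
apply: ge0_subset_integral.
- by apply: nnm_gt; exact: nnm_fmax.
- by apply: nnm_gt; exact: nnm_fmax.
- exact: nnm_measurable.
- by move=> x _; exact: hw.2.
move=> x /= yx; rewrite ltNge; apply/negP => bx.
move: yx; rewrite ltNge => /negP; apply.
apply: (@le_trans _ _ (fmax L (fun x => b x + y%:E) x)).
  apply: fmax_mono => //.
    by apply: nnmD => //; apply: nnm_cst; rewrite lee_fin ltW.
  move=> z; rewrite /b; have [yz|yz] := boolP (y%:E < f z).
    by rewrite ind_gt yz mul1e leeDl// lee_fin ltW.
  by rewrite ind_gt (negbTE yz) mul0e add0e leNgt.
apply: le_trans (fmaxD L x hb _) _; first by apply: nnm_cst; rewrite lee_fin ltW.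
rewrite fmax_cst ?lee_fin ?(ltW y0)//.
by rewrite (_ : (2 * y)%R = (y + y)%R) ?EFinD ?leeD2r//; ring.
Qed.

End filtration_maximal.

Section fmax_strong.
Context d (T : measurableType d) (R : realType).
Variable mu : {measure set T -> \bar R}.
Implicit Types f g h w : T -> \bar R.

(** Marcinkiewicz interpolation by hand: slice [fmax] at heights [2 * 2 ^ k], bound each slice by
    [fmax_weak_trunc], and resum under the integral. The truncated bound spends one factor [2 ^ k],
    so [dyadic_le] is applied with exponent [r - 1], and the factor [f x] left in the integrand
    restores [r]. *)
Lemma fmax_strong (r : R) : (1 < r)%R -> exists C : R, (0 < C)%R /\
  forall (F : filtration mu) L f w, nnm f -> nnm w ->
  \int[mu]_x (fmax F L f x `^ r * w x) <=
  C%:E * \int[mu]_x (f x `^ r * fmax F L w x).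
Proof.
move=> r1; have r10 : (0 < r - 1)%R by rewrite subr_gt0.
have r0 : (0 < r)%R by exact: lt_trans r1.
have [C [C0 HC]] := dyadic_le r10.
exists (8 `^ r * C)%R; split; first by rewrite mulr_gt0 ?powR_gt0.
move=> F L f w hf hw.
have p0 k : (0 < 2 ^ k :> R)%R by rewrite exprz_gt0.
have hi (y : R) g : nnm g -> nnm (@ind _ T R [set x | y%:E < g x]).
  by move=> hg; apply: nnm_ind; exact: nnm_gt.
have hMf := nnm_fmax F L hf; have hMw := nnm_fmax F L hw.
have c0 k : (0 <= 8 `^ r * (2 ^ k) `^ r :> R)%R by rewrite mulr_ge0 ?powR_ge0.
have hMi k : nnm (fun x => ind [set x | (2 * 2 ^ k)%:E < fmax F L f x] x * w x).
  by apply: nnmM => //; exact: hi.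
have hfM : nnm (fun x => f x * fmax F L w x) by exact: nnmM.
have hfi k : nnm (fun x => ind [set x | (2 ^ k)%:E < f x] x * (f x * fmax F L w x)).
  by apply: nnmM => //; exact: hi.
have d0 k : (0 <= 8 `^ r * (2 ^ k) `^ (r - 1) :> R)%R by rewrite mulr_ge0 ?powR_ge0.
apply: (@le_trans _ _ (\int[mu]_x zsum (fun k => (8 `^ r * (2 ^ k) `^ r)%:E *
    (ind [set x | (2 * 2 ^ k)%:E < fmax F L f x] x * w x)))).
  apply: nnm_int_le.
  - by apply: nnmM => //; exact: nnm_pow.
  - by apply: nnm_zsum => k; exact: nnmZ.
  move=> x; apply: le_trans (lee_wpmul2r (hw.2 x) (dyadic_ge r0 (hMf.2 x))) _.
  have t0 k : 0 <= (8 `^ r * (2 ^ k) `^ r)%:E *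
      (if (2 * 2 ^ k)%:E < fmax F L f x then 1 else 0).
    by apply: mule_ge0; [rewrite lee_fin|case: ifP].
  rewrite -(zsumZr (hw.2 x) t0); apply: zsum_le => k; first by rewrite mule_ge0 ?hw.2.
  by rewrite -ind_gt muleA.
rewrite nnm_int_zsum; last by move=> k; exact: nnmZ.
apply: (@le_trans _ _ (zsum (fun k => \int[mu]_x ((8 `^ r * (2 ^ k) `^ (r - 1))%:E *
    (ind [set x | (2 ^ k)%:E < f x] x * (f x * fmax F L w x)))))).
  apply: zsum_le => k; first by apply: nnm_int_ge0; exact: nnmZ.
  rewrite !nnm_intZ ?lee_fin// (nnm_int_ind _ _ hw); last exact: nnm_gt.
  rewrite -(mulr_powRB1 (ltW (p0 k)) r0) mulrCA mulrC EFinM -muleA.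
  rewrite lee_wpmul2l ?lee_fin//.
  exact: fmax_weak_trunc.
rewrite -nnm_int_zsum; last by move=> k; exact: nnmZ.
rewrite -nnm_intZ; last 2 first.
- by rewrite lee_fin mulr_ge0 ?powR_ge0// ltW.
- by apply: nnmM => //; exact: nnm_pow.
apply: nnm_int_le.
- by apply: nnm_zsum => k; exact: nnmZ.
- by apply: nnmZ; [rewrite mulr_ge0 ?powR_ge0// ltW|apply: nnmM => //; exact: nnm_pow].
move=> x.
pose a k := ((2 ^ k) `^ (r - 1))%:E * (if (2 ^ k)%:E < f x then 1 else 0) : \bar R.
have a0 k : 0 <= a k by apply: mule_ge0; [rewrite lee_fin powR_ge0|case: ifP].
have fx0 := hf.2 x.
have wx0 := hfM.2 x.
have p8 : (0 <= 8 `^ r :> R)%R by exact: powR_ge0.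
apply: (@le_trans _ _ ((8 `^ r)%:E * (zsum a * (f x * fmax F L w x)))).
  rewrite -zsumZr// -zsumZ//; last by move=> k; apply: mule_ge0.
  apply: zsum_le => k; first by apply: (nnmZ (d0 k) (hfi k)).2.
  by rewrite EFinM ind_gt /a !muleA.
rewrite EFinM -!muleA lee_wpmul2l ?lee_fin//.
apply: (@le_trans _ _ ((C%:E * f x `^ (r - 1)) * (f x * fmax F L w x))).
  by rewrite lee_wpmul2r// HC.
rewrite -muleA lee_wpmul2l ?lee_fin ?(ltW C0)// muleA lee_wpmul2r ?hMw.2//.
rewrite -{2}(poweRe1 fx0) -poweRD ?subrK//.
by apply: add_neq0_poweRD_def; rewrite subrK gt_eqF.
Qed.

End fmax_strong.

(** * The sequence norm and its duality *)

Section lr_norm.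
Context (R : realType).

Definition lrnorm (r : R) (u : nat -> \bar R) : \bar R :=
  (\sum_(0 <= j <oo) u j `^ r) `^ r^-1.

Lemma nneseries_le_bound (u : nat -> \bar R) (y : \bar R) : (forall j, 0 <= u j) ->
  (forall N, \sum_(0 <= j < N) u j <= y) -> \sum_(0 <= j <oo) u j <= y.
Proof.
move=> u0 H; apply: lime_le; last exact: nearW.
by apply: is_cvg_nneseries => n _ _.
Qed.

Lemma poweR_le_linear (r M : R) (x : \bar R) : (1 < r)%R -> 0 <= x -> x <= M%:E ->
  x `^ r <= (M `^ (r - 1))%:E * x.
Proof.
move=> r1; case: x => [x| |] x0 xM; [|by rewrite leye_eq in xM|by []].
rewrite !lee_fin in x0 xM; rewrite poweR_EFin -EFinM lee_fin -(@mulr_powRB1 _ x r)//; last exact: lt_trans r1.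
rewrite mulrC ler_wpM2r// ge0_ler_powR ?nnegrE ?subr_ge0 ?(ltW r1)//.
exact: le_trans xM.
Qed.

Lemma poweRK (r : R) (x : \bar R) : (r != 0)%R -> 0 <= x -> (x `^ r) `^ r^-1 = x.
Proof. by move=> r0 x0; rewrite -poweRrM mulfV// poweRe1. Qed.

Lemma poweRVK (r : R) (x : \bar R) : (r != 0)%R -> 0 <= x -> (x `^ r^-1) `^ r = x.
Proof. by move=> r0 x0; rewrite -poweRrM mulVf// poweRe1. Qed.

Lemma poweR_lt (r : R) (x y : \bar R) : (0 < r)%R -> 0 <= x -> 0 <= y ->
  (x `^ r < y `^ r) = (x < y).
Proof.
move=> r0 x0 y0; apply/idP/idP => H; rewrite ltNge; apply/negP => H'.
  by move: H; rewrite ltNge poweR_le ?(ltW r0).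
suff : y <= x by rewrite leNgt H.
rewrite -(poweRe1 x0) -(poweRe1 y0) -(mulfV (lt0r_neq0 r0)) !poweRrM.
by apply: poweR_le; rewrite ?invr_ge0 ?(ltW r0) ?poweR_ge0.
Qed.

Lemma lrnorm_powK r u : (r != 0)%R ->
  lrnorm r u `^ r = \sum_(0 <= j <oo) u j `^ r.
Proof.
move=> r0; rewrite /lrnorm -poweRrM mulVf// poweRe1//.
by apply: nneseries_ge0 => i _ _; exact: poweR_ge0.
Qed.

Lemma lrnorm_ge0 r u : 0 <= lrnorm r u.
Proof. exact: poweR_ge0. Qed.

Lemma lrnorm_ge r u j : (0 < r)%R -> (forall j, 0 <= u j) -> u j <= lrnorm r u.
Proof.
move=> r0 u0; rewrite -[leLHS](poweRe1 (u0 j)) -(mulfV (lt0r_neq0 r0)) poweRrM.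
apply: poweR_le; rewrite ?invr_ge0 ?(ltW r0) ?poweR_ge0//.
by apply: (@nneseries_ge_term _ (fun j => u j `^ r)) => i; exact: poweR_ge0.
Qed.

Lemma lrnorm_le r u w : (0 < r)%R -> (forall j, 0 <= u j) ->
  (forall j, u j <= w j) -> lrnorm r u <= lrnorm r w.
Proof.
move=> r0 u0 uw; apply: poweR_le; first by rewrite invr_ge0 ltW.
  by apply: nneseries_ge0 => i _ _; exact: poweR_ge0.
apply: lee_nneseries => [i _ _|i _]; first exact: poweR_ge0.
by apply: poweR_le => //; exact: ltW.
Qed.

Lemma young_pow (r a b : R) : (1 < r -> 0 <= a -> 0 <= b ->
  a `^ (r - 1) * b <= (1 - r^-1) * a `^ r + r^-1 * b `^ r)%R.
Proof.
move=> r1 a0 b0; have r0 : (0 < r)%R by exact: lt_trans r1.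
have r10 : (0 < r - 1)%R by rewrite subr_gt0.
have rN : (r != 0)%R by rewrite gt_eqF.
have rN1 : (r - 1 != 0)%R by rewrite gt_eqF.
have := @conjugate_powR _ (a `^ (r - 1))%R b (r / (r - 1))%R r (powR_ge0 _ _) b0.
rewrite -powRrM [((r - 1) * _)%R]mulrC divfK// => H.
have E : ((r / (r - 1))^-1 + r^-1 = 1)%R.
  by rewrite invf_div -[X in (_ / _ + X)%R]mul1r -mulrDl subrK mulfV.
have {E} := H (divr_gt0 r0 r10) r0 E.
rewrite (_ : a `^ r / (r / (r - 1)) = (1 - r^-1) * a `^ r)%R ?[(b `^ r / r)%R]mulrC//.
by field; rewrite rN rN1.
Qed.

Lemma powRV (t r : R) : (0 <= t -> t^-1 `^ r = (t `^ r)^-1)%R.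
Proof. by move=> t0; rewrite -powR_inv1// -powRrM mulN1r powRN. Qed.

Lemma powR_div (b t r : R) : (0 <= b -> 0 <= t -> (b / t) `^ r = b `^ r / t `^ r)%R.
Proof. by move=> b0 t0; rewrite powRM ?invr_ge0// powRV. Qed.

(** Hoelder's inequality prepared for duality: the weights, powers [r - 1] of [a j], have norm [S]
    to the power [1 - r^-1] in the conjugate sequence space. *)
Lemma lrnorm_weighted (r S : R) (a : nat -> R) (u : nat -> \bar R) N : (1 < r)%R ->
  (forall j, 0 <= a j)%R -> (forall j, 0 <= u j) ->
  (\sum_(0 <= j < N) a j `^ r)%R = S -> (0 < S)%R ->
  \sum_(0 <= j < N) (a j `^ (r - 1))%:E * u j <= (S `^ (1 - r^-1))%:E * lrnorm r u.
Proof.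
move=> r1 a0 u0 SE S0.
have r0 : (0 < r)%R by exact: lt_trans r1.
have rN : (r != 0)%R by rewrite gt_eqF.
have Sp : (0 < S `^ (1 - r^-1))%R by rewrite powR_gt0.
move: (lrnorm_ge0 r u); case E : (lrnorm r u) => [F| |]// F0; last first.
  by rewrite gt0_muley ?lte_fin// leey.
rewrite lee_fin in F0.
have uF j : u j <= F%:E by rewrite -E; exact: lrnorm_ge.
have {uF} [b ub] : exists b : nat -> R, u = EFin \o b.
  exists (fine \o u); apply/funext => j /=; rewrite fineK// fin_numElt.
  by rewrite (lt_le_trans _ (u0 j))// (le_lt_trans (uF j))// ltry.
have b0 j : (0 <= b j)%R by have := u0 j; rewrite ub lee_fin.
have Fb : (\sum_(0 <= j < N) b j `^ r <= F `^ r)%R.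
  rewrite -lee_fin -poweR_EFin -E lrnorm_powK// -sumEFin.
  rewrite (eq_bigr (fun j => u j `^ r)); last by move=> j _; rewrite ub.
  by apply: nneseries_lim_ge => j _ _; exact: poweR_ge0.
rewrite ub /=; under eq_bigr do rewrite -EFinM.
rewrite sumEFin -EFinM lee_fin.
move: F0; rewrite le_eqVlt => /orP[/eqP F0|F0].
  rewrite -F0 mulr0 big1// => j _; have := @lrnorm_ge r u j r0 u0.
  by rewrite E -F0 ub /= lee_fin => bj; rewrite (_ : b j = 0%R) ?mulr0//; apply: le_anti; rewrite bj b0.
(* This scaling balances Young's inequality: the [r]-th powers of [b j / t] add up to at most [S],
   the sum of those of [a j]. *)
pose t := (F / S `^ r^-1)%R.
have t0 : (0 < t)%R by rewrite divr_gt0// powR_gt0.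
apply: (@le_trans _ _ (\sum_(0 <= j < N) t * ((1 - r^-1) * a j `^ r + r^-1 * (b j `^ r / t `^ r))))%R.
  apply: ler_sum => j _.
  have := @young_pow r (a j) (b j / t)%R r1 (a0 j) (divr_ge0 (b0 j) (ltW t0)).
  move=> /(ler_wpM2l (ltW t0)); rewrite mulrCA (mulrC t (b j / t)%R) divfK ?gt_eqF// => /le_trans; apply.
  by rewrite powR_div// ltW.
rewrite -mulr_sumr big_split /= -!mulr_sumr -mulr_suml SE.
have tr : (t `^ r = F `^ r / S)%R.
  by rewrite /t powR_div ?powR_ge0 ?(ltW F0)// -powRrM mulVf// powRr1 ?(ltW S0).
have Fr : (0 < F `^ r)%R by rewrite powR_gt0.
have bS : ((\sum_(0 <= i < N) b i `^ r) / t `^ r <= S)%R.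
  by rewrite tr invf_div mulrA ler_pdivrMr// mulrC ler_wpM2l// ltW.
apply: (@le_trans _ _ (t * ((1 - r^-1) * S + r^-1 * S)))%R.
  by rewrite ler_wpM2l ?(ltW t0)// lerD2l ler_wpM2l// invr_ge0 ltW.
rewrite -mulrDl subrK mul1r /t powRB ?powRr1 ?(ltW S0)//; last by rewrite (lt0r_neq0 S0) implybT.
by rewrite mulrAC [leRHS]mulrAC (mulrC S).
Qed.

End lr_norm.

(** * Vector-valued inequalities for a filtration *)

Section vector_maximal.
Context d (T : measurableType d) (R : realType).
Variable mu : {measure set T -> \bar R}.
Variable F : filtration mu.
Local Notation cE := (cE F).
Local Notation lvl := (lvl F).
Local Notation fmax := (fmax F).
Local Notation stop := (stop F).
Implicit Types (g h w : T -> \bar R) (f : nat -> T -> \bar R).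

Lemma nnm_lrnorm r f : (forall j, nnm (f j)) -> nnm (fun x => lrnorm r (f ^~ x)).
Proof. by move=> hf; apply: nnm_pow; apply: nnm_series => j; exact: nnm_pow. Qed.

(** Minkowski's integral inequality by duality: the averages [a j] are tested against their own
    powers [r - 1], and [lrnorm_weighted] is applied under the average. *)
Lemma lrnorm_cE r k f x : (1 < r)%R -> (forall j, nnm (f j)) ->
  lrnorm r (fun j => cE k (f j) x) <= cE k (fun y => lrnorm r (f ^~ y)) x.
Proof.
move=> r1 hf; have r0 : (0 < r)%R by exact: lt_trans r1.
set N := fun y => lrnorm r (f ^~ y).
have hN : nnm N by exact: nnm_lrnorm.
have fN j : cE k (f j) x <= cE k N x.
  by apply: cE_le => // y; apply: (@lrnorm_ge _ r (f ^~ y)) => // i; exact: (hf i).2.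
have cE0 j : 0 <= cE k (f j) x by exact: (nnm_cE F k (hf j)).2.
move: (cE_ge0 F k x hN.2) fN; case EN : (cE k N x) => [M| |]// M0 fN; last by rewrite leey.
rewrite lee_fin in M0.
have [a aE] : exists a : nat -> R, forall j, cE k (f j) x = (a j)%:E.
  exists (fun j => fine (cE k (f j) x)) => j; rewrite fineK// fin_numElt.
  by rewrite (lt_le_trans _ (cE0 j))// (le_lt_trans (fN j))// ltry.
have a0 j : (0 <= a j)%R by rewrite -lee_fin -aE.
rewrite -[leRHS]poweRe1 ?lee_fin// -(mulfV (lt0r_neq0 r0)) poweRrM.
apply: poweR_le; first by rewrite invr_ge0 ltW.
  by apply: nneseries_ge0 => i _ _; exact: poweR_ge0.
apply: nneseries_le_bound => [j|n]; first exact: poweR_ge0.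
under eq_bigr do rewrite aE poweR_EFin.
rewrite sumEFin poweR_EFin lee_fin.
set S := (\sum_(0 <= j < n) a j `^ r)%R.
have : (0 <= S)%R by apply: sumr_ge0 => j _; exact: powR_ge0.
rewrite le_eqVlt => /orP[/eqP <-|S0]; first exact: powR_ge0.
have H : (S <= S `^ (1 - r^-1) * M)%R.
  rewrite -lee_fin.
  have hs j : nnm (fun y => (a j `^ (r - 1))%:E * f j y) by apply: nnmZ; [exact: powR_ge0|].
  have -> : S%:E = cE k (fun y => \sum_(0 <= j < n) (a j `^ (r - 1))%:E * f j y) x.
    rewrite cE_sum// -sumEFin; apply: eq_bigr => j _.
    by rewrite cEZ ?lee_fin ?powR_ge0// aE -EFinM mulrC mulr_powRB1.
  rewrite EFinM -EN -cEZ ?lee_fin ?powR_ge0//.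
  apply: cE_le.
  - exact: nnm_sum.
  - by apply: nnmZ => //; exact: powR_ge0.
  move=> y; apply: (@lrnorm_weighted _ r S a (f ^~ y) n) => // j; exact: (hf j).2.
(* A partial sum [S] is finite and positive here, so its power [1 - r^-1] can be divided out. *)
have {H}: (S `^ r^-1 <= M)%R.
  have p0 : (0 < S `^ (1 - r^-1))%R by rewrite powR_gt0.
  rewrite -(ler_pM2l p0) -powRD ?subrK ?powRr1 ?(ltW S0)//.
  by rewrite (lt0r_neq0 S0) implybT.
move=> /(ge0_ler_powR (ltW r0)); rewrite !nnegrE powR_ge0 M0 => /(_ isT isT).
by rewrite -powRrM mulVf ?lt0r_neq0// powRr1// ltW.
Qed.

Lemma cE_parent k h x : nnm h -> cE k.+1 h x <= (fdbl F)%:E * cE k h x.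
Proof.
move=> hh; rewrite /cE.
have v0 := fvol_gt0 F k; have v1 := fvol_gt0 F k.+1.
rewrite muleA -EFinM; apply: lee_pmul.
- by rewrite lee_fin invr_ge0 ltW.
- exact: nnm_int_ge0.
- by rewrite lee_fin ler_pdivlMr// mulrC ler_pdivrMr// fvolS.
apply: ge0_subset_integral.
- exact: measurable_fcell.
- exact: measurable_fcell.
- exact: nnm_measurable.
- by move=> y _; exact: hh.2.
by move=> y /=; exact: fcellS.
Qed.

(* Conditional expectation at the first generation [k <= L] whose average of
   [g] exceeds [y], or at generation [L] when there is none. *)
Definition stopE L (y : R) g h x : \bar R :=
  \sum_(k < L.+1) ind (stop y%:E g k) x * cE k h x +
  ind [set x | fmax L g x <= y%:E] x * cE L h x.

Section stopE.
Variables (L : nat) (y : R) (g : T -> \bar R).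
Hypothesis y0 : (0 <= y)%R.
Hypothesis hg : nnm g.
Local Notation Om := [set x | fmax L g x <= y%:E].

Let hi k : nnm (@ind _ T R (stop y%:E g k)).
Proof. by apply: nnm_ind; exact: measurable_stop. Qed.

Let hO : nnm (@ind _ T R Om).
Proof. by apply: nnm_ind; apply: nnm_le; exact: nnm_fmax. Qed.

Lemma nnm_stopE h : nnm h -> nnm (stopE L y g h).
Proof.
move=> hh; apply: nnmD; last by apply: nnmM => //; exact: nnm_cE.
by apply: nnm_sum => k; apply: nnmM => //; exact: nnm_cE.
Qed.

Lemma ind_noncross_lvl : lvl L (@ind _ T R Om).
Proof.
move=> x x' xx'; rewrite /ind !indicE (_ : (x \in Om) = (x' \in Om))//.
have E : fmax L g x = fmax L g x'.
  by apply: eq_bigr => k _; apply: cE_lvl; apply: cell_le xx'; rewrite -ltnS.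
by apply/idP/idP => /set_mem h; apply/mem_set; move: h; rewrite /= E.
Qed.

Lemma stopE_crossed k h x : (k <= L)%N -> stop y%:E g k x -> stopE L y g h x = cE k h x.
Proof.
move=> kL sk; rewrite /stopE [X in _ + X](_ : _ = 0); last first.
  rewrite indF ?mul0e//= => /(le_trans (le_fmax F g x kL)).
  by rewrite leNgt; case: sk => ->.
rewrite adde0 (bigD1 (Ordinal (kL : (k < L.+1)%N)))//= indT// mul1e big1 ?adde0// => i ik.
rewrite indF ?mul0e// => si; move/eqP: ik; apply; apply/val_inj => /=.
exact: stop_uniq si sk.
Qed.

Lemma stopE_noncrossed h x : fmax L g x <= y%:E -> stopE L y g h x = cE L h x.
Proof.
move=> gx; rewrite /stopE big1 ?add0e; last first.
  move=> k _; rewrite indF ?mul0e// => -[yk _].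
  have kL : (k <= L)%N by rewrite -ltnS.
  by have := le_trans (le_fmax F g x kL) gx; rewrite leNgt yk.
by rewrite indT// mul1e.
Qed.

Lemma stopE_cases (P : \bar R -> Prop) h x :
  (forall k, (k <= L)%N -> stop y%:E g k x -> P (cE k h x)) ->
  (fmax L g x <= y%:E -> P (cE L h x)) -> P (stopE L y g h x).
Proof.
move=> H1 H2; have [gx|gx] := leP (fmax L g x) y%:E.
  by rewrite stopE_noncrossed//; exact: H2.
have [k kL sk] := fmax_stop (y0 : 0 <= y%:E) gx.
by rewrite (stopE_crossed _ kL sk); exact: H1.
Qed.

(** Every average of the constant 1 is 1, so [stopE_cases] at that function is exactly this
    partition of unity. *)
Lemma ind_stop_decomp x :
  \sum_(k < L.+1) ind (stop y%:E g k) x + ind Om x = 1 :> \bar R.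
Proof.
have := @stopE_cases (fun z => z = 1) (fun=> 1) x.
rewrite /stopE => H; rewrite -[RHS]H; last 2 first.
- by move=> *; rewrite cE_cst.
- by move=> *; rewrite cE_cst.
rewrite cE_cst// mule1; congr (_ + _); apply: eq_bigr => k _.
by rewrite cE_cst// mule1.
Qed.

(** Each average is multiplied by an indicator of its own generation, so adjointness undoes the
    averaging piece by piece, and the pieces partition the space. *)
Lemma stopE_int h : nnm h -> \int[mu]_x stopE L y g h x = \int[mu]_x h x.
Proof.
move=> hh.
have hE k : nnm (cE k h) by exact: nnm_cE.
rewrite /stopE nnm_intD; last 2 first.
- by apply: nnm_sum => k; exact: nnmM.
- exact: nnmM.
rewrite nnm_int_sum; last by move=> k; exact: nnmM.
transitivity (\sum_(k < L.+1) \int[mu]_x (ind (stop y%:E g k) x * h x) +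
   \int[mu]_x (ind Om x * h x)).
  congr (_ + _).
    apply: eq_bigr => k _; rewrite -cE_adj//; apply: eq_integral => x _.
    by rewrite cE_id//; [exact: ind_stop_lvl|exact: (hi k).2].
  rewrite -cE_adj//; apply: eq_integral => x _.
  by rewrite cE_id//; [exact: ind_noncross_lvl|exact: hO.2].
rewrite -nnm_int_sum; last by move=> k; exact: nnmM.
rewrite -nnm_intD; last 2 first.
- by apply: nnm_sum => k; exact: nnmM.
- exact: nnmM.
apply: eq_integral => x _.
rewrite -ge0_sume_distrl; last by move=> k _; exact: (hi k).2.
rewrite -ge0_muleDl ?ind_stop_decomp ?mul1e//; last exact: hO.2.
by apply: sume_ge0 => k _; exact: (hi k).2.
Qed.

(** Pieces stopped at a generation [l >= k] are averaged back by [cE_tower]. Pieces with [l < k] are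
    unions of cells of generation [k] that miss [x], since no average of [g] at [x] crosses the
    height. *)
Lemma cE_stopE h k x : nnm h -> (k <= L)%N -> fmax L g x <= y%:E ->
  cE k (stopE L y g h) x = cE k h x.
Proof.
move=> hh kL gx.
have hE l : nnm (cE l h) by exact: nnm_cE.
have hO0 := hO.2.
rewrite /stopE cED; last 2 first.
- by apply: nnm_sum => l; exact: nnmM.
- exact: nnmM.
rewrite cE_sum; last by move=> l; exact: nnmM.
transitivity (\sum_(l < L.+1) cE k (fun x => ind (stop y%:E g l) x * h x) x +
    cE k (fun x => ind Om x * h x) x).
  congr (_ + _); last first.
    rewrite -[RHS](@cE_tower _ _ _ _ _ k L)//; last exact: nnmM.
    apply: (congr1 (fun w => cE k w x)); apply/funext => z.
    by rewrite cE_pull//; exact: ind_noncross_lvl.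
  apply: eq_bigr => l _.
  have hi0 := (hi l).2.
  have [kl|lk] := leqP k l.
    rewrite -[RHS](@cE_tower _ _ _ _ _ k l)//; last exact: nnmM.
    apply: (congr1 (fun w => cE k w x)); apply/funext => z.
    by rewrite cE_pull//; exact: ind_stop_lvl.
  have nsl : ~ stop y%:E g l x.
    move=> [yl _]; have lL : (l <= L)%N by rewrite -ltnS.
    by have := le_trans (le_fmax F g x lL) gx; rewrite leNgt yl.
  have sl : lvl k (ind (stop y%:E g l) : T -> \bar R).
    by apply: lvl_le (ltnW lk) _; exact: ind_stop_lvl.
  rewrite (cE_pull (hE l) sl hi0) (cE_pull hh sl hi0).
  by rewrite indF// !mul0e.
transitivity (cE k (fun z => \sum_(l < L.+1) (ind (stop y%:E g l) z * h z)) x +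
    cE k (fun z => ind Om z * h z) x).
  by rewrite cE_sum// => l; exact: nnmM.
rewrite -cED; last 2 first.
- by apply: nnm_sum => l; exact: nnmM.
- exact: nnmM.
apply: (congr1 (fun w => cE k w x)); apply/funext => z.
rewrite -ge0_sume_distrl; last by move=> l _; exact: (hi l).2.
rewrite -ge0_muleDl ?ind_stop_decomp ?mul1e//.
by apply: sume_ge0 => l _; exact: (hi l).2.
Qed.

(** Just before the first crossing the parent average was at most [y], and passing to the child
    costs the factor [fdbl F]. The hypothesis excludes a crossing at generation 0; the maximum with
    1 covers points that never cross. *)
Lemma stopE_bound x : (forall x, cE 0 g x <= y%:E) ->
  stopE L y g g x <= (Num.max 1 (fdbl F) * y)%:E.
Proof.
move=> g0; apply: (@stopE_cases (fun z => z <= _)) => [k kL [yk Hk]|gx].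
  case: k kL yk Hk => [_|k kL yk Hk]; first by rewrite ltNge g0.
  apply: le_trans (cE_parent k x hg) _.
  have d0 : (0 <= fdbl F)%R.
    rewrite -(pmulr_lge0 _ (fvol_gt0 F 1)); apply: le_trans (fvolS F 0).
    exact/ltW/fvol_gt0.
  rewrite EFinM; apply: lee_pmul; rewrite ?lee_fin ?cE_ge0 ?le_max ?lexx ?orbT//; first exact: hg.2.
  exact: Hk.
apply: le_trans (le_fmax F g x (leqnn L)) _; apply: le_trans gx _.
by rewrite lee_fin ler_peMl// le_max lexx.
Qed.

End stopE.

End vector_maximal.

(** * Endpoint bounds for the vector-valued maximal function *)

Section weak_type.
Context d (T : measurableType d) (R : realType).
Variable mu : {measure set T -> \bar R}.
Implicit Types (g h w : T -> \bar R) (f : nat -> T -> \bar R).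

Lemma chebyshev (y : R) h : (0 <= y)%R -> nnm h ->
  y%:E * mu [set x | y%:E < h x] <= \int[mu]_x h x.
Proof.
move=> y0 hh; have mA : measurable [set x | y%:E < h x] by exact: nnm_gt.
have hA : nnm (@ind _ T R [set x | y%:E < h x]) by exact: nnm_ind.
rewrite -nnm_int_indT// -nnm_intZ ?lee_fin//.
apply: nnm_int_le => //; first exact: nnmZ.
move=> x; rewrite ind_gt; case: ifPn => [/ltW|_]; first by rewrite mule1.
by rewrite mule0; exact: hh.2.
Qed.

(** The exponent equals the index of the sequence norm, so the scalar inequality [fmax_strong] can
    be summed over [j]. *)
Lemma vec_strong (r : R) : (1 < r)%R -> exists C : R, (0 < C)%R /\
  forall (F : filtration mu) L f w, (forall j, nnm (f j)) -> nnm w ->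
  \int[mu]_x (lrnorm r (fun j => fmax F L (f j) x) `^ r * w x) <=
  C%:E * \int[mu]_x (lrnorm r (f ^~ x) `^ r * fmax F L w x).
Proof.
move=> r1; have r0 : (r != 0)%R by rewrite gt_eqF// (lt_trans _ r1).
have [C [C0 HC]] := @fmax_strong _ _ _ mu _ r1; exists C; split => // F L f w hf hw.
have hMw := nnm_fmax F L hw.
have hMf j := nnm_fmax F L (hf j).
have -> : \int[mu]_x (lrnorm r (fun j => fmax F L (f j) x) `^ r * w x) =
    \sum_(0 <= j <oo) \int[mu]_x (fmax F L (f j) x `^ r * w x).
  rewrite -nnm_int_series; last by move=> j; apply: nnmM => //; exact: nnm_pow.
  apply: eq_integral => x _; rewrite lrnorm_powK// nneseriesZr; [by []|exact: hw.2|].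
  by move=> j; exact: poweR_ge0.
have -> : \int[mu]_x (lrnorm r (f ^~ x) `^ r * fmax F L w x) =
    \sum_(0 <= j <oo) \int[mu]_x (f j x `^ r * fmax F L w x).
  rewrite -nnm_int_series; last by move=> j; apply: nnmM => //; exact: nnm_pow.
  apply: eq_integral => x _; rewrite lrnorm_powK// nneseriesZr; [by []|exact: hMw.2|].
  by move=> j; exact: poweR_ge0.
rewrite -nneseriesZl; last first.
  by move=> j _; apply: nnm_int_ge0; apply: nnmM => //; exact: nnm_pow.
apply: lee_nneseries => [j _ _|j _]; last exact: HC.
by apply: nnm_int_ge0; apply: nnmM => //; exact: nnm_pow.
Qed.

(* Replacing [f j] by its conditional expectation at the stopping time of the
   [l^r] norm does not change the maximal functions before stopping, and bounds
   the norm by a multiple of [y]; then [vec_strong] with [w = 1] applies. *)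
Lemma vec_weak11 (r A : R) : (1 < r)%R -> exists C : R, (0 < C)%R /\
  forall (F : filtration mu) L f (y : R), fdbl F = A ->
  (forall j, nnm (f j)) -> (0 < y)%R ->
  (forall x, cE F 0 (fun x => lrnorm r (f ^~ x)) x <= y%:E) ->
  y%:E * mu [set x | y%:E < lrnorm r (fun j => fmax F L (f j) x)]
  <= C%:E * \int[mu]_x lrnorm r (f ^~ x).
Proof.
move=> r1; have r0 : (0 < r)%R by exact: lt_trans r1.
have rN : (r != 0)%R by rewrite gt_eqF.
have [C [C0 HC]] := vec_strong r1.
pose D := Num.max 1%R A.
have D1 : (1 <= D)%R by rewrite le_max lexx.
have D0 : (0 < D)%R by exact: lt_le_trans D1.
exists (1 + C * D `^ (r - 1))%R; split.
  by rewrite addr_gt0// mulr_gt0// powR_gt0.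
move=> F L f y FA hf y0 Ey.
set N := fun x => lrnorm r (f ^~ x).
have hN : nnm N by exact: nnm_lrnorm.
pose g j := stopE F L y N (f j).
have hg j : nnm (g j) by exact: nnm_stopE.
have hGf : nnm (fun x => lrnorm r (fun j => fmax F L (f j) x)).
  by apply: (@nnm_lrnorm _ _ _ r (fun j => fmax F L (f j))) => j; exact: nnm_fmax.
have hGg : nnm (fun x => lrnorm r (fun j => fmax F L (g j) x)).
  by apply: (@nnm_lrnorm _ _ _ r (fun j => fmax F L (g j))) => j; exact: nnm_fmax.
(* [Om] is where a crossing occurs. Outside it the averages of [f j] and [g j] agree, so a large
   maximal norm there puts the point in [S]. *)
pose Om := [set x | y%:E < fmax F L N x].
pose S := [set x | y%:E < lrnorm r (fun j => fmax F L (g j) x)].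
have mOm : measurable Om by apply: nnm_gt; exact: nnm_fmax.
have mS : measurable S by exact: nnm_gt.
have sub : [set x | y%:E < lrnorm r (fun j => fmax F L (f j) x)] `<=` Om `|` S.
  move=> x /= yx; have [nx|] := leP (fmax F L N x) y%:E; last by left.
  right; rewrite /S/=; apply: lt_le_trans yx _; apply: lrnorm_le => // [j|j].
    exact: fmax_ge0.
  apply: fmax_le => [|k kL]; first exact: fmax_ge0.
  rewrite -(cE_stopE (ltW y0) hN (hf j) kL nx).
  exact: le_fmax.
have muU : mu [set x | y%:E < lrnorm r (fun j => fmax F L (f j) x)] <= mu Om + mu S.
  apply: (@le_trans _ _ (mu (Om `|` S))); last exact: measureU2.
  apply: le_measure; [apply/mem_set|apply/mem_set|exact: sub].
  - exact: nnm_gt.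
  - exact: measurableU.
apply: le_trans (lee_wpmul2l _ muU) _; first by rewrite lee_fin ltW.
rewrite ge0_muleDr// EFinD ge0_muleDl ?lee_fin ?mulr_ge0 ?powR_ge0 ?(ltW C0)//.
apply: leeD.
  have := fmax_weak F L (ltW y0) hN (nnm_cst _ lee01).
  rewrite integral_cst// mul1e => /le_trans; apply.
  rewrite mul1e; apply: nnm_int_le => //.
    by apply: nnmM => //; apply: nnm_fmax; exact: nnm_cst.
  by move=> x; rewrite fmax_cst// mule1.
(* After multiplication by this power, Chebyshev applies to [r]-th powers. The matching power of
   [D * y] appears on the right when [poweR_le_linear] bounds the [r]-th power of the stopped
   norm. *)
have yr : (0 < y `^ (r - 1))%R by rewrite powR_gt0.
rewrite -(@lee_pmul2l _ (y `^ (r - 1))%:E)// ?lte_fin//.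
rewrite [leLHS](_ : _ = (y `^ r)%:E * mu S); last first.
  by rewrite muleA -EFinM mulrC mulr_powRB1// ltW.
have SE : S = [set x | (y `^ r)%:E < lrnorm r (fun j => fmax F L (g j) x) `^ r].
  apply/seteqP; split => x; rewrite /S /= -poweR_EFin poweR_lt ?lee_fin ?(ltW y0)//;
    exact: lrnorm_ge0.
have hGr : nnm (fun x => lrnorm r (fun j => fmax F L (g j) x) `^ r) by exact: nnm_pow.
rewrite SE; apply: le_trans (chebyshev (powR_ge0 y r) hGr) _.
have := HC F L g (fun=> 1) hg (nnm_cst _ lee01).
under eq_integral do rewrite mule1.
move=> /le_trans; apply.
have hS := nnm_stopE F L y hN hN.
apply: (@le_trans _ _ (C%:E * \int[mu]_x (((D * y) `^ (r - 1))%:E * stopE F L y N N x))).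
  apply: lee_wpmul2l; first by rewrite lee_fin ltW.
  apply: nnm_int_le.
  - apply: nnmM; first by apply: nnm_pow; exact: nnm_lrnorm.
    by apply: nnm_fmax; exact: nnm_cst.
  - by apply: nnmZ => //; exact: powR_ge0.
  move=> x; rewrite fmax_cst// mule1.
  apply: (@le_trans _ _ (stopE F L y N N x `^ r)).
    apply: poweR_le; rewrite ?(ltW r0) ?lrnorm_ge0//.
    have [nx|nx] := leP (fmax F L N x) y%:E.
      rewrite stopE_noncrossed// /g.
      rewrite (_ : (fun j => _) = fun j => cE F L (f j) x); first exact: lrnorm_cE.
      by apply/funext => j; rewrite stopE_noncrossed.
    have [k kL sk] := fmax_stop (ltW y0 : 0 <= y%:E) nx.
    rewrite (stopE_crossed _ kL sk).
    rewrite (_ : (fun j => _) = fun j => cE F k (f j) x); first exact: lrnorm_cE.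
    by apply/funext => j; rewrite /g (stopE_crossed _ kL sk).
  apply: poweR_le_linear => //; first exact: hS.2.
  by rewrite /D -FA; exact: (stopE_bound L (ltW y0) hN x Ey).
rewrite nnm_intZ ?lee_fin ?powR_ge0// stopE_int//.
rewrite powRM ?(ltW D0) ?(ltW y0)// !muleA -!EFinM.
by rewrite mulrA [(y `^ (r - 1) * _)%R]mulrC.
exact: ltW.
Qed.

(* Duality: [vec_strong] with [w] the indicator of [E], whose maximal function is
   bounded in the conjugate space. Finiteness of [mu E] permits absorption. *)
Lemma vec_weak_high_fin (r p : R) : (1 < r)%R -> (1 < p)%R -> exists C : R, (0 < C)%R /\
  forall (F : filtration mu) L f (y : R) (E : set T), (forall j, nnm (f j)) -> (0 < y)%R ->
  measurable E -> mu E < +oo ->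
  E `<=` [set x | y%:E < lrnorm r (fun j => fmax F L (f j) x)] ->
  (y `^ (r * p))%:E * mu E <= C%:E * \int[mu]_x lrnorm r (f ^~ x) `^ (r * p).
Proof.
move=> r1 p1; have r0 : (0 < r)%R by exact: lt_trans r1.
have p0 : (0 < p)%R by exact: lt_trans p1.
have p10 : (0 < p - 1)%R by rewrite subr_gt0.
pose p' := (p / (p - 1))%R.
have p'1 : (1 < p')%R by rewrite /p' ltr_pdivlMr// mul1r ltrBlDr ltrDl.
have [C1 [C10 H1]] := vec_strong r1.
have [C2 [C20 H2]] := @fmax_strong _ _ _ mu _ p'1.
(* Chosen so that, at [a = y ^ r / K] in [key], the term containing [C2 * e] is half of the left
   side. *)
pose K := (2 * (C1 * C2))%R.
have K0 : (0 < K)%R by rewrite !mulr_gt0.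
exists (K `^ (p - 1) * (2 * C1))%R; split.
  by rewrite !mulr_gt0// powR_gt0.
move=> F L f y E hf y0 mE Efin Ey.
set N := fun x => lrnorm r (f ^~ x).
have hN : nnm N by exact: nnm_lrnorm.
have hE : nnm (@ind _ T R E) by exact: nnm_ind.
have hM := nnm_fmax F L hE.
set I := \int[mu]_x N x `^ (r * p).
have I0 : 0 <= I by apply: nnm_int_ge0; exact: nnm_pow.
pose e := fine (mu E).
have eE : mu E = e%:E by rewrite fineK// ge0_fin_numE.
have e0 : (0 <= e)%R by exact: fine_ge0.
rewrite eE.
(* Weighted Young inequality: whichever of [x] and [a * z ^ (p' - 1)] is larger decides which term
   on the right dominates. The bound [m <= 1] makes [m] finite. *)
have young (a : R) (x m : \bar R) : (0 < a)%R -> 0 <= x -> 0 <= m -> m <= 1 ->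
    x * m <= (a `^ (1 - p))%:E * x `^ p + a%:E * m `^ p'.
  move=> a0 + m0 m1; case: x => [x| |] x0; last by [].
  - have {m1} [z mz] : exists z, m = z%:E.
      by exists (fine m); rewrite fineK// fin_numElt (lt_le_trans _ m0)// (le_lt_trans m1)// ltry.
    rewrite mz lee_fin in m0 *; rewrite lee_fin in x0.
    rewrite !poweR_EFin -!EFinM -EFinD lee_fin.
    have pp : ((p' - 1) * (p - 1) = 1)%R by rewrite /p'; field; rewrite gt_eqF.
    have p'0 : (0 < p')%R by exact: lt_trans p'1.
    have [xm|xm] := leP x (a * z `^ (p' - 1))%R.
      apply: (@le_trans _ _ (a * z `^ p')%R); last by rewrite lerDr mulr_ge0 ?powR_ge0.
      by rewrite -(mulr_powRB1 m0 p'0) mulrCA mulrC ler_wpM2l.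
    apply: (@le_trans _ _ (a `^ (1 - p) * x `^ p)%R); last first.
      by rewrite lerDl mulr_ge0 ?powR_ge0 ?(ltW a0).
    rewrite -opprB powRN -(mulr_powRB1 x0 p0) mulrCA ler_wpM2l//.
    rewrite mulrC -powR_div// ?(ltW a0)//.
    apply: (@le_trans _ _ ((z `^ (p' - 1)) `^ (p - 1)))%R.
      by rewrite -powRrM pp powRr1.
    rewrite ge0_ler_powR ?nnegrE ?powR_ge0 ?(ltW p10)//.
      by rewrite divr_ge0// ltW.
    by rewrite ler_pdivlMr// mulrC ltW.
  - rewrite poweRyr ?gt_eqF// gt0_muley ?lte_fin ?powR_gt0//.
    rewrite addye ?leey// gt_eqF// (@lt_le_trans _ _ 0)// mule_ge0 ?poweR_ge0//.
    by rewrite lee_fin ltW.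
have key (a : R) : (0 < a)%R ->
    (y `^ r * e)%:E <= C1%:E * ((a `^ (1 - p))%:E * I + (a * (C2 * e))%:E).
  move=> a0.
  apply: (@le_trans _ _ (\int[mu]_x (lrnorm r (fun j => fmax F L (f j) x) `^ r * ind E x))).
    rewrite EFinM -eE -nnm_int_indT// -nnm_intZ ?lee_fin ?powR_ge0//.
    apply: nnm_int_le.
    - by apply: nnmZ => //; exact: powR_ge0.
    - apply: nnmM => //; apply: nnm_pow.
      by apply: (@nnm_lrnorm _ _ _ r (fun j => fmax F L (f j))) => j; exact: nnm_fmax.
    move=> x; have [Ex|Ex] := pselect (E x); last by rewrite indF// !mule0.
    rewrite indT// !mule1 -poweR_EFin; apply: poweR_le; rewrite ?(ltW r0) ?lee_fin ?(ltW y0)//.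
    exact/ltW/Ey.
  apply: (le_trans (H1 F L f _ hf hE)); rewrite lee_wpmul2l ?lee_fin ?(ltW C10)//.
  apply: (@le_trans _ _ (\int[mu]_x ((a `^ (1 - p))%:E * N x `^ (r * p) +
      a%:E * fmax F L (ind E) x `^ p'))).
    apply: nnm_int_le.
    - by apply: nnmM => //; exact: nnm_pow.
    - apply: nnmD; apply: nnmZ; rewrite ?powR_ge0 ?(ltW a0)//; exact: nnm_pow.
    move=> x; rewrite poweRrM; apply: young => //; rewrite ?poweR_ge0 ?fmax_ge0//.
    apply: (@le_trans _ _ (fmax F L (fun=> 1) x)); last by rewrite fmax_cst.
    by apply: fmax_mono => // z; exact: ind_le1.
  rewrite nnm_intD; last 2 first.
  - by apply: nnmZ; [exact: powR_ge0|exact: nnm_pow].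
  - by apply: nnmZ; [exact: ltW|exact: nnm_pow].
  rewrite !nnm_intZ ?lee_fin ?powR_ge0 ?(ltW a0)//; last 2 first.
  - exact: nnm_pow.
  - exact: nnm_pow.
  apply: leeD => //; rewrite !EFinM lee_wpmul2l ?lee_fin ?(ltW a0)//.
  (* With weight 1, [fmax_strong] bounds the integral of the [p']-th power of the maximal function
     of the indicator by [C2 * mu E]. *)
  have := H2 F L _ _ hE (nnm_cst _ lee01).
  under eq_integral do rewrite mule1.
  move=> /le_trans; apply; rewrite lee_wpmul2l ?lee_fin ?(ltW C20)// -eE -nnm_int_indT//.
  apply: nnm_int_le => //.
    apply: nnmM; first exact: nnm_pow.
    by apply: nnm_fmax; exact: nnm_cst.
  move=> x; rewrite fmax_cst// mule1 /ind indicE.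
  by case: (_ \in _); rewrite ?poweR1r// poweR0r// gt_eqF// (lt_trans _ p'1).
have yr0 : (0 < y `^ r)%R by exact: powR_gt0.
have CC : (0 < K `^ (p - 1) * (2 * C1))%R by rewrite !mulr_gt0// powR_gt0.
move: I I0 key => [I| |] I0 key; [|by rewrite gt0_muley ?leey// lte_fin|by []].
have {key} := key (y `^ r / K)%R (divr_gt0 yr0 K0).
rewrite -!EFinM !lee_fin powR_div ?(ltW yr0) ?(ltW K0)//.
have -> : (y `^ r / K * (C2 * e) = y `^ r * e / 2 / C1)%R.
  by rewrite /K; field; rewrite !gt_eqF.
have -> : (K `^ (1 - p) = (K `^ (p - 1))^-1)%R by rewrite -opprB powRN.
rewrite invrK mulrDr [(C1 * (y `^ r * e / 2 / C1))%R](_ : _ = y `^ r * e / 2)%R; last first.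
  by field; rewrite gt_eqF.
move=> H.
(* Absorption of half of the left side, legitimate because [e] is a real number. *)
have {}H : (y `^ r * e <= 2 * (C1 * ((y `^ r) `^ (1 - p) * K `^ (p - 1) * I)))%R by lra.
have yp : (0 < (y `^ r) `^ (p - 1))%R by exact: powR_gt0.
have := ler_wpM2l (ltW yp) H.
rewrite powRrM -(mulr_powRB1 (ltW yr0) p0) => H'.
apply: (@le_trans _ _ ((y `^ r) `^ (p - 1) * (y `^ r * e)))%R.
  by rewrite mulrA [(y `^ r * _)%R]mulrC.
apply: (le_trans H').
have -> : ((y `^ r) `^ (1 - p) = ((y `^ r) `^ (p - 1))^-1)%R by rewrite -opprB powRN.
rewrite le_eqVlt; apply/orP; left; apply/eqP.
by field; rewrite gt_eqF.
Qed.

(** The level set is exhausted by its intersections with finitely many coarsest cells, each of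
    finite measure. *)
Lemma vec_weak_high (r p : R) : (1 < r)%R -> (1 < p)%R -> exists C : R, (0 < C)%R /\
  forall (F : filtration mu) L f (y : R), (forall j, nnm (f j)) -> (0 < y)%R ->
  (y `^ (r * p))%:E * mu [set x | y%:E < lrnorm r (fun j => fmax F L (f j) x)]
  <= C%:E * \int[mu]_x lrnorm r (f ^~ x) `^ (r * p).
Proof.
move=> r1 p1; have [C [C0 HC]] := vec_weak_high_fin r1 p1.
exists C; split => // F L f y hf y0.
set A := [set x | _ < _].
have mA : measurable A.
  apply: nnm_gt.
  by apply: (@nnm_lrnorm _ _ _ r (fun j => fmax F L (f j))) => j; exact: nnm_fmax.
pose B N : set T := \bigcup_(a < N) [set x | fcell F 0 x = a].
have mB N : measurable (B N).
  by apply: bigcup_measurable => a _; exact: measurable_fcell.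
have muB N : mu (B N) < +oo.
  elim: N => [|N IH]; first by rewrite /B bigcup_mkord big_ord0 measure0.
  have -> : B N.+1 = B N `|` [set x | fcell F 0 x = N].
    by rewrite /B !bigcup_mkord big_ord_recr.
  apply: (@le_lt_trans _ _ (mu (B N) + mu [set x | fcell F 0 x = N])).
    by apply: measureU2 => //; exact: measurable_fcell.
  apply: lte_add_pinfty => //.
  have [[x <-]|nx] := pselect (exists x, fcell F 0 x = N).
    by rewrite measure_fcell ltry.
  rewrite (_ : [set x | _] = set0) ?measure0//.
  by apply/seteqP; split => // x /= xN; apply: nx; exists x.
have AB : A = \bigcup_N (A `&` B N).
  apply/seteqP; split => [x Ax|x [N _ []//]].
  by exists (fcell F 0 x).+1 => //; split => //; exists (fcell F 0 x) => /=.
have yp : (0 < y `^ (r * p))%R by exact: powR_gt0.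
rewrite -lee_pdivlMl//.
have cv : mu (A `&` B N) @[N --> \oo] --> mu A.
  rewrite [in X in _ --> X]AB; apply: nondecreasing_cvg_mu.
  - by move=> N; exact: measurableI.
  - by rewrite -AB.
  - move=> m n mn; apply/subsetPset => x [Ax [a /= am xa]]; split => //.
    by exists a => //=; exact: leq_trans mn.
rewrite -(cvg_lim _ cv)//; apply: lime_le; first by apply/cvg_ex; exists (mu A).
apply: nearW => N; rewrite lee_pdivlMl//; apply: (HC F L f y) => //.
- exact: measurableI.
- apply: le_lt_trans (muB N); apply: le_measure; rewrite ?inE//; first exact: measurableI.
Qed.

End weak_type.

(** * Shifted dyadic grids *)

Section half_open_box.
Context (R : realType).

Definition hbox n (a b : n.-tuple R) : set (euclid R n) :=
  [set x | forall i, (tnth a i <= tnth x i < tnth b i)%R].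

Lemma measurable_borel_hbox n (a b : n.-tuple R) :
  measurable (hbox a b : set (n.-tuple (measurableTypeR R))).
Proof.
rewrite (_ : hbox a b = \bigcap_(i in [set: 'I_n])
    ((fun x : n.-tuple (measurableTypeR R) => tnth x i) @^-1`
       `[tnth a i, tnth b i[)); last first.
  apply/seteqP; split=> [x abx i _|x abx i]; first by rewrite /= in_itv /= abx.
  by have := abx i Logic.I; rewrite /= in_itv.
apply: fin_bigcap_measurable => [|i _]; first exact: finite_finset.
by rewrite -[X in measurable X]setTI; exact: measurable_tnth.
Qed.

Lemma measurable_hbox n (a b : n.-tuple R) : measurable (hbox a b).
Proof.
have := measurable_borel_hbox a b.
move=> h; apply: sub_caratheodory; exact: sub_sigma_algebra.
Qed.

Lemma borel_lebesgue_hbox n (a b : n.-tuple R) :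
  (forall i, tnth a i <= tnth b i)%R ->
  borel_lebesgue R n (hbox a b) = (\prod_(i < n) (tnth b i - tnth a i))%:E.
Proof.
elim: n a b => [|n IH] a b ab /=.
  by rewrite big_ord0 diracE mem_set// => -[].
rewrite /borel_lebesgueS /pushforward.
pose a' := [tuple of behead a]; pose b' := [tuple of behead b].
have bE (c : n.+1.-tuple R) i : tnth [tuple of behead c] i = tnth c (lift ord0 i).
  by rewrite tnth_behead; congr tnth; apply/val_inj; rewrite /= inordK// ltnS.
rewrite (_ : _ @^-1` _ = `[tnth a ord0, tnth b ord0[ `*` hbox a' b').
  rewrite product_measure1E//=; last exact: measurable_borel_hbox.
  rewrite IH => [|i]; last by rewrite !bE.
  rewrite lebesgue_measure_itv /= lte_fin big_ord_recl EFinM.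
  congr (_ * _); last by congr EFin; apply: eq_bigr => i _; rewrite !bE.
  by case: ltgtP (ab ord0) => // -> _; rewrite subrr.
apply/seteqP; split=> [[x y] abx|[x y] [/= + aby] i].
  split; first by have := abx ord0; rewrite /= in_itv.
  by move=> i; have := abx (lift ord0 i); rewrite /= !bE tnthS.
rewrite in_itv /= => abx; have [j ->|->//] := unliftP ord0 i.
by have := aby j; rewrite !bE tnthS.
Qed.

Lemma leb_hbox n (a b : n.-tuple R) : (forall i, tnth a i <= tnth b i)%R ->
  leb (hbox a b) = (\prod_(i < n) (tnth b i - tnth a i))%:E.
Proof.
move=> ab; rewrite -(borel_lebesgue_hbox ab).
by apply: measurable_mu_extE; exact: measurable_borel_hbox.
Qed.

Lemma measurable_cube n (a : n.-tuple R) l : measurable (cube a l).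
Proof.
have := measurable_borel_box a [tuple tnth a i + l | i < n]%R.
rewrite (_ : box _ _ = cube a l).
  by move=> h; apply: sub_caratheodory; exact: sub_sigma_algebra.
by apply/seteqP; split => x H i; have := H i; rewrite tnth_mktuple.
Qed.

Lemma leb_cube n (a : n.-tuple R) l : (0 <= l)%R -> leb (cube a l) = (l ^+ n)%:E.
Proof.
move=> l0; have -> : cube a l = box a [tuple tnth a i + l | i < n]%R.
  by apply/seteqP; split => x H i; have := H i; rewrite tnth_mktuple.
rewrite leb_box => [|i]; last by rewrite tnth_mktuple lerDl.
rewrite (eq_bigr (fun=> l)) => [|i _]; last by rewrite tnth_mktuple addrC addKr.
by rewrite prodr_const card_ord.
Qed.

End half_open_box.

Section dyadic_grid.
Context (R : realType) (n : nat).
Implicit Types (al : {ffun 'I_n -> bool}) (k : int) (x y : euclid R n).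

(* Shifting generation [k] of the dyadic grid by [(-1)^k / 3] (in units of
   [2^-k]) keeps the generations nested. *)
Definition gshift al k (i : 'I_n) : R := if al i then ((-1) ^+ `|k|%N / 3)%R else 0%R.

Definition dcell al k x : {ffun 'I_n -> int} :=
  [ffun i => Num.floor (2 ^ k * tnth x i - gshift al k i)%R].

Lemma floor_eqP (z : R) (m : int) : (Num.floor z == m) = (m%:~R <= z < m%:~R + 1)%R.
Proof.
apply/eqP/idP => [<-|/andP[H1 H2]].
  by rewrite Num.Theory.floor_le/= -[1%R]/(1%:~R) -intrD Num.Theory.floorD1_gt.
by apply: Num.Theory.floor_def; rewrite H1 intrD.
Qed.

Lemma dcell_hbox al k x : [set y | dcell al k y = dcell al k x] =
  hbox [tuple ((dcell al k x i)%:~R + gshift al k i) / 2 ^ k | i < n]%R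
       [tuple ((dcell al k x i)%:~R + gshift al k i + 1) / 2 ^ k | i < n]%R.
Proof.
have p0 : (0 < 2 ^ k :> R)%R by rewrite exprz_gt0.
have H (m : int) (s z : R) : (Num.floor (2 ^ k * z - s) == m) =
    ((m%:~R + s) / 2 ^ k <= z < (m%:~R + s + 1) / 2 ^ k)%R.
  rewrite floor_eqP ler_pdivrMr// ltr_pdivlMr// lerBrDr ltrBlDr [(z * _)%R]mulrC.
  by rewrite addrAC.
apply/seteqP; split => y /=.
  move=> /ffunP E i; rewrite !tnth_mktuple -H; apply/eqP.
  by have := E i; rewrite !ffunE.
move=> B; apply/ffunP => i; apply/eqP; rewrite [dcell al k y i]ffunE H.
by have := B i; rewrite !tnth_mktuple.
Qed.

Lemma measurable_dcell al k x : measurable [set y | dcell al k y = dcell al k x].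
Proof. by rewrite dcell_hbox; exact: measurable_hbox. Qed.

Lemma leb_dcell al k x :
  leb [set y | dcell al k y = dcell al k x] = (((2 ^ k)^-1) ^+ n)%:E.
Proof.
have p0 : (0 < 2 ^ k :> R)%R by rewrite exprz_gt0.
rewrite dcell_hbox leb_hbox => [|i].
  rewrite (eq_bigr (fun=> (2 ^ k)^-1)%R) ?prodr_const ?card_ord// => i _.
  by rewrite !tnth_mktuple -mulrBl addrC addKr mul1r.
by rewrite !tnth_mktuple ler_pM2r ?invr_gt0// lerDl.
Qed.

(** Halving after an integer translation maps each interval [[m, m + 1[] into one interval of the
    same kind; this is what nests consecutive generations. *)
Lemma floor_half (u u' : R) (c : int) : Num.floor u = Num.floor u' ->
  Num.floor ((u - c%:~R) / 2)%R = Num.floor ((u' - c%:~R) / 2)%R.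
Proof.
move=> uu'; apply/eqP; rewrite floor_eqP.
set j := Num.floor _; have : Num.floor ((u' - c%:~R) / 2)%R == j by [].
rewrite floor_eqP => /andP[j1 j2].
have NE : ((2 * j + c)%:~R = 2 * j%:~R + c%:~R :> R)%R by rewrite intrD intrM.
have H1 : (2 * j + c <= Num.floor u)%R.
  by rewrite uu' Num.Theory.floor_ge_int NE; lra.
have H2 : (Num.floor u + 1 <= 2 * j + c + 2)%R.
  by rewrite lezD1 uu' Num.Theory.floor_lt_int intrD NE; lra.
have := Num.Theory.floor_le u; have := Num.Theory.floorD1_gt u.
have H1' : ((2 * j + c)%:~R <= (Num.floor u)%:~R :> R)%R by rewrite ler_int.
have H2' : ((Num.floor u + 1)%:~R <= (2 * j + c + 2)%:~R :> R)%R by rewrite ler_int.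
move: H1' H2'; rewrite [((2 * j + c + 2)%:~R)%R]intrD NE.
set a := ((Num.floor u)%:~R)%R; set b := ((Num.floor u + 1)%:~R)%R; lra.
Qed.

Lemma sign_absS k : ((-1) ^+ `|(k + 1)%R|%N = - (-1) ^+ `|k|%N :> R)%R.
Proof.
case: k => m; first by rewrite -PoszD addn1 absz_nat exprS mulN1r.
rewrite NegzE (_ : - m.+1%:Z + 1 = - m%:Z)%R; last by rewrite -addn1 PoszD opprD subrK.
by rewrite !abszN !absz_nat exprS mulN1r opprK.
Qed.

Lemma dcellS al k x y : dcell al (k + 1)%R x = dcell al (k + 1)%R y ->
  dcell al k x = dcell al k y.
Proof.
move=> /ffunP E; apply/ffunP => i; have := E i; rewrite !ffunE.
(* The shift changes sign between generations, so the two sides differ by three times a third, an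
   integer, and [floor_half] applies. *)
pose c : int := if al i then (- (-1) ^+ `|k|%N)%R else 0%R.
have pE (z : R) : (2 ^ k * z - gshift al k i =
    ((2 ^ (k + 1) * z - gshift al (k + 1) i) + c%:~R) / 2)%R.
  rewrite expfzDr// expr1z /gshift /c; case: (al i); last by field.
  by rewrite sign_absS intrN rmorphXn /= rmorphN1; field.
by move=> /(@floor_half _ _ (- c)%R); rewrite intrN !opprK !pE.
Qed.

(** The one-third trick: in units of the cell, each side of the cube is shorter than 1/3. An
    interval starting in [[m, m + 1[] and reaching [m + 1] lies strictly between [m + 2/3] and
    [m + 4/3], so it meets no boundary of the grid shifted by either sign of 1/3. The choice of [al]
    is made coordinate by coordinate. *)
Lemma cube_dcell (a : n.-tuple R) (l : R) : (0 < l)%R ->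
  exists al k, [/\ ((2 ^ k)^-1 <= 6 * l)%R &
    forall x y, cube a l x -> cube a l y -> dcell al k x = dcell al k y].
Proof.
move=> l0; have [j /andP[j1 j2]] := pow2_bracket (mulr_gt0 (ltr0n R 3 : 0 < 3)%R l0).
(* The cell side is [2 ^ (j + 1)], and the choice of [j] gives [3 * l < 2 ^ (j + 1) <= 6 * l]. *)
pose k := (- (j + 1))%R.
have kE : ((2 ^ k)^-1 = 2 * 2 ^ j :> R)%R.
  by rewrite /k invr_expz opprK expfzDr// expr1z mulrC.
have k0 : (0 < 2 ^ k :> R)%R by rewrite exprz_gt0.
pose al : {ffun 'I_n -> bool} := [ffun i => ~~ (2 ^ k * (tnth a i + l) <
   (Num.floor (2 ^ k * tnth a i))%:~R + 1)%R].
exists al, k; split; first by rewrite kE; lra.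
suff H x i : cube a l x -> dcell al k x i = Num.floor (2 ^ k * tnth a i - gshift al k i)%R.
  by move=> x y ax ay; apply/ffunP => i; rewrite !H.
move=> /(_ i) /andP[x1 x2]; rewrite ffunE; apply/eqP; rewrite floor_eqP.
have {}x1 := ler_wpM2l (ltW k0) x1; have {}x2 := ler_wpM2l (ltW k0) x2.
move: x1 x2; rewrite [(2 ^ k * (_ + _))%R]mulrDr.
have hl : (2 ^ k * l < 3^-1)%R.
  have : (2 ^ k * (3 * l) < 1)%R by rewrite -ltr_pdivlMl// mulr1 kE; move: j2; rewrite expfzDr// expr1z; lra.
  by move=> ?; lra.
have hl0 : (0 < 2 ^ k * l)%R by rewrite mulr_gt0.
rewrite /gshift ffunE [(2 ^ k * (_ + _))%R]mulrDr.
set A := (2 ^ k * tnth a i)%R; set h := (2 ^ k * l)%R in hl hl0 *; set X := (2 ^ k * tnth x i)%R.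
have := Num.Theory.floor_le A; have := Num.Theory.floorD1_gt A.
rewrite intrD; set m := Num.floor A => Am mA AX XA.
case: ltP => /= Ah; first by rewrite !subr0; apply/andP; split; [lra|rewrite -/m; lra].
have [->|->] : ((-1) ^+ `|k|%N = 1 :> R \/ (-1) ^+ `|k|%N = -1 :> R)%R.
  by rewrite -signr_odd; case: (odd _); [right|left].
- have /eqP -> : Num.floor (A - 1 / 3)%R == m by rewrite floor_eqP; apply/andP; split; lra.
  by apply/andP; split; lra.
- have /eqP -> : Num.floor (A - -1 / 3)%R == (m + 1)%R.
    by rewrite floor_eqP intrD; apply/andP; split; lra.
  by rewrite intrD; apply/andP; split; lra.
Qed.

End dyadic_grid.

(** * Grid filtrations and their domination of the maximal operator *)

Section grid_filtration.
Context (R : realType) (n : nat).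
Implicit Types (al : {ffun 'I_n -> bool}) (x y : euclid R n).

(** Generation [l] has side [2 ^ (N - l)], so the coarsest cells are large when [N] is. [pickle]
    produces the natural number label that [filtration] asks for. *)
Definition gcell al N l x : nat := pickle (dcell al (l%:Z - N%:Z) x).
Definition gvol N l : R := ((2 ^ (l%:Z - N%:Z)) ^- n)%R.

Lemma gcellE al N l x : [set y | gcell al N l y = gcell al N l x] =
  [set y | dcell al (l%:Z - N%:Z) y = dcell al (l%:Z - N%:Z) x].
Proof.
apply/seteqP; split => y; rewrite /gcell /=; last by move->.
exact: (pcan_inj pickleK).
Qed.

Lemma measurable_gcell al N l a : measurable [set x | gcell al N l x = a].
Proof.
have [[x <-]|nx] := pselect (exists x, gcell al N l x = a).
  by rewrite gcellE; exact: measurable_dcell.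
rewrite (_ : [set x | _] = set0)//.
by apply/seteqP; split => // x /= xa; apply: nx; exists x.
Qed.

Lemma levelS N l : (l.+1%:Z - N%:Z = l%:Z - N%:Z + 1)%R.
Proof. by rewrite -addn1 PoszD addrAC. Qed.

Lemma gcellS al N l x y : gcell al N l.+1 x = gcell al N l.+1 y ->
  gcell al N l x = gcell al N l y.
Proof.
rewrite /gcell levelS => /(pcan_inj pickleK) E.
by congr (pickle _); exact: dcellS.
Qed.

Lemma gvol_gt0 N l : (0 < gvol N l)%R.
Proof. by rewrite invr_gt0 exprn_gt0// exprz_gt0. Qed.

Lemma leb_gcell al N l x : leb [set y | gcell al N l y = gcell al N l x] = (gvol N l)%:E.
Proof. by rewrite gcellE leb_dcell /gvol exprVn. Qed.

Lemma gvolS N l : (gvol N l <= 2 ^+ n * gvol N l.+1)%R.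
Proof.
rewrite /gvol levelS (@expfzDr R 2 (l%:Z - N%:Z) 1)// expr1z exprMn invfM mulrCA.
by rewrite mulfV ?mulr1// expf_neq0.
Qed.

Definition grid al N : filtration (@leb R n) :=
  Filtration (@measurable_gcell al N) (@gcellS al N) (gvol_gt0 N) (leb_gcell al N) (gvolS N).

(** Generations 0 to [N.*2] are the dyadic scales from [- N] to [N], so the range grows in both
    directions with [N]. *)
Definition gmax al N f x := fmax (grid al N) N.*2 f x.

Definition gavg al (k : int) f x : \bar R :=
  ((2 ^ k) ^+ n)%:E * \int[@leb R n]_(y in [set y | dcell al k y = dcell al k x]) f y.

Lemma cE_grid al N l f x : cE (grid al N) l f x = gavg al (l%:Z - N%:Z) f x.
Proof. by rewrite /cE /= gcellE /gvol invrK. Qed.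

Lemma gavg_le_gmax al N (k : int) f x : (`|k|%N <= N)%N -> gavg al k f x <= gmax al N f x.
Proof.
move=> kN; have [l [lN ->]] : exists l : nat, (l <= N.*2)%N /\ k = (l%:Z - N%:Z)%R.
  exists (absz (k + N%:Z)%R); rewrite -addnn.
  have : (0 <= k + N%:Z)%R by lia.
  move: kN; lia.
by rewrite -cE_grid; exact: le_fmax.
Qed.

Lemma gmax_homo al f x : {homo gmax al ^~ f ^~ x : N M / (N <= M)%N >-> N <= M}.
Proof.
move=> N M NM; apply: fmax_le => [|l lN]; first exact: fmax_ge0.
by rewrite cE_grid; apply: gavg_le_gmax; lia.
Qed.

Lemma cube_avg_le_gmax (f : euclid R n -> \bar R) a l x : nnm f -> (0 < l)%R -> cube a l x ->
  exists al N, (leb (cube a l))^-1 * \int[@leb R n]_(y in cube a l) f y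
    <= (6 ^+ n)%:E * gmax al N f x.
Proof.
move=> hf l0 ax; have [al [k [kl H]]] := cube_dcell a l0.
exists al, `|k|%N; apply: (@le_trans _ _ ((6 ^+ n)%:E * gavg al k f x)); last first.
  by rewrite lee_wpmul2l ?lee_fin ?exprn_ge0//; exact: gavg_le_gmax.
have k0 : (0 < 2 ^ k :> R)%R by rewrite exprz_gt0.
rewrite leb_cube ?(ltW l0)// inver gt_eqF ?exprn_gt0// /gavg muleA -EFinM.
apply: lee_pmul.
- by rewrite lee_fin invr_ge0 exprn_ge0// ltW.
- exact: nnm_int_ge0.
- rewrite lee_fin -exprMn -exprVn; apply: lerXn2r; rewrite ?nnegrE ?mulr_ge0 ?invr_ge0 ?(ltW l0) ?(ltW k0)//.
  rewrite -(ler_pM2r l0) mulVf ?gt_eqF// mulrAC -ler_pdivrMr// mul1r//.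
apply: ge0_subset_integral.
- exact: measurable_cube.
- exact: measurable_dcell.
- exact: nnm_measurable.
- by move=> y _; exact: hf.2.
- by move=> y ay /=; exact: H.
Qed.

End grid_filtration.

Section maximal_grid.
Context (R : realType) (n : nat).
Implicit Types (x : euclid R n).
Local Notation grids := {ffun 'I_n -> bool}.

Lemma nnm_abse (f : euclid R n -> \bar R) : measurable_fun [set: euclid R n] f ->
  nnm (fun x => `|f x|).
Proof. by move=> mf; split=> [|x]; [exact: measurableT_comp|exact: abse_ge0]. Qed.

Lemma nnm_gmax al N (f : euclid R n -> \bar R) : nnm f -> nnm (gmax al N f).
Proof. exact: nnm_fmax. Qed.

Lemma maximal_ge0 (f : euclid R n -> \bar R) x : 0 <= maximal f x.
Proof.
pose Q := cube [tuple tnth x i | i < n] 1%R.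
have Qx : Q x by move=> i; rewrite tnth_mktuple lexx lerDl ler01.
have : 0 <= (leb Q)^-1 * \int[@leb R n]_(y in Q) `|f y|.
  by apply: mule_ge0; [rewrite inve_ge0|exact: integral_ge0].
move=> /le_trans; apply; apply: ereal_sup_ubound; exists Q => //; split => //.
by exists [tuple tnth x i | i < n], 1%R.
Qed.

Definition grid_const (r : R) : R := (6 ^+ n * #|grids|%:R `^ r^-1)%R.

(** A cube average is at most [6 ^+ n] times some grid's maximal function. Replacing the supremum
    over grids by a sum of [r]-th powers yields the other factor of [grid_const]. The supremum over
    [N] passes outside finite sums in [j] because [gmax] increases with [N]. *)
Lemma lrnorm_maximal_le (r : R) (f : nat -> euclid R n -> \bar R) x (y : \bar R) :
  (0 < r)%R -> (forall j, measurable_fun [set: euclid R n] (f j)) -> 0 <= y ->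
  (forall al N, lrnorm r (fun j => gmax al N (fun z => `|f j z|) x) <= y) ->
  lrnorm r (fun j => maximal (f j) x) <= (grid_const r)%:E * y.
Proof.
move=> r0 mf y0 H.
have rN : (r != 0)%R by rewrite gt_eqF.
pose m al N j := gmax al N (fun z => `|f j z|) x.
have m0 al N j : 0 <= m al N j by exact: fmax_ge0.
pose L (al : grids) j := ereal_sup (range (fun N => m al N j `^ r)).
have mL al N j : m al N j `^ r <= L al j by apply: ereal_sup_ubound; exists N.
have L0 al j : 0 <= L al j by apply: (le_trans _ (mL al 0%N j)); exact: poweR_ge0.
have p6 : (0 < 6 ^+ n :> R)%R by rewrite exprn_gt0.
have Mr j : maximal (f j) x `^ r <= ((6 ^+ n) `^ r)%:E * \sum_al L al j.
  have S0 : 0 <= ((6 ^+ n) `^ r)%:E * \sum_al L al j.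
    by apply: mule_ge0; [rewrite lee_fin powR_ge0|exact: sume_ge0].
  rewrite -[leRHS](poweRVK rN S0).
  apply: poweR_le; rewrite ?(ltW r0) ?maximal_ge0//.
  apply: ge_ereal_sup => _ [Q [[a [l [l0 ->]]] ax] <-].
  have [al [N /le_trans]] := cube_avg_le_gmax (nnm_abse (mf j)) l0 ax; apply.
  rewrite -/(m al N j).
  have q0 : 0 <= (6 ^+ n)%:E * m al N j by apply: mule_ge0 => //; rewrite lee_fin ltW.
  rewrite -[leLHS](poweRK rN q0).
  apply: poweR_le; rewrite ?invr_ge0 ?(ltW r0) ?poweR_ge0//.
  rewrite poweRM ?lee_fin ?(ltW p6)// poweR_EFin lee_wpmul2l ?lee_fin ?powR_ge0//.
  apply: le_trans (mL al N j) _.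
  by rewrite (bigD1 al)//= leeDl// sume_ge0.
have LJ al J : \sum_(0 <= j < J) L al j <= y `^ r.
  have cv : \sum_(0 <= j < J) m al N j `^ r @[N --> \oo] --> \sum_(0 <= j < J) L al j.
    apply: cvg_nnesum => j _; first by apply: nearW => N; exact: poweR_ge0.
    apply: ereal_nondecreasing_cvgn => N M NM; apply: poweR_le; rewrite ?(ltW r0)//.
    exact: gmax_homo.
  rewrite -(cvg_lim _ cv)//; apply: lime_le; first by apply/cvg_ex; eexists; exact: cv.
  apply: nearW => N; apply: (@le_trans _ _ (\sum_(0 <= j <oo) m al N j `^ r)).
    by apply: nneseries_lim_ge => j _ _; exact: poweR_ge0.
  rewrite -(@lrnorm_powK _ r (m al N))//; apply: poweR_le; rewrite ?(ltW r0) ?lrnorm_ge0//.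
  exact: H.
have gc0 : (0 <= #|grids|%:R :> R)%R by [].
rewrite [leRHS](_ : _ = (((6 ^+ n) `^ r)%:E * (#|grids|%:R%:E * y `^ r)) `^ r^-1); last first.
  rewrite !poweRM ?mule_ge0 ?poweR_ge0 ?lee_fin ?powR_ge0//.
  rewrite !poweR_EFin -powRrM mulfV// powRr1 ?(ltW p6)// -poweRrM mulfV// poweRe1//.
  by rewrite muleA /grid_const EFinM.
apply: poweR_le; first by rewrite invr_ge0 ltW.
  by apply: nneseries_ge0 => *; exact: poweR_ge0.
apply: nneseries_le_bound => [j|J]; first exact: poweR_ge0.
apply: (@le_trans _ _ (\sum_(0 <= j < J) (((6 ^+ n) `^ r)%:E * \sum_al L al j))).
  by apply: lee_sum => j _; exact: Mr.
rewrite -ge0_sume_distrr; last by move=> j _; exact: sume_ge0.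
rewrite lee_wpmul2l ?lee_fin ?powR_ge0// exchange_big/=.
apply: (@le_trans _ _ (\sum_(al : grids) y `^ r)); first by apply: lee_sum => al _; exact: LJ.
by rewrite sumr_const mule_natl.
Qed.

(** Outer-measure monotonicity: it handles level sets of [maximal] without a proof that they are
    measurable. *)
Lemma le_leb (A B : set (euclid R n)) : A `<=` B -> leb A <= leb B.
Proof. by move=> AB; apply: (@le_mu_ext _ _ _ (borel_lebesgue R n) A B). Qed.

Lemma leb_bigsetU_le (I : Type) (s : seq I) (A : I -> set (euclid R n)) :
  (forall i, measurable (A i)) ->
  leb (\big[setU/set0]_(i <- s) A i) <= \sum_(i <- s) leb (A i).
Proof.
move=> mA; elim: s => [|i s IH]; first by rewrite !big_nil measure0.
rewrite !big_cons; apply: le_trans (leeD2l _ IH).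
by apply: measureU2 => //; exact: bigsetU_measurable.
Qed.

(** The level sets increase with [N], so large [N] suffice. The threshold [N0] leaves room for the
    size condition on the coarsest cells in [vec_weak11]. *)
Lemma leb_lrnorm_maximal (r : R) (f : nat -> euclid R n -> \bar R) (u t : R) N0 :
  (0 < r)%R -> (forall j, measurable_fun [set: euclid R n] (f j)) -> (0 <= u)%R ->
  (forall al N, (N0 <= N)%N ->
    leb [set x | u%:E < lrnorm r (fun j => gmax al N (fun z => `|f j z|) x)] <= t%:E) ->
  leb [set x | (grid_const r * u)%:E < lrnorm r (fun j => maximal (f j) x)]
  <= (#|grids|%:R * t)%:E.
Proof.
move=> r0 mf u0 H.
pose A al N := [set x | u%:E < lrnorm r (fun j => gmax al N (fun z => `|f j z|) x)].
have mA al N : measurable (A al N).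
  apply: nnm_gt; apply: (@nnm_lrnorm _ _ _ r (fun j => gmax al N (fun z => `|f j z|))) => j.
  by apply: nnm_gmax; exact: nnm_abse.
have mU al : measurable (\bigcup_N A al N) by exact: bigcupT_measurable.
apply: (@le_trans _ _ (leb (\big[setU/set0]_(al : grids) \bigcup_N A al N))).
  apply: le_leb => x /= ux; apply/not_notP => nU.
  move: ux; rewrite ltNge => /negP; apply; rewrite EFinM.
  apply: lrnorm_maximal_le => // al N; rewrite leNgt; apply/negP => xA.
  by apply: nU; rewrite (bigD1 al)//=; left; exists N.
apply: le_trans (leb_bigsetU_le _ mU) _.
apply: (@le_trans _ _ (\sum_(al : grids) t%:E)); last first.
  by rewrite sumr_const EFinM mule_natl.
apply: lee_sum => al _.
have nd : nondecreasing_seq (A al).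
  move=> N M NM; apply/subsetPset => x; rewrite /A/= => /lt_le_trans; apply.
  by apply: lrnorm_le => // j; [exact: fmax_ge0|exact: gmax_homo].
have cv : leb (A al N) @[N --> \oo] --> leb (\bigcup_N A al N).
  by apply: nondecreasing_cvg_mu.
rewrite -(cvg_lim _ cv)//; apply: lime_le; first by apply/cvg_ex; eexists; exact: cv.
by exists N0 => // N /= NN; exact: H.
Qed.

End maximal_grid.

(** * The distribution of the vector-valued maximal function *)

Section layers.
Context (R : realType).

Lemma exprn_unbounded (a M : R) : (1 < a -> exists i, M < a ^+ i)%R.
Proof.
move=> a1; have h0 : (0 < a - 1)%R by rewrite subr_gt0.
have bern i : (1 + i%:R * (a - 1) <= a ^+ i)%R.
  elim: i => [|i IH]; first by rewrite mul0r addr0 expr0.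
  rewrite exprS -natr1; have : (0 <= i%:R * (a - 1) ^+ 2)%R by rewrite mulr_ge0 ?sqr_ge0.
  have := ler_wpM2l (ltW (lt_trans ltr01 a1)) IH; lra.
exists (Num.bound (M / (a - 1)))%R; apply: lt_le_trans (bern _).
have [M0|M0] := leP M 0%R.
  by apply: (le_lt_trans M0); rewrite ltr_wpDr// mulr_ge0 ?ltW.
have : (M / (a - 1) < (Num.bound (M / (a - 1)))%:R)%R.
  by rewrite archi_boundP// divr_ge0// ltW.
by rewrite ltr_pdivrMr// => H; apply: (lt_trans H); rewrite ltrDr.
Qed.

(** For finite [z] the term at the least [i] with [z <= a ^+ i.+1] already dominates [z]. *)
Lemma layer_up (a : R) (z : \bar R) : (1 < a)%R -> 1 < z ->
  z <= \sum_(0 <= i <oo) (a ^+ i.+1)%:E * (if (a ^+ i)%:E < z then 1 else 0).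
Proof.
move=> a1 z1; have a0 : (0 < a)%R by exact: lt_trans a1.
pose u z i : \bar R := (a ^+ i.+1)%:E * (if (a ^+ i)%:E < z then 1 else 0).
have u0 z' i : 0 <= u z' i by apply: mule_ge0; [rewrite lee_fin exprn_ge0 ?ltW|case: ifP].
have fin (s : R) : (1 < s)%R -> s%:E <= \sum_(0 <= i <oo) u s%:E i.
  move=> s1; have ex : exists i, (s <= a ^+ i.+1)%R.
    have [i si] := exprn_unbounded s a1; exists i.
    by rewrite (le_trans (ltW si))// exprS ler_peMl ?exprn_ge0 ?(ltW a0) ?(ltW a1).
  case: (ex_minnP ex) => i si imin.
  apply: le_trans (@nneseries_ge_term _ (u s%:E) i (u0 _)).
  rewrite /u lte_fin ifT ?mule1 ?lee_fin//.
  case: i si imin => [|i] si imin; first by rewrite expr0.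
  by rewrite ltNge; apply/negP => /imin; rewrite ltnn.
case: z z1 => [s| _|//]; first by rewrite lte_fin; exact: fin.
rewrite leye_eq; apply/eqP/eqyP => M M0.
have M1 : (1 < M + 1)%R by rewrite ltrDr.
apply: (@le_trans _ _ (M + 1)%:E); first by rewrite lee_fin lerDl.
apply: le_trans (fin _ M1) _; apply: lee_nneseries => [i _ _|i _]; first exact: u0.
rewrite /u ltry lee_wpmul2l ?lee_fin ?exprn_ge0 ?(ltW a0)//.
by case: ifP; rewrite ?lexx ?lee_fin.
Qed.

(** For the least [i] with [a ^- i.+1 < z], the height [a ^- i] is still at least [z], so one term
    suffices. *)
Lemma layer_down (a s : R) (z : \bar R) : (1 < a)%R -> (0 < s)%R -> 0 <= z -> z <= 1 ->
  z `^ s <= \sum_(0 <= i <oo) ((a ^- i) `^ s)%:E * (if (a ^- i.+1)%:E < z then 1 else 0).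
Proof.
move=> a1 s0 z0 z1; have a0 : (0 < a)%R by exact: lt_trans a1.
pose u z i : \bar R := ((a ^- i) `^ s)%:E * (if (a ^- i.+1)%:E < z then 1 else 0).
have u0 z' i : 0 <= u z' i by apply: mule_ge0; [rewrite lee_fin powR_ge0|case: ifP].
case: z z0 z1 => [z| |]//; rewrite !lee_fin => z0 z1.
move: z0; rewrite le_eqVlt => /orP[/eqP <-|z0].
  by rewrite poweR0r ?gt_eqF//; apply: nneseries_ge0 => i _ _; exact: u0.
have ex : exists i, (a ^- i.+1 < z)%R.
  have [i si] := exprn_unbounded z^-1 a1; exists i.
  rewrite -[ltRHS]invrK ltf_pV2 ?posrE ?invr_gt0 ?exprn_gt0//.
  by rewrite (lt_le_trans si)// exprS ler_peMl ?exprn_ge0 ?(ltW a0) ?(ltW a1).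
case: (ex_minnP ex) => i si imin.
apply: le_trans (@nneseries_ge_term _ (u z%:E) i (u0 _)).
rewrite /u lte_fin si mule1 poweR_EFin lee_fin ge0_ler_powR ?nnegrE ?(ltW s0) ?(ltW z0)//.
  by rewrite invr_ge0 exprn_ge0// ltW.
case: i si imin => [|i] si imin; first by rewrite expr0 invr1.
by rewrite leNgt; apply/negP => /imin; rewrite ltnn.
Qed.

End layers.

Section maximal_distribution.
Context (R : realType) (n : nat).
Hypothesis n0 : (0 < n)%N.
Variables (r a b : R).
Hypothesis r1 : (1 < r)%R.
Hypothesis a1 : (1 < a)%R.
Hypothesis a2 : (a < 2)%R.
Hypothesis b1 : (1 < b)%R.
Implicit Types (N : euclid R n -> \bar R) (B t s : R).

(** Slicing at heights [B * a ^+ i] leaves a geometric series of ratio [a / 2]. *)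
Lemma int_upper N B t : nnm N -> (0 < B)%R -> (0 <= t)%R ->
  (forall i, leb [set x | (B * a ^+ i)%:E < N x] <= (t / 2 ^+ i)%:E) ->
  \int[@leb R n]_x (ind [set x | B%:E < N x] x * N x) <= (a / (1 - a / 2) * (B * t))%:E.
Proof.
move=> hN B0 t0 H; have a0 : (0 < a)%R by exact: lt_trans a1.
have hi i : nnm (@ind _ _ R [set x : euclid R n | (B * a ^+ i)%:E < N x]).
  by apply: nnm_ind; exact: nnm_gt.
have c0 i : (0 <= B * a ^+ i.+1)%R by rewrite mulr_ge0 ?exprn_ge0 ?ltW.
apply: (@le_trans _ _ (\int[@leb R n]_x \sum_(0 <= i <oo)
    ((B * a ^+ i.+1)%:E * ind [set x | (B * a ^+ i)%:E < N x] x))).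
  apply: nnm_int_le.
  - by apply: nnmM; [apply: nnm_ind; exact: nnm_gt|exact: hN].
  - by apply: nnm_series => i; exact: nnmZ.
  move=> x; rewrite ind_gt; case: ifPn => [BN|_]; last first.
    by rewrite mul0e; apply: nneseries_ge0 => i _ _; apply: (nnmZ (c0 i) (hi i)).2.
  rewrite mul1e; have : 1 < B^-1%:E * N x by rewrite lte_pdivlMl ?mule1.
  move=> /(layer_up a1); rewrite lee_pdivrMl//.
  rewrite -nneseriesZl; last first.
    by move=> i _; apply: mule_ge0; [rewrite lee_fin exprn_ge0 ?ltW|case: ifP].
  move=> /le_trans; apply; apply: lee_nneseries => [i _ _|i _].
    apply: mule_ge0; first by rewrite lee_fin ltW.
    by apply: mule_ge0; [rewrite lee_fin exprn_ge0 ?ltW|case: ifP].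
  by rewrite muleA -EFinM ind_gt lte_pdivlMl// -EFinM.
rewrite nnm_int_series; last by move=> i; exact: nnmZ.
have q01 : (0 <= a / 2 < 1)%R.
  by rewrite divr_ge0 ?(ltW a0)//= ltr_pdivrMr// mul1r.
apply: (@le_trans _ _ (\sum_(0 <= i <oo) ((a * (B * t))%:E * ((a / 2) ^+ i)%:E))).
  apply: lee_nneseries => [i _ _|i _]; first by apply: nnm_int_ge0; exact: nnmZ.
  rewrite nnm_intZ ?lee_fin// nnm_int_indT; last exact: nnm_gt.
  apply: le_trans (lee_wpmul2l _ (H i)) _; first by rewrite lee_fin.
  rewrite -!EFinM lee_fin exprS expr_div_n le_eqVlt; apply/orP; left; apply/eqP.
  by field; rewrite expf_neq0.
rewrite nneseriesZl; last first.
  by move=> i _; rewrite lee_fin exprn_ge0//; case/andP: q01.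
rewrite nneseries_geometric// -EFinM lee_fin le_eqVlt; apply/orP; left; apply/eqP.
by field; rewrite gt_eqF// subr_gt0.
Qed.

(** Slicing at heights [B / b ^+ i] leaves ratio [2 / b ^ s], at most 1/2. In the constant 4, one
    factor 2 is the sum of this series and the other comes from the index [i.+1] in the measure of
    the slice. *)
Lemma int_lower N B t s : nnm N -> (0 < B)%R -> (0 <= t)%R -> (0 < s)%R -> (4 <= b `^ s)%R ->
  (forall i, leb [set x | (B / b ^+ i)%:E < N x] <= (t * 2 ^+ i)%:E) ->
  \int[@leb R n]_x ((ind [set x | N x <= B%:E] x * N x) `^ s) <= (4 * (B `^ s * t))%:E.
Proof.
move=> hN B0 t0 s0 bs H; have b0 : (0 < b)%R by exact: lt_trans b1.
have hi i : nnm (@ind _ _ R [set x : euclid R n | (B / b ^+ i)%:E < N x]).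
  by apply: nnm_ind; exact: nnm_gt.
have c0 i : (0 <= B `^ s * (b ^- i) `^ s)%R by rewrite mulr_ge0 ?powR_ge0.
have hO : nnm (@ind _ _ R [set x : euclid R n | N x <= B%:E]).
  by apply: nnm_ind; exact: nnm_le.
apply: (@le_trans _ _ (\int[@leb R n]_x \sum_(0 <= i <oo)
    ((B `^ s * (b ^- i) `^ s)%:E * ind [set x | (B / b ^+ i.+1)%:E < N x] x))).
  apply: nnm_int_le.
  - by apply: nnm_pow; exact: nnmM.
  - by apply: nnm_series => i; exact: nnmZ.
  move=> x; have [BN|BN] := leP (N x) B%:E; last first.
    rewrite indF ?mul0e ?poweR0r ?gt_eqF//=; last by rewrite leNgt BN.
    by apply: nneseries_ge0 => i _ _; apply: (nnmZ (c0 i) (hi i.+1)).2.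
  rewrite indT// mul1e.
  have z0 : 0 <= B^-1%:E * N x by apply: mule_ge0; [rewrite lee_fin invr_ge0 ltW|exact: hN.2].
  have z1 : B^-1%:E * N x <= 1 by rewrite lee_pdivrMl// mule1.
  have := layer_down b1 s0 z0 z1.
  rewrite poweRM ?lee_fin ?invr_ge0 ?(ltW B0)//; last exact: hN.2.
  rewrite poweR_EFin powRV ?(ltW B0)// lee_pdivrMl ?powR_gt0//.
  rewrite -nneseriesZl; last first.
    by move=> i _; apply: mule_ge0; [rewrite lee_fin powR_ge0|case: ifP].
  move=> /le_trans; apply; apply: lee_nneseries => [i _ _|i _].
    apply: mule_ge0; first by rewrite lee_fin powR_ge0.
    by apply: mule_ge0; [rewrite lee_fin powR_ge0|case: ifP].
  by rewrite muleA -EFinM ind_gt lte_pdivlMl// -EFinM.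
rewrite nnm_int_series; last by move=> i; exact: nnmZ.
have bs0 : (0 < b `^ s)%R by exact: powR_gt0.
have q01 : (0 <= 2 / b `^ s < 1)%R.
  by rewrite divr_ge0 ?powR_ge0//= ltr_pdivrMr//; lra.
apply: (@le_trans _ _ (\sum_(0 <= i <oo) ((2 * (B `^ s * t))%:E * ((2 / b `^ s) ^+ i)%:E))).
  apply: lee_nneseries => [i _ _|i _]; first by apply: nnm_int_ge0; exact: nnmZ.
  rewrite nnm_intZ ?lee_fin// nnm_int_indT; last exact: nnm_gt.
  apply: le_trans (lee_wpmul2l _ (H i.+1)) _; first by rewrite lee_fin.
  rewrite -!EFinM lee_fin exprS expr_div_n.
  have -> : ((b ^- i) `^ s = (b `^ s) ^- i)%R.
    rewrite powRV ?exprn_ge0 ?(ltW b0)//; congr (_^-1)%R.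
    by rewrite -[(b ^+ i)%R]powR_mulrn ?(ltW b0)// -[RHS]powR_mulrn ?powR_ge0// powRAC.
  rewrite le_eqVlt; apply/orP; left; apply/eqP.
  by field; rewrite expf_neq0// gt_eqF.
rewrite nneseriesZl; last first.
  by move=> i _; rewrite lee_fin exprn_ge0//; case/andP: q01.
rewrite nneseries_geometric// -EFinM lee_fin.
rewrite -[(4 * _)%R](_ : 2 * (B `^ s * t) * 2 = _)%R; last by ring.
rewrite ler_wpM2l ?mulr_ge0 ?powR_ge0//.
rewrite -[leRHS]invrK lef_pV2 ?posrE ?invr_gt0 ?subr_gt0//; last by case/andP: q01.
suff : (2 / b `^ s <= 2^-1)%R by lra.
rewrite ler_pdivrMr//; lra.
Qed.

End maximal_distribution.

Section lrnorm_split.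
Context (R : realType).

(** A crude substitute for Minkowski's inequality: a sum is at most twice its larger term, and
    [2 * 2 ^ r <= 4 ^ r]. *)
Lemma lrnormD_le (r : R) (u w : nat -> \bar R) (y : \bar R) : (1 < r)%R ->
  (forall j, 0 <= u j) -> (forall j, 0 <= w j) -> 0 <= y ->
  lrnorm r u <= y -> lrnorm r w <= y -> lrnorm r (fun j => u j + w j) <= 4%:E * y.
Proof.
move=> r1 u0 w0 y0 uy wy; have r0 : (0 < r)%R by exact: lt_trans r1.
have rN : (r != 0)%R by rewrite gt_eqF.
have y4 : 0 <= 4%:E * y by exact: mule_ge0.
rewrite -[leRHS](poweRK rN y4); apply: poweR_le; first by rewrite invr_ge0 ltW.
  by apply: nneseries_ge0 => *; exact: poweR_ge0.
have two (s t : \bar R) : 0 <= s -> 0 <= t ->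
    (s + t) `^ r <= (2 `^ r)%:E * (s `^ r + t `^ r).
  have H (s' t' : \bar R) : 0 <= s' -> 0 <= t' -> s' <= t' ->
      (s' + t') `^ r <= (2 `^ r)%:E * t' `^ r.
    move=> s0 t0 st; rewrite -poweR_EFin -poweRM ?lee_fin//.
    apply: poweR_le; rewrite ?(ltW r0) ?adde_ge0//.
    by rewrite mule_natl mule2n leeD2r.
  move=> s0 t0; rewrite ge0_muleDr ?poweR_ge0//.
  have [st|ts] := leP s t.
    by apply: (le_trans (H _ _ s0 t0 st)); rewrite leeDr// mule_ge0 ?poweR_ge0 ?lee_fin ?powR_ge0.
  rewrite addeC; apply: (le_trans (H _ _ t0 s0 (ltW ts))).
  by rewrite leeDl// mule_ge0 ?poweR_ge0 ?lee_fin ?powR_ge0.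
apply: (@le_trans _ _ (\sum_(0 <= j <oo) ((2 `^ r)%:E * (u j `^ r + w j `^ r)))).
  by apply: lee_nneseries => [*|j _]; [exact: poweR_ge0|exact: two].
rewrite nneseriesZl; last by move=> j _; rewrite adde_ge0 ?poweR_ge0.
rewrite nneseriesD; [|by move=> *; exact: poweR_ge0..].
rewrite -!lrnorm_powK//.
have uyr : lrnorm r u `^ r <= y `^ r by apply: poweR_le; rewrite ?(ltW r0) ?lrnorm_ge0.
have wyr : lrnorm r w `^ r <= y `^ r by apply: poweR_le; rewrite ?(ltW r0) ?lrnorm_ge0.
apply: le_trans (lee_wpmul2l _ (leeD uyr wyr)) _; first by rewrite lee_fin powR_ge0.
rewrite poweRM ?lee_fin// poweR_EFin.
have -> : y `^ r + y `^ r = 2%:E * y `^ r.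
  by rewrite mule_natl mule2n.
rewrite muleA -EFinM lee_wpmul2r ?poweR_ge0// lee_fin.
rewrite (_ : 4 = 2 * 2)%R; last by lra.
rewrite powRM// ler_wpM2l ?powR_ge0//.
by apply: le1r_powR; [rewrite ler1n|exact: ltW].
Qed.

Lemma lrnorm_ind d (T : measurableType d) (r : R) (A : set T) (f : nat -> T -> \bar R) x :
  (0 < r)%R ->
  lrnorm r (fun j => ind A x * f j x) = ind A x * lrnorm r (f ^~ x).
Proof.
move=> r0; rewrite /ind indicE; case: (_ \in _) => /=.
  by rewrite mul1e; congr lrnorm; apply/funext => j; rewrite mul1e.
rewrite mul0e /lrnorm eseries0 ?poweR0r ?invr_eq0 ?gt_eqF// => j _ _.
by rewrite mul0e poweR0r// gt_eqF.
Qed.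

End lrnorm_split.

Section maximal_distribution.
Context (R : realType) (n : nat).
Hypothesis n0 : (0 < n)%N.
Local Notation grids := {ffun 'I_n -> bool}.

(** The coarsest cells have volume [2 ^ (N * n)]; its growth in [N] rests on [0 < n]. *)
Lemma le_gvol N : (N%:R <= gvol R n N 0)%R.
Proof.
rewrite /gvol sub0r -exprVn invr_expz opprK -exprnP -natrX -natrX ler_nat.
apply: (leq_trans (ltnW (ltn_expl N (ltnSn 1)))).
by rewrite -{1}[(2 ^ N)%N]expn1 leq_pexp2l// expn_gt0.
Qed.

Lemma maximal_distribution (r a b : R) : (1 < r)%R -> (1 < a)%R -> (a < 2)%R -> (1 < b)%R ->
  exists C : R, (0 < C)%R /\
  forall (f : nat -> euclid R n -> \bar R) (B t : R),
    (forall j, measurable_fun [set: euclid R n] (f j)) -> (0 < B)%R -> (0 < t)%R ->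
    (forall i, leb [set x | (B * a ^+ i)%:E < lrnorm r (fun j => `|f j x|)]
      <= (t / 2 ^+ i)%:E) ->
    (forall i, leb [set x | (B / b ^+ i)%:E < lrnorm r (fun j => `|f j x|)]
      <= (t * 2 ^+ i)%:E) ->
  leb [set x | (C * B)%:E < lrnorm r (fun j => maximal (f j) x)] <= t%:E.
Proof.
move=> r1 a1 a2 b1.
have r0 : (0 < r)%R by exact: lt_trans r1.
have b0 : (0 < b)%R by exact: lt_trans b1.
have lnb : (0 < ln b)%R by rewrite ln_gt0.
(* The [p]-th power of [b] is [4 * b], so [int_lower] applies with exponent [r * p]. *)
pose p := (1 + ln 4 / ln b)%R.
have ln4 : (0 < ln 4 :> R)%R by rewrite ln_gt0// ltr1n.
have p1 : (1 < p)%R by rewrite ltrDl divr_gt0.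
have s1 : (1 < r * p)%R by rewrite -[ltLHS]mulr1 ltr_pM// ler01.
have s0 : (0 < r * p)%R by exact: lt_trans s1.
have bs : (4 <= b `^ (r * p))%R.
  rewrite -[leLHS](@lnK R 4%R) ?posrE// /powR gt_eqF// ler_expR -ler_pdivrMr//.
  rewrite (@le_trans _ _ p)//; first by rewrite lerDr.
  by rewrite ler_peMl ?(ltW r1)// ltW// (lt_trans ltr01).
have [C1 [C10 H1]] := @vec_weak11 _ _ _ (@leb R n) r (2 ^+ n)%R r1.
have [C2 [C20 H2]] := @vec_weak_high _ _ _ (@leb R n) r p r1 p1.
pose K1 := (a / (1 - a / 2))%R.
have K10 : (0 < K1)%R.
  by apply: divr_gt0; [exact: lt_trans a1|rewrite subr_gt0 ltr_pdivrMr// mul1r].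
pose c : R := #|grids|%:R.
have c0 : (0 < c)%R by rewrite ltr0n; apply/card_gt0P; exists [ffun=> false].
(* Large enough for each weak-type bound to give at most [t / (2 * c)], half of the share [t / c] of
   one grid. The summand 1 makes [y0] at most its power [r * p]. *)
pose y0 := (1 + 2 * c * (C1 * K1) + 2 * c * (C2 * 4))%R.
have q1 : (0 < 2 * c * (C1 * K1))%R by do !apply: mulr_gt0 => //.
have q2 : (0 < 2 * c * (C2 * 4))%R by do !apply: mulr_gt0 => //.
have y01 : (1 <= y0)%R by rewrite /y0 -addrA lerDl addr_ge0// ltW.
have y0q1 : (2 * c * (C1 * K1) <= y0)%R by rewrite /y0 [(1 + _)%R]addrC -addrA lerDl addr_ge0// ltW.
have y0q2 : (2 * c * (C2 * 4) <= y0)%R by rewrite /y0 lerDr addr_ge0// ltW.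
have y00 : (0 < y0)%R by exact: lt_le_trans y01.
have gc0 : (0 < grid_const n r)%R by rewrite mulr_gt0 ?exprn_gt0 ?powR_gt0.
exists (grid_const n r * (4 * y0))%R; split; first by do !apply: mulr_gt0 => //.
move=> f B t mf B0 t0 Hup Hlow.
pose y := (y0 * B)%R.
have yp : (0 < y)%R by exact: mulr_gt0.
pose h j x := `|f j x|.
have hh j : nnm (h j) by exact: nnm_abse.
pose F x := lrnorm r (h ^~ x).
have hF : nnm F by exact: nnm_lrnorm.
pose Up := [set x | B%:E < F x]; pose Lo := [set x | F x <= B%:E].
have mUp : measurable Up by exact: nnm_gt.
have mLo : measurable Lo by exact: nnm_le.
pose hu j x := ind Up x * h j x; pose hl j x := ind Lo x * h j x.
have hhu j : nnm (hu j) by exact: (nnmM (nnm_ind R mUp) (hh j)).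
have hhl j : nnm (hl j) by exact: (nnmM (nnm_ind R mLo) (hh j)).
have huE x : lrnorm r (hu ^~ x) = ind Up x * F x by exact: lrnorm_ind.
have hlE x : lrnorm r (hl ^~ x) = ind Lo x * F x by exact: lrnorm_ind.
have hE j x : h j x = hu j x + hl j x.
  rewrite /hu /hl; have [BF|BF] := ltP B%:E (F x).
    rewrite [ind Up x]indT ?[ind Lo x]indF ?mul1e ?mul0e ?adde0//.
    by rewrite /Lo/= leNgt BF.
  rewrite [ind Up x]indF ?[ind Lo x]indT ?mul1e ?mul0e ?add0e//.
  by rewrite /Up/= ltNge BF.
have Iu : \int[@leb R n]_x lrnorm r (hu ^~ x) <= (K1 * (B * t))%:E.
  under eq_integral do rewrite huE.
  exact: (int_upper a1 a2 hF B0 (ltW t0) Hup).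
have Il : \int[@leb R n]_x lrnorm r (hl ^~ x) `^ (r * p) <= (4 * (B `^ (r * p) * t))%:E.
  under eq_integral do rewrite hlE.
  exact: (int_lower b1 hF B0 (ltW t0) s0 bs Hlow).
pose t' := (t / c)%R.
have -> : t = (c * t')%R by rewrite mulrC divfK// gt_eqF.
have -> : (grid_const n r * (4 * y0) * B = grid_const n r * (4 * y))%R by rewrite /y; ring.
(* From this [N] on, a coarsest cell has volume at least [K1 * (B * t) / y], so the average of the
   upper part over it is at most [y], as [vec_weak11] requires. The 4 is that of [lrnormD_le]. *)
apply: (@leb_lrnorm_maximal _ _ r f (4 * y)%R t' (Num.bound (K1 * (B * t) / y)%R)) => //.
  by rewrite mulr_ge0// ltW.
move=> al N NN.
have mG (g : nat -> euclid R n -> \bar R) : (forall j, nnm (g j)) ->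
    measurable [set x | y%:E < lrnorm r (fun j => gmax al N (g j) x)].
  move=> hg; apply: nnm_gt.
  by apply: (@nnm_lrnorm _ _ _ r (fun j => gmax al N (g j))) => j; exact: nnm_gmax.
apply: (@le_trans _ _ (leb ([set x | y%:E < lrnorm r (fun j => gmax al N (hu j) x)]
   `|` [set x | y%:E < lrnorm r (fun j => gmax al N (hl j) x)]))).
  apply: le_leb => x /= H; apply/not_notP => /not_orP[/negP nu /negP nl].
  move: H; rewrite ltNge => /negP; apply.
  rewrite -leNgt in nu; rewrite -leNgt in nl.
  rewrite EFinM; apply: (le_trans _ (lrnormD_le r1 _ _ _ nu nl)).
  - apply: lrnorm_le => // j; first exact: fmax_ge0.
    apply: le_trans (fmaxD _ _ _ (hhu j) (hhl j)).
    by rewrite /gmax (_ : (fun z => `|f j z|) = (fun z => hu j z + hl j z))//; apply/funext => z; exact: hE.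
  - by move=> j; exact: fmax_ge0.
  - by move=> j; exact: fmax_ge0.
  - by rewrite lee_fin ltW.
apply: (@le_trans _ _ (leb [set x | y%:E < lrnorm r (fun j => gmax al N (hu j) x)] +
   leb [set x | y%:E < lrnorm r (fun j => gmax al N (hl j) x)])).
  by apply: measureU2; exact: mG.
have -> : t' = (t' / 2 + t' / 2)%R by rewrite /t'; field; rewrite gt_eqF.
rewrite EFinD; apply: leeD.
  have E0 x : cE (grid R al N) 0 (fun x => lrnorm r (hu ^~ x)) x <= y%:E.
    have hN : nnm (fun x => lrnorm r (hu ^~ x)) by exact: nnm_lrnorm.
    apply: (@le_trans _ _ ((gvol R n N 0)^-1%:E * (K1 * (B * t))%:E)).
      apply: lee_wpmul2l; first by rewrite lee_fin invr_ge0 ltW// gvol_gt0.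
      apply: (le_trans _ Iu); apply: ge0_subset_integral.
      - exact: measurable_gcell.
      - exact: measurableT.
      - exact: (@nnm_measurable _ _ _ _ _ hN).
      - by move=> z _; exact: (hN.2 z).
      - exact: subsetT.
    rewrite -EFinM lee_fin -ler_pdivlMl ?invr_gt0 ?gvol_gt0// invrK.
    rewrite -ler_pdivrMr//; apply: (@le_trans _ _ N%:R%R); last exact: le_gvol.
    apply: (@le_trans _ _ (Num.bound (K1 * (B * t) / y))%:R%R); last by rewrite ler_nat.
    apply/ltW/archi_boundP/divr_ge0; last exact: ltW.
    by rewrite ltW//; do !apply: mulr_gt0 => //.
  have := H1 (grid R al N) N.*2 hu y erefl hhu yp E0.
  move=> /le_trans /(_ (lee_wpmul2l _ Iu)); rewrite lee_fin => /(_ (ltW C10)).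
  rewrite -lee_pdivlMl// => /le_trans; apply.
  rewrite -!EFinM lee_fin ler_pdivrMl//.
  rewrite (_ : C1 * (K1 * (B * t)) = 2 * c * (C1 * K1) * (B * t / (2 * c)))%R; last first.
    by field; rewrite gt_eqF.
  rewrite (_ : y * (t' / 2) = y0 * (B * t / (2 * c)))%R; last first.
    by rewrite /y /t'; field; rewrite gt_eqF.
  by rewrite ler_wpM2r ?divr_ge0 ?mulr_ge0 ?(ltW B0) ?(ltW t0) ?(ltW c0).
have := H2 (grid R al N) N.*2 hl y hhl yp.
move=> /le_trans /(_ (lee_wpmul2l _ Il)); rewrite lee_fin => /(_ (ltW C20)).
rewrite -lee_pdivlMl ?powR_gt0// => /le_trans; apply.
rewrite -!EFinM lee_fin ler_pdivrMl ?powR_gt0//.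
rewrite powRM ?(ltW B0) ?(ltW y00)//.
rewrite (_ : C2 * (4 * (B `^ (r * p) * t)) =
  2 * c * (C2 * 4) * (B `^ (r * p) * t / (2 * c)))%R; last first.
  by field; rewrite gt_eqF.
rewrite (_ : y0 `^ (r * p) * B `^ (r * p) * (t' / 2) =
  y0 `^ (r * p) * (B `^ (r * p) * t / (2 * c)))%R; last first.
  by rewrite /t'; field; rewrite gt_eqF.
rewrite ler_wpM2r ?divr_ge0 ?mulr_ge0 ?powR_ge0 ?(ltW t0) ?(ltW c0)//.
exact: le_trans (le1r_powR y01 (ltW s1)).
Qed.

End maximal_distribution.

(** * Discretization of the Lorentz modular *)

Section measurable_power.
Context (R : realType).

Lemma lt_lne (c : R) (x : \bar R) : (c%:E < lne x) = ((expR c)%:E < x).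
Proof.
case: x => [x| |]/=; rewrite ?ltry ?ltNge ?leNye// -?ltNge; case: ifPn => [x0|].
  by rewrite ltNge leNye/= lte_fin ltNge (le_trans x0)// expR_ge0.
by rewrite -ltNge => x0; rewrite !lte_fin -ltr_expR lnK.
Qed.

Lemma lt_expeR (c : R) (x : \bar R) :
  (c%:E < expeR x) = if (c < 0)%R then true else lne c%:E < x.
Proof.
case: ifPn => [c0|]; first by apply: lt_le_trans (expeR_ge0 x); rewrite lte_fin.
by rewrite -leNgt => c0; rewrite -[RHS]lte_expeR lneK// in_itv/= lee_fin c0 leey.
Qed.

Lemma measurable_lne : measurable_fun [set: \bar R] (@lne R).
Proof.
apply: (measurability _ (ErealGenOInfty.measurableE R)) => // _ [_ [c ->] <-].
rewrite setTI (_ : _ @^-1` _ = `](expR c)%:E, +oo[%classic); first exact: emeasurable_itv.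
by apply/seteqP; split => x /=; rewrite !in_itv/= !andbT lt_lne.
Qed.

Lemma measurable_expeR : measurable_fun [set: \bar R] (@expeR R).
Proof.
apply: (measurability _ (ErealGenOInfty.measurableE R)) => // _ [_ [c ->] <-].
rewrite setTI (_ : _ @^-1` _ = if (c < 0)%R then setT else `]lne c%:E, +oo[%classic).
  by case: ifP => _; [exact: measurableT|exact: emeasurable_itv].
apply/seteqP; split => x; rewrite /preimage/= in_itv/= andbT lt_expeR; case: ifP => // _ /=;
  by rewrite in_itv/= andbT.
Qed.

Lemma poweR_expeR (x : \bar R) (r : R) : (0 < r)%R -> 0 <= x ->
  x `^ r = expeR (r%:E * lne x).
Proof.
move=> r0; case: x => [x| |]//; last by rewrite poweRyr ?gt_eqF//= gt0_muley ?lte_fin.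
rewrite lee_fin le_eqVlt => /orP[/eqP <-|x0].
  by rewrite poweR0r ?gt_eqF//= lexx gt0_muleNy ?lte_fin.
by rewrite lne_EFin//= /powR gt_eqF.
Qed.

(** As [g] is positive, the power equals [expeR] of [g] times [lne f] even where [f] is 0 or
    [+oo]. *)
Lemma measurable_fun_poweR d (T : measurableType d) (D : set T) (f : T -> \bar R) (g : T -> R) :
  measurable D -> measurable_fun D f -> measurable_fun D g ->
  (forall t, D t -> 0 <= f t) -> (forall t, D t -> 0 < g t)%R ->
  measurable_fun D (fun t => f t `^ g t).
Proof.
move=> mD mf mg f0 g0.
apply: (eq_measurable_fun (fun t => expeR ((g t)%:E * lne (f t)))).
  by move=> t /set_mem Dt; rewrite poweR_expeR ?f0 ?g0.
apply: (measurableT_comp measurable_expeR); apply: emeasurable_funM.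
  exact/measurable_EFinP.
exact: (measurableT_comp measurable_lne).
Qed.

End measurable_power.

Section dyadic_partition.
Context (R : realType).
Local Notation lebR := (@completed_lebesgue_measure R).
Local Notation TR := (caratheodory_type ((@wlength R (idfun : R -> R))^*)%mu).

Definition dyad (k : int) : set TR := ([set` `[(2 ^ k)%R, (2 ^ (k + 1))%R[] : set R).

Lemma measurable_dyad k : measurable (dyad k).
Proof. exact: measurable_itv_cara. Qed.

Lemma lebR_itv (i : interval R) : lebR ([set` i] : set TR) = lebesgue_measure ([set` i] : set R).
Proof. by []. Qed.

Lemma lebR_dyad k : lebR (dyad k) = (2 ^ k)%:E.
Proof.
have p0 : (0 < 2 ^ k :> R)%R by rewrite exprz_gt0.
rewrite lebR_itv lebesgue_measure_itv /= lte_fin expfzDr// expr1z.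
by rewrite ifT; [rewrite -EFinB; congr EFin; lra|lra].
Qed.

(** Superlevel sets are intervals. *)
Lemma measurable_nonincreasing (h : R -> \bar R) :
  (forall s t, (0 < s)%R -> (s <= t)%R -> h t <= h s) ->
  measurable_fun (`]0%R, +oo[%classic : set TR) (h : TR -> \bar R).
Proof.
move=> hh; have mD : measurable (`]0%R, +oo[%classic : set TR) by exact: measurable_itv_cara.
apply: (measurability _ (ErealGenOInfty.measurableE R)) => // _ [_ [c ->] <-].
set A := _ `&` _.
have /is_intervalP -> : is_interval (A : set R).
  move=> s t [/=]; rewrite !in_itv/= !andbT => s0 hs [t0 ht] z /andP[sz zt].
  rewrite /= in_itv/= andbT in ht.
  split; rewrite /= in_itv/= andbT; first exact: (lt_le_trans s0 sz).
  by apply: (lt_le_trans ht); apply: hh => //; exact: (lt_le_trans s0 sz).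
exact: measurable_itv_cara.
Qed.

Lemma dyad_gt0 k (t : TR) : dyad k t -> (0 < (t : R))%R.
Proof. by rewrite /dyad/= in_itv/= => /andP[+ _]; apply: lt_le_trans; rewrite exprz_gt0. Qed.

Lemma dyad_inj k l t : dyad k t -> dyad l t -> k = l.
Proof.
rewrite /dyad/= !in_itv/= => /andP[k1 k2] /andP[l1 l2].
apply/eqP; rewrite eq_le -!ltzD1.
have o : (1 < 2 :> R)%R by rewrite ltr1n.
by rewrite -!(ltr_eXz2l o) (le_lt_trans k1)// (le_lt_trans l1).
Qed.

Lemma dyad_cover : `]0%R, +oo[%classic = \bigcup_k dyad k.
Proof.
apply/seteqP; split => t /=; rewrite in_itv/= andbT.
  by move=> /pow2_bracket[k kt]; exists k.
by move=> [k _ /dyad_gt0].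
Qed.

Lemma int_dyad (h : TR -> \bar R) :
  measurable_fun (`]0%R, +oo[%classic : set TR) h ->
  (forall t, (0 < (t : R))%R -> 0 <= h t) ->
  \int[lebR]_(t in `]0%R, +oo[) h t = zsum (fun k => \int[lebR]_(t in dyad k) h t).
Proof.
move=> mh h0.
pose P n := dyad (Posz n); pose N n := dyad (Negz n).
have tP : trivIset setT P.
  by apply/trivIsetP => i j _ _ /eqP ij; apply/seteqP; split => // t [/= /dyad_inj H /H[]].
have tN : trivIset setT N.
  by apply/trivIsetP => i j _ _ /eqP ij; apply/seteqP; split => // t [/= /dyad_inj H /H[]].
have DE : `]0%R, +oo[%classic = (\bigcup_n P n) `|` (\bigcup_n N n).
  rewrite dyad_cover; apply/seteqP; split => t.
    by move=> [[n|n] _ nt]; [left|right]; exists n.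
  by move=> [[n _ nt]|[n _ nt]]; [exists (Posz n)|exists (Negz n)].
have mP : measurable (\bigcup_n P n) by apply: bigcupT_measurable => n; exact: measurable_dyad.
have mN : measurable (\bigcup_n N n) by apply: bigcupT_measurable => n; exact: measurable_dyad.
have h0' t : (\bigcup_n P n `|` \bigcup_n N n) t -> 0 <= h t.
  by rewrite -DE /= in_itv/= andbT; exact: h0.
rewrite DE in mh *; rewrite ge0_integral_setU//; last first.
  apply/disj_setPS => t [[n _ nt] [m _ mt]].
  by have := dyad_inj nt mt.
rewrite !ge0_integral_bigcup//.
- by move=> k; exact: measurable_dyad.
- by apply: measurable_funS mh => //; exact: measurableU.
- by move=> t nt; apply: h0'; right.
- by move=> k; exact: measurable_dyad.
- by apply: measurable_funS mh => //; exact: measurableU.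
- by move=> t nt; apply: h0'; left.
Qed.

End dyadic_partition.

(** * Log-Hoelder exponents on dyadic blocks *)

Section exponents.
Context (R : realType).
Implicit Types (p : R -> R) (k : int) (t y : R).

Definition side (p0 poo : R) k : R := if (k < 0)%R then p0 else poo.

(** For [y] between [2 ^- m] and [Y], an exponent error of order [1 / m] costs a bounded factor. For
    [y] below [2 ^- m] the power is below [2 ^- m] too, since [al >= 1]. With [m] the absolute block
    index, the additive errors are summable. *)
Lemma powR_compare (Y c al be y : R) (m : nat) : (1 <= Y -> 0 <= c -> 1 <= al -> 0 <= y -> y <= Y ->
  `|al - be| <= c / (1 + m%:R) -> y `^ al <= (Y * 2) `^ c * y `^ be + 2 ^- m)%R.
Proof.
move=> Y1 c0 al1 y0 yY abc.
have al0 : (0 < al)%R by exact: lt_le_trans al1.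
have m0 : (0 < 2 ^- m :> R)%R by rewrite invr_gt0 exprn_gt0.
have K0 : (0 <= (Y * 2) `^ c * y `^ be)%R by rewrite mulr_ge0 ?powR_ge0.
have [ym|ym] := ltP y (2 ^- m).
  rewrite -[leLHS]add0r lerD// (le_trans _ (ltW ym))//.
  move: y0; rewrite le_eqVlt => /orP[/eqP <-|y0]; first by rewrite powR0// gt_eqF.
  apply: ge1r_powR => //; rewrite y0/= (le_trans (ltW ym))//.
  by rewrite invf_le1 ?exprn_gt0// exprn_ege1// ler1n.
have {}y0 : (0 < y)%R by exact: lt_le_trans ym.
rewrite -[leLHS]addr0 lerD ?(ltW m0)//.
rewrite -{1}(subrK be al) powRD; last by rewrite (gt_eqF y0) implybT.
rewrite ler_wpM2r ?powR_ge0//.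
have m1 : (0 < 1 + m%:R :> R)%R by rewrite ltr_pwDl.
have abc' : (`|al - be| <= c)%R.
  by rewrite (le_trans abc)// ler_pdivrMr// ler_peMr// lerDl.
have Y20 : (1 <= Y * 2)%R by lra.
have [y1|y1] := leP 1%R y.
  apply: (@le_trans _ _ (y `^ c)%R).
    by apply: ler_powR => //; exact: le_trans (ler_norm _) abc'.
  apply: ge0_ler_powR; rewrite ?nnegrE ?(ltW y0)//; lra.
apply: (@le_trans _ _ (y `^ (- `|al - be|))%R).
  apply: ger_powR; first by rewrite y0 ltW.
  by rewrite lerNl -normrN ler_norm.
rewrite powRN -powRV ?(ltW y0)//.
apply: (@le_trans _ _ ((2 ^+ m) `^ `|al - be|)%R).
  apply: ge0_ler_powR; rewrite ?nnegrE ?invr_ge0 ?(ltW y0) ?exprn_ge0//.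
  by rewrite -[leRHS]invrK lef_pV2// posrE// invr_gt0 exprn_gt0.
rewrite -powR_mulrn// -powRrM.
apply: (@le_trans _ _ (2 `^ c)%R).
  apply: ler_powR; first by rewrite ler1n.
  apply: (@le_trans _ _ (m%:R * (c / (1 + m%:R)))%R); first by rewrite ler_wpM2l.
  by rewrite mulrCA ler_piMr// ler_pdivrMr// mul1r lerDr.
by apply: ge0_ler_powR; rewrite ?nnegrE//; lra.
Qed.

Lemma ln_exprz k : (ln (2 ^ k) = k%:~R * ln 2 :> R)%R.
Proof. by rewrite -powR_intmul// ln_powR. Qed.

(** The window spans two octaves because both block [k] and block [k - 1] are compared with the
    limit exponent of index [k]. *)
Lemma log_holder_window p (p0 poo C : R) : (0 < C)%R ->
  (forall t, 0 < t < 2^-1 -> `|p t - p0| <= C / - ln t)%R ->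
  (forall t, 0 < t -> `|p t - poo| <= C / ln (expR 1 + t))%R ->
  exists c : R, (0 <= c)%R /\ forall k t, (2 ^ (k - 1) <= t <= 2 ^ (k + 1))%R ->
    (`|p t - side p0 poo k| <= c / (1 + `|k|%N%:R))%R.
Proof.
move=> C0 H0 Hoo.
have L0 : (0 < ln 2 :> R)%R by rewrite ln_gt0// ltr1n.
pose e := (C + `|poo - p0|)%R.
have e0 : (0 < e)%R by rewrite ltr_wpDr.
pose A : R := (3 * (1 + (ln 2)^-1))%R.
have A0 : (3 <= A)%R.
  have : (0 < (ln 2)^-1 :> R)%R by rewrite invr_gt0.
  by rewrite /A; lra.
(* [z] is either of the logarithms in the two log-Hoelder conditions. *)
have big (m : nat) (z : R) : ((m%:R - 1) * ln 2 <= z)%R -> ((1 <= z)%R \/ (2 < m)%N) ->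
    (0 < z /\ C / z <= A * e / (1 + m%:R))%R.
  move=> mz zm; have Ce : (C <= e)%R by rewrite lerDl.
  have m1 : (0 < 1 + m%:R :> R)%R by rewrite ltr_pwDl.
  have [m2|m2] := leqP m 2.
    have z1 : (1 <= z)%R by case: zm => //; rewrite ltnNge m2.
    have z0 : (0 < z)%R by exact: lt_le_trans z1.
    split => //; apply: (@le_trans _ _ e).
      by rewrite ler_pdivrMr// (le_trans Ce)// ler_peMr// ltW.
    rewrite ler_pdivlMr// mulrC ler_wpM2r ?(ltW e0)// (le_trans _ A0)//.
    by have := m2; rewrite -(ler_nat R) => ?; lra.
  have m2' : (3 <= m%:R :> R)%R by rewrite ler_nat.
  have z0 : (0 < z)%R by apply: lt_le_trans mz; rewrite mulr_gt0//; lra.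
  split => //; rewrite ler_pdivrMr// mulrAC ler_pdivlMr//.
  apply: (@le_trans _ _ (e * (A * ((m%:R - 1) * ln 2))))%R; last first.
    rewrite mulrCA mulrA ler_wpM2l//.
    by rewrite mulr_ge0 ?(ltW e0)//; lra.
  apply: ler_pM; rewrite ?(ltW C0) ?(ltW m1)//.
  have -> : (A * ((m%:R - 1) * ln 2) = 3 * (m%:R - 1) * (ln 2 + 1))%R.
    by rewrite /A; field; rewrite gt_eqF.
  apply: (@le_trans _ _ (3 * (m%:R - 1))%R); first by lra.
  by rewrite ler_peMr ?lerDr ?(ltW L0)// mulr_ge0//; lra.
exists (A * e)%R; split; first by rewrite mulr_ge0 ?(ltW e0)//; lra.
move=> k t /andP[kt tk].
have t0 : (0 < t)%R by apply: lt_le_trans kt; rewrite exprz_gt0.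
have e1 : (1 <= ln (expR 1 + t))%R.
  by rewrite -[leLHS](@expRK R) ler_ln ?posrE ?expR_gt0 ?addr_gt0 ?expR_gt0// lerDl ltW.
rewrite /side; case: ifPn => k0.
  have [m km] : exists m : nat, k = (- m.+1%:Z)%R.
    by case: k k0 {kt tk} => // m _; exists m; rewrite NegzE.
  have ak : `|k|%N = m.+1 by rewrite km abszN absz_nat.
  rewrite ak; have [m1|m1] := leqP m 1.
    apply: (@le_trans _ _ e).
      rewrite -(subrK poo (p t)) -addrA (le_trans (ler_normD _ _))// lerD2r.
      apply: (le_trans (Hoo t t0)).
      by rewrite ler_pdivrMr ?(lt_le_trans ltr01)// ler_peMr// ltW.
    rewrite ler_pdivlMr ?ltr_pwDl// mulrC ler_wpM2r ?(ltW e0)// (le_trans _ A0)//.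
    by have := m1; rewrite -(ler_nat R) -natr1 => ?; lra.
  have tm : (t <= 2 ^ (- m%:Z))%R.
    rewrite (le_trans tk)// km (_ : (- m.+1%:Z + 1 = - m%:Z)%R)//.
    by rewrite -addn1 PoszD opprD subrK.
  have t2 : (t < 2^-1)%R.
    apply: (le_lt_trans tm); rewrite -[ltRHS]/(2 ^ (- 1%:Z))%R ltr_eXz2l ?ltr1n//.
    by rewrite ltrN2.
  have lt : (m%:R * ln 2 <= - ln t)%R.
    rewrite lerNr (le_trans (_ : _ <= ln (2 ^ (- m%:Z))))%R//.
      by rewrite ler_ln ?posrE ?exprz_gt0.
    by rewrite ln_exprz intrN mulNr.
  apply: (le_trans (H0 t _)); first by rewrite t0 t2.
  by apply: (big m.+1 _ _ _).2; [rewrite -natr1 addrK|right].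
have [m km] : exists m : nat, k = m%:Z.
  by case: k k0 {kt tk} => // m _; exists m.
rewrite km absz_nat.
apply: le_trans (Hoo t t0) _.
apply: (big m _ _ _).2; last by left.
apply: (@le_trans _ _ (ln t)).
  rewrite km in kt.
  rewrite -[X in (X * _)%R]/((m%:Z)%:~R - 1%:~R)%R -intrB -ln_exprz ler_ln ?posrE ?exprz_gt0//.
by rewrite ler_ln ?posrE ?addr_gt0 ?expR_gt0// lerDr expR_ge0.
Qed.

End exponents.

Section tame_exponents.
Context (R : realType).
Implicit Types (p P : R -> R) (k : int) (t : R).
Local Notation lebR := (@completed_lebesgue_measure R).
Local Notation TR := (caratheodory_type ((@wlength R (idfun : R -> R))^*)%mu).

(** What is kept of [class_P0] after division by [tau]. The lower bound 1 holds only almost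
    everywhere, since it comes from an essential infimum. *)
Record tame P (p0 poo c : R) : Prop := Tame {
  tame0 : (1 < p0)%R ;
  tameoo : (1 < poo)%R ;
  tamec : (0 <= c)%R ;
  tame_window : forall k t, (2 ^ (k - 1) <= t <= 2 ^ (k + 1))%R ->
    (`|P t - side p0 poo k| <= c / (1 + `|k|%N%:R))%R ;
  tame_ae : {ae lebR, forall t : TR, (0 < (t : R))%R -> (1 <= P t)%R} ;
  tame_measurable : measurable_fun (`]0%R, +oo[%classic : set TR) (P : TR -> R) ;
  tame_gt0 : forall t, (0 < t -> 0 < P t)%R }.

Lemma dyad_window k t : dyad k (t : TR) -> (2 ^ (k - 1) <= t <= 2 ^ (k + 1))%R.
Proof.
rewrite /dyad/= in_itv/= => /andP[kt tk]; rewrite (ltW tk) andbT.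
by apply: le_trans kt; apply: ler_weXz2l; [rewrite ler1n|rewrite gerBl].
Qed.

Lemma ae_dyad (A : set TR) k : {ae lebR, forall t, A t} -> exists2 t, dyad k t & A t.
Proof.
move=> [N [mN N0 AN]]; apply/not_exists2P => H.
have : lebR (dyad k) <= 0.
  rewrite -N0; apply: le_measure; rewrite ?inE//; first exact: measurable_dyad.
  by move=> t kt; apply: AN => /= At; have [] := H t.
by rewrite lebR_dyad lee_fin leNgt exprz_gt0.
Qed.

(** The margin between [tau] and [tau'] keeps the limits strictly above 1: every block contains
    points with [p t / tau >= tau' / tau], and on far blocks such values are arbitrarily close to
    the limit. *)
Lemma class_P0_tame p (tau : R) : class_P0 p -> (0 < tau)%R -> tau%:E < exponent_inf p ->
  exists (p0 poo c : R), tame (fun t => p t / tau)%R p0 poo c.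
Proof.
move=> [[mp pp] _ _ _ [p0 [poo [C [_ _ C0 H0 Hoo]]]]] tau0 tauI.
have [tau' [tt' tI]] : exists tau', (tau < tau')%R /\ tau'%:E <= exponent_inf p.
  case: (exponent_inf p) tauI => [e| |]//; first by rewrite lte_fin => te; exists e.
  by move=> _; exists (tau + 1)%R; rewrite ltrDl ltr01 leey.
have aeP : {ae lebR, forall t : TR, (0 < (t : R))%R -> (tau' / tau <= p t / tau)%R}.
  have /ess_infP [N [mN N0 HN]] := tI.
  exists (N `&` `]0%R, +oo[%classic); split => //.
    by apply: measurableI => //; exact: measurable_itv_cara.
  move=> t /= /not_implyP[t0 H]; split; last by rewrite in_itv/= t0.
  by apply: HN => /=; rewrite lee_fin => H'; apply: H; rewrite ler_pM2r ?invr_gt0.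
have [c [c0 W]] := log_holder_window C0 H0 Hoo.
have W' k t : (2 ^ (k - 1) <= t <= 2 ^ (k + 1))%R ->
    (`|p t / tau - side (p0 / tau) (poo / tau) k| <= (c / tau) / (1 + `|k|%N%:R))%R.
  move=> /W kt; rewrite (_ : side _ _ _ = side p0 poo k / tau)%R; last by rewrite /side; case: ifP.
  rewrite -mulrBl normrM [(`|tau^-1|)%R]ger0_norm ?invr_ge0 ?(ltW tau0)//.
  by rewrite mulrAC ler_wpM2r// invr_ge0 ltW.
have tt1 : (1 < tau' / tau)%R by rewrite ltr_pdivlMr// mul1r.
have lim (q : R) : (forall m : nat, exists k : int, (m <= `|k|%N)%N /\ side (p0 / tau) (poo / tau) k = q) -> (1 < q)%R.
  move=> Hk; apply: lt_le_trans tt1 _; rewrite leNgt; apply/negP => qt.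
  pose d := (tau' / tau - q)%R; have d0 : (0 < d)%R by rewrite subr_gt0.
  have [k [mk kq]] := Hk (Num.bound (c / tau / d)%R).
  have [t kt Ht] := ae_dyad k aeP.
  have := W' k t (dyad_window kt); rewrite kq.
  have {}Ht := Ht (dyad_gt0 kt).
  move=> /(le_trans (ler_norm _)); rewrite leNgt => /negP; apply.
  have k1 : (0 < 1 + `|k|%N%:R :> R)%R by rewrite ltr_pwDl.
  apply: (@lt_le_trans _ _ d); last by rewrite lerD2r.
  rewrite ltr_pdivrMr// -ltr_pdivrMl// mulrC.
  apply: (lt_le_trans (archi_boundP _)).
    by rewrite !divr_ge0 ?(ltW tau0) ?(ltW d0).
  by rewrite (le_trans (_ : _ <= `|k|%N%:R)%R)// ?ler_nat// lerDr.
exists (p0 / tau)%R, (poo / tau)%R, (c / tau)%R; split.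
- by apply: lim => m; exists (- m.+1%:Z)%R; rewrite abszN absz_nat; split.
- by apply: lim => m; exists m%:Z; rewrite absz_nat.
- by rewrite divr_ge0// ltW.
- exact: W'.
- move: aeP => [N [mN N0 HN]]; exists N; split => // t H; apply: HN => H'.
  by apply: H => t0; rewrite (le_trans (ltW tt1))// H'.
- apply: measurable_funM => //; exact: mp.
- by move=> t t0; rewrite divr_gt0// pp.
Qed.

Definition psi (p0 poo : R) k : R := (k%:~R / side p0 poo k)%R.

Lemma side_gt1 (p0 poo : R) k : (1 < p0 -> 1 < poo -> 1 < side p0 poo k)%R.
Proof. by rewrite /side; case: ifP. Qed.

(** The exponent of 2 has two errors: replacing the binary logarithm of [t] by [k] costs at most 1,
    and replacing [P t] by its limit costs at most [c], because the factor [k] meets the decay of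
    [tame_window]. *)
Lemma tame_scale P (p0 poo c : R) k t : tame P p0 poo c ->
  (2 ^ (k - 1) <= t <= 2 ^ (k + 1))%R -> (1 <= P t)%R ->
  (2 `^ (psi p0 poo k - (1 + c)) <= t `^ (P t)^-1 <= 2 `^ (psi p0 poo k + (1 + c)))%R.
Proof.
move=> T kt Pt; have W := tame_window T kt; move: kt => /andP[kt tk].
have t0 : (0 < t)%R by apply: lt_le_trans kt; rewrite exprz_gt0.
have L0 : (0 < ln 2 :> R)%R by rewrite ln_gt0// ltr1n.
pose x := (ln t / ln 2)%R.
have tx : t = (2 `^ x)%R.
  by rewrite /powR pnatr_eq0/= /x divfK ?gt_eqF// lnK.
have kx : (k%:~R - 1 <= x)%R.
  rewrite ler_pdivlMr// -[X in (_ - X)%R]/(1%:~R)%R -intrB -ln_exprz.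
  by rewrite ler_ln ?posrE ?exprz_gt0.
have xk : (x <= k%:~R + 1)%R.
  rewrite ler_pdivrMr// -[X in (_ + X)%R]/(1%:~R)%R -intrD -ln_exprz.
  by rewrite ler_ln ?posrE ?exprz_gt0.
have s1 := side_gt1 k (tame0 T) (tameoo T).
set s := side p0 poo k in s1 W *.
have Pp : (0 < P t)%R by exact: lt_le_trans Pt.
have sp : (0 < s)%R by exact: lt_trans s1.
have key : (`|x / P t - psi p0 poo k| <= 1 + c)%R.
  have -> : (x / P t - psi p0 poo k = (x - k%:~R) / P t + k%:~R * (s - P t) / (P t * s))%R.
    by rewrite /psi -/s; field; rewrite !gt_eqF.
  apply: (le_trans (ler_normD _ _)); apply: lerD.
    rewrite normrM normfV (gtr0_norm Pp) ler_pdivrMr// mul1r (le_trans _ Pt)//.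
    by rewrite ler_norml; apply/andP; split; lra.
  rewrite normrM normfV (gtr0_norm (mulr_gt0 Pp sp)) ler_pdivrMr ?mulr_gt0//.
  apply: (@le_trans _ _ c); last by rewrite ler_peMr ?(tamec T)// mulr_ege1// ltW.
  rewrite normrM distrC; apply: le_trans (ler_wpM2l (normr_ge0 _) W) _.
  rewrite -intr_norm -natr_absz mulrCA ler_piMr ?(tamec T)//.
  by rewrite ler_pdivrMr ?ltr_pwDl// mul1r lerDr.
move: key; rewrite ler_norml => /andP[k1 k2].
rewrite [X in (_ <= X `^ _ <= _)%R]tx -powRrM.
by apply/andP; split; apply: ler_powR; rewrite ?ler1n//; lra.
Qed.

End tame_exponents.

(** * The modular as a sum over dyadic blocks *)

Section modular.
Context (R : realType).
Implicit Types (k : int) (t : R) (h : R -> \bar R).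
Local Notation lebR := (@completed_lebesgue_measure R).
Local Notation TR := (caratheodory_type ((@wlength R (idfun : R -> R))^*)%mu).
Variables (P Q : R -> R) (p0 poo cp q0 qoo cq : R).
Hypothesis tP : tame P p0 poo cp.
Hypothesis tQ : tame Q q0 qoo cq.
Local Notation psi := (psi p0 poo).

Definition integrand h (t : R) : \bar R := (t `^ (Q t / P t - 1))%R%:E * h t `^ Q t.

Definition nonincr h := (forall t, 0 <= h t) /\
  (forall s t, (0 < s)%R -> (s <= t)%R -> h t <= h s).

Lemma integrand_ge0 h t : 0 <= integrand h t.
Proof. by apply: mule_ge0; [rewrite lee_fin powR_ge0|exact: poweR_ge0]. Qed.

(** This form exhibits the dilation-invariant measure [dt / t] and the factor that [tame_scale]
    controls. *)
Lemma integrandE h t : nonincr h -> (0 < t)%R ->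
  integrand h t = t^-1%:E * ((t `^ (P t)^-1)%:E * h t) `^ Q t.
Proof.
move=> [h0 _] t0; rewrite /integrand poweRM ?lee_fin ?powR_ge0// poweR_EFin muleA -EFinM.
congr (_%:E * _); rewrite -powRrM [((P t)^-1 * _)%R]mulrC powRB.
  by rewrite powRr1 ?(ltW t0)// [RHS]mulrC.
by rewrite (gt_eqF t0) implybT.
Qed.

Lemma measurable_integrand h : nonincr h ->
  measurable_fun (`]0%R, +oo[%classic : set TR) (integrand h : TR -> \bar R).
Proof.
move=> [h0 hn]; have mD : measurable (`]0%R, +oo[%classic : set TR) by exact: measurable_itv_cara.
have mQ := tame_measurable tQ; have mP := tame_measurable tP.
have pos t : (t \in `]0%R, +oo[) -> (0 < t)%R by rewrite in_itv/= andbT.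
apply: emeasurable_funM.
  apply/measurable_EFinP.
  apply: (eq_measurable_fun (fun t : TR => expR ((Q t / P t - 1) * ln (t : R))%R)).
    by move=> t /set_mem/= /pos t0; rewrite /powR gt_eqF.
  apply: (measurableT_comp (@measurable_expR R)); apply: measurable_funM.
    apply: measurable_funB; last exact: measurable_cst.
    apply: measurable_funM; first exact: mQ.
    apply: (eq_measurable_fun (fun t : TR => expR (- ln (P t)))).
      by move=> t /set_mem/= /pos t0; rewrite expRN lnK// posrE (tame_gt0 tP).
    apply: (measurableT_comp (@measurable_expR R)); apply: measurable_funN.
    exact: (measurableT_comp (@measurable_ln R)).
  apply: (measurableT_comp (@measurable_ln R)); apply: measurable_funTS.
  by move=> _ B mB; rewrite setTI; apply: sub_caratheodory.
apply: measurable_fun_poweR => //.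
- exact: measurable_nonincreasing.
- by move=> t /=; rewrite in_itv/= andbT; exact: (tame_gt0 tQ).
Qed.

Definition modular h : \bar R := \int[lebR]_(t in `]0%R, +oo[) integrand h t.

Definition modularD h k : \bar R := \int[lebR]_(t in dyad k) integrand h t.

Lemma modularE h : nonincr h -> modular h = zsum (modularD h).
Proof.
move=> hn; apply: int_dyad; first exact: measurable_integrand.
by move=> t _; exact: integrand_ge0.
Qed.

Lemma modularD_ge0 h k : 0 <= modularD h k.
Proof. by apply: integral_ge0 => t _; exact: integrand_ge0. Qed.

Lemma measurable_integrand_dyad h k : nonincr h ->
  measurable_fun (dyad k) (integrand h : TR -> \bar R).
Proof.
move=> hn; apply: measurable_funS (measurable_integrand hn).
  exact: measurable_itv_cara.
by move=> t /dyad_gt0; rewrite /= in_itv/= andbT.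
Qed.

Lemma dyad_inv k (t : TR) : dyad k t -> ((2 ^ (k + 1))^-1 <= (t : R)^-1 <= (2 ^ k)^-1)%R.
Proof.
move=> kt; have t0 := dyad_gt0 kt.
have p k' : (0 < 2 ^ k' :> R)%R by rewrite exprz_gt0.
move: kt; rewrite /dyad/= in_itv/= => /andP[kt tk].
by rewrite !lef_pV2 ?posrE// (ltW tk) kt.
Qed.

(** As [h] is nonincreasing, [h (2 ^ k)] is at most the values on the preceding block, of length
    [2 ^ k / 2], whence the factor 2. [V], [A] and [e] stay free because [modular_lower] uses the
    estimate for finiteness, for a crude bound and for the final power. *)
Lemma modularD_lower h k (V A e : R) : nonincr h -> (0 <= V)%R -> (0 <= A)%R -> (0 <= e)%R ->
  (forall s, (2 ^ (k - 1) <= s <= 2 ^ (k + 1))%R -> (1 <= Q s)%R ->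
    V%:E <= A%:E * ((2 `^ (psi k - (1 + cp)))%:E * h (2 ^ k)%R) `^ Q s + e%:E) ->
  V%:E <= (2 * A)%:E * modularD h (k - 1) + e%:E.
Proof.
move=> hn V0 A0 e0 H.
have p2 : (0 < 2 ^ k :> R)%R by rewrite exprz_gt0.
have mD := @measurable_dyad R (k - 1).
have mI := @measurable_integrand_dyad h (k - 1)%R hn.
have lD : lebR (dyad (k - 1)) = (2 ^ k / 2)%:E by rewrite lebR_dyad expfzDr.
have k1 : (k - 1 + 1 = k)%R by rewrite subrK.
have main : \int[lebR]_(t in dyad (k - 1)) (V / 2 ^ k)%:E <=
    \int[lebR]_(t in dyad (k - 1)) (A%:E * integrand h t + (e / 2 ^ k)%:E).
  apply: ae_ge0_le_integral.
  - exact: mD.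
  - by move=> t _; rewrite lee_fin divr_ge0// ltW.
  - exact: measurable_cst.
  - move=> t _; apply: adde_ge0; last by rewrite lee_fin divr_ge0// ltW.
    by apply: mule_ge0; [rewrite lee_fin|exact: integrand_ge0].
  - apply: emeasurable_funD; last exact: measurable_cst.
    by apply: emeasurable_funM; [exact: measurable_cst|exact: mI].
  move: (tame_ae tP) (tame_ae tQ); apply: filterS2 => t Pt Qt kt.
  have t0 := dyad_gt0 kt.
  have {}Pt := Pt t0; have {}Qt := Qt t0.
  have /andP[it _] := dyad_inv kt; rewrite k1 in it.
  have t2k : ((t : R) <= 2 ^ k)%R by move: kt; rewrite /dyad/= in_itv/= k1 => /andP[_ /ltW].
  have win : (2 ^ (k - 1) <= (t : R) <= 2 ^ (k + 1))%R.
    move: kt; rewrite /dyad/= in_itv/= => /andP[-> _] /=; apply: (le_trans t2k).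
    by apply: ler_weXz2l; rewrite ?ler1n// lerDl.
  rewrite integrandE//.
  have /andP[sc _] := tame_scale tP win Pt.
  apply: (@le_trans _ _ ((2 ^ k)^-1%:E * (A%:E * ((2 `^ (psi k - (1 + cp)))%:E * h (2 ^ k)%R) `^ Q t + e%:E))).
    by rewrite mulrC EFinM lee_wpmul2l ?lee_fin ?invr_ge0 ?(ltW p2)//; exact: H.
  rewrite ge0_muleDr ?mule_ge0 ?poweR_ge0 ?lee_fin//.
  apply: leeD; last by rewrite -EFinM mulrC.
  rewrite muleCA lee_wpmul2l ?lee_fin//.
  apply: lee_pmul; rewrite ?lee_fin ?invr_ge0 ?(ltW p2) ?poweR_ge0//.
  apply: poweR_le; first by rewrite (le_trans ler01).
    by apply: mule_ge0; [rewrite lee_fin powR_ge0|exact: hn.1].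
  apply: lee_pmul; rewrite ?lee_fin ?powR_ge0 ?hn.1//.
  exact: hn.2.
have I0 (t : TR) : dyad (k - 1) t -> 0 <= integrand h t by move=> _; exact: integrand_ge0.
have Ic (z : R) : \int[lebR]_(t in dyad (k - 1)) z%:E = (z * (2 ^ k / 2))%:E.
  by rewrite (integral_cst _ mD) EFinM; congr (_ * _); exact: lD.
have splitI : \int[lebR]_(t in dyad (k - 1)) (A%:E * integrand h t + (e / 2 ^ k)%:E) =
    A%:E * \int[lebR]_(t in dyad (k - 1)) integrand h t +
    \int[lebR]_(t in dyad (k - 1)) (e / 2 ^ k)%:E.
  rewrite -(@ge0_integralZl _ _ _ lebR _ mD _ mI A%:E I0) ?lee_fin//; apply: ge0_integralD.
  - exact: mD.
  - by move=> t kt; apply: mule_ge0; [rewrite lee_fin|exact: I0].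
  - by apply: emeasurable_funM; [exact: measurable_cst|exact: mI].
  - by move=> t _; rewrite lee_fin divr_ge0// ltW.
  - exact: measurable_cst.
move: main; rewrite splitI.
rewrite -/(modularD h (k - 1)) !Ic.
have cancel2 (z : R) : (z / 2 ^ k * (2 ^ k / 2) = z / 2)%R by field; rewrite gt_eqF.
rewrite !cancel2 => H'.
have := lee_wpmul2l (ler0n R 2 : (0 <= 2%:E)) H'.
rewrite ge0_muleDr ?mule_ge0 ?modularD_ge0 ?lee_fin ?divr_ge0//.
rewrite -!EFinM muleA -EFinM.
by rewrite !(mulrCA 2%R) !mulfV// !mulr1.
Qed.

End modular.

Section modular_bounds.
Context (R : realType).
Implicit Types (k l : int) (t : R) (h : R -> \bar R).
Local Notation lebR := (@completed_lebesgue_measure R).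
Variables (P Q : R -> R) (p0 poo cp q0 qoo cq : R).
Hypothesis tP : tame P p0 poo cp.
Hypothesis tQ : tame Q q0 qoo cq.
Local Notation psi := (psi p0 poo).
Local Notation qs := (side q0 qoo).
Local Notation modular := (modular P Q).
Local Notation modularD := (modularD P Q).

Let qmax := Num.max q0 qoo.

Let qs1 k : (1 < qs k)%R.
Proof. exact: side_gt1 (tame0 tQ) (tameoo tQ). Qed.

Let qsmax k : (qs k <= qmax)%R.
Proof. by rewrite /side /qmax; case: ifP; rewrite le_max lexx ?orbT. Qed.

Lemma zsum_half : zsum (fun k => (2 ^- `|k|%N)%:E) = 3%:E :> \bar R.
Proof.
rewrite (eq_zsum (b := fun k => (2^-1 ^+ `|k|%N)%:E)); last by move=> k; rewrite exprVn.
rewrite zsum_geometric; last by rewrite invr_ge0 ler0n/= invf_lt1// ltr1n.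
by congr EFin; field.
Qed.

Lemma modular_lower : exists S : R, (1 <= S)%R /\ forall h, nonincr h -> modular h <= 1 ->
  exists x : int -> R, [/\ forall k, (0 <= x k)%R,
    forall k, h (2 ^ k)%R = (2 `^ (- psi k) * x k)%:E,
    forall k, (x k <= S)%R &
    zsum (fun k => (x k `^ qs k)%:E) <= S%:E].
Proof.
pose D := (2 `^ (1 + cp))%R.
have cp0 := tamec tP; have cq0 := tamec tQ.
have D1 : (1 <= D)%R by rewrite -(@powRr0 R 2) ler_powR ?ler1n// addr_ge0.
have D0 : (0 < D)%R by exact: lt_le_trans D1.
pose E := (D `^ qmax)%R.
have E0 : (0 <= E)%R by exact: powR_ge0.
pose A := ((3 * 2) `^ cq)%R.
have A0 : (0 <= A)%R by exact: powR_ge0.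
exists (3 * D + E * (2 * A + 3))%R; split.
  by apply: ler_wpDr; [rewrite mulr_ge0 ?addr_ge0 ?mulr_ge0|lra].
move=> h hn hm.
have J0 := modularD_ge0 P Q h.
have sumJ : zsum (modularD h) <= 1 by rewrite -(modularE tP tQ hn).
have J1 k : modularD h k <= 1 by apply: le_trans sumJ; exact: zsum_ge_term.
pose s k := (2 `^ (psi k - (1 + cp)))%R.
have s0 k : (0 < s k)%R by rewrite powR_gt0.
(* With [V = 3], [A = 1] and [e = 0], an infinite value would give [3 <= 2]. *)
have fin k : h (2 ^ k)%R \is a fin_num.
  rewrite ge0_fin_numE ?hn.1// ltey; apply/eqP => hy.
  have : 3%:E <= (2 * 1)%:E * modularD h (k - 1) + 0%:E.
    apply: (modularD_lower tP tQ hn) => // z _ Qz.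
    have sk : 0 < (2 `^ (psi k - (1 + cp)))%:E by rewrite lte_fin; exact: s0.
    by rewrite hy (gt0_muley sk) poweRyr ?mul1e ?adde0 ?leey// gt_eqF// (lt_le_trans ltr01).
  rewrite adde0 mulr1 => H; have e2 : 0 <= 2%:E :> \bar R by rewrite lee_fin.
  have := le_trans H (lee_wpmul2l e2 (J1 (k - 1)%R)).
  by rewrite mule1 lee_fin ler_nat.
pose hk k := fine (h (2 ^ k)%R).
have hkE k : h (2 ^ k)%R = (hk k)%:E by rewrite fineK.
have hk0 k : (0 <= hk k)%R by rewrite -lee_fin -hkE hn.1.
pose v k := (s k * hk k)%R.
have v0 k : (0 <= v k)%R by rewrite mulr_ge0 ?(ltW (s0 k)).
(* The crude bound comes first, since [powR_compare] exchanges exponents only for bounded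
   quantities. *)
have v3 k : (v k <= 3)%R.
  have := @modularD_lower _ _ _ _ _ _ _ _ _ tP tQ h k (v k) 1 1 hn (v0 k) ler01 ler01.
  rewrite hkE -!EFinM -/(s k) -/(v k) mulr1 => H.
  have {}H : (v k)%:E <= 2%:E * modularD h (k - 1) + 1%:E.
    apply: H => z _ Qz; rewrite poweR_EFin mul1e -EFinD lee_fin.
    have [v1|v1] := leP (v k) 1%R; first by rewrite (le_trans v1)// lerDr powR_ge0.
    by rewrite (le_trans (le1r_powR (ltW v1) Qz))// lerDl.
  rewrite -lee_fin (le_trans H)// (_ : 3 = 2 + 1)%R ?EFinD; last by lra.
  by rewrite leeD2r// -[leRHS]mule1 lee_wpmul2l ?lee_fin.
have vq k : (v k `^ qs k)%:E <= (2 * A)%:E * modularD h (k - 1) + (2 ^- `|k|%N)%:E.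
  apply: (modularD_lower tP tQ hn) => //; first exact: powR_ge0.
  move=> z wz Qz.
  have -> : (2 `^ (psi k - (1 + cp)))%:E * h (2 ^ k)%R = (v k)%:E by rewrite hkE -EFinM.
  rewrite poweR_EFin -EFinM -EFinD lee_fin.
  apply: powR_compare => //; first by rewrite ler1n.
  - exact: ltW.
  - by rewrite distrC; exact: (tame_window tQ wz).
exists (fun k => D * v k)%R; split.
- by move=> k; rewrite mulr_ge0 ?(ltW D0).
- move=> k; rewrite hkE; congr EFin; rewrite /v mulrA mulrA.
  have -> : (2 `^ (- psi k) * D * s k = 1)%R; last by rewrite mul1r.
  rewrite /D /s -!powRD; try by rewrite pnatr_eq0 implybT.
  by rewrite (_ : _ + _ = 0)%R ?powRr0//; ring.
- move=> k; rewrite (@le_trans _ _ (3 * D)%R)//.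
    by rewrite mulrC ler_wpM2r ?(ltW D0).
  by rewrite lerDl mulr_ge0// addr_ge0// mulr_ge0.
apply: (@le_trans _ _ (zsum (fun k => E%:E * ((2 * A)%:E * modularD h (k - 1) + (2 ^- `|k|%N)%:E)))).
  apply: zsum_le => k; first by rewrite lee_fin powR_ge0.
  rewrite powRM ?(ltW D0)// EFinM; apply: lee_pmul; rewrite ?lee_fin ?powR_ge0//.
  exact: ler_powR.
have t0 k : 0 <= (2 ^- `|k|%N)%:E :> \bar R by rewrite lee_fin invr_ge0 exprn_ge0.
have u0 k : 0 <= (2 * A)%:E * modularD h (k - 1).
  by apply: mule_ge0; rewrite ?J0// lee_fin mulr_ge0.
rewrite zsumZ//; last by move=> k; exact: adde_ge0.
rewrite zsumD// zsum_half zsumZ ?mulr_ge0//.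
rewrite (zsum_shift (-1)%R J0).
apply: (@le_trans _ _ (E%:E * ((2 * A)%:E * 1 + 3%:E))).
  rewrite lee_wpmul2l ?lee_fin// leeD2r// lee_wpmul2l ?lee_fin ?mulr_ge0//.
rewrite mule1 -EFinD -EFinM lee_fin lerDr mulr_ge0 ?(ltW D0)//.
Qed.

(* [Y k ^ qs k] is the convolution of [x l ^ qs k] with a geometric kernel, plus a
   positive term. Where [qs k <> qs l], the indices lie on both sides of [0] and
   the kernel splits as a product. *)
Lemma kernel_bound (e S : R) : (0 < e)%R -> (1 <= S)%R -> exists S' : R, (1 <= S')%R /\
  forall x : int -> R, (forall k, 0 <= x k)%R -> (forall k, x k <= S)%R ->
    zsum (fun k => (x k `^ qs k)%:E) <= S%:E ->
  exists Y : int -> R, [/\ forall k, (0 < Y k)%R,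
    forall k l, (x l * 2 `^ (- (e * `|(k - l)%R|%N%:R)) < Y k)%R &
    zsum (fun k => (Y k `^ qs k)%:E) <= S'%:E].
Proof.
move=> e0 S1; pose w : R := (2 `^ (- e))%R.
have S0 : (0 <= S)%R by exact: le_trans S1.
have w0 : (0 < w)%R by exact: powR_gt0.
have w1 : (w < 1)%R.
  rewrite /w powRN invf_lt1 ?powR_gt0//.
  by have := @gt0_ltr_powR R e e0 1%R 2%R; rewrite powR1; apply; rewrite ?nnegrE ?ltr1n.
have wE (m : nat) : (2 `^ (- (e * m%:R)) = w ^+ m :> R)%R.
  by rewrite -mulNr powRrM powR_mulrn ?powR_ge0.
have w01 : (0 <= w < 1)%R by rewrite (ltW w0) w1.
pose W : R := ((1 - w)^-1 * (1 + w))%R.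
have W0 : (0 <= W)%R by rewrite mulr_ge0 ?invr_ge0 ?subr_ge0 ?addr_ge0 ?(ltW w0) ?(ltW w1).
have wp m : (0 <= w ^+ m)%R by rewrite exprn_ge0 ?(ltW w0).
have wp' m : 0 <= (w ^+ m)%:E :> \bar R by rewrite lee_fin.
have sumw l : zsum (fun k => (w ^+ `|(k - l)%R|%N)%:E) = W%:E.
  by rewrite (@zsum_shift _ (fun k => (w ^+ `|k|%N)%:E) (- l)%R)// zsum_geometric.
(* Bounds [x l] to the power [qs k] when [k] and [l] lie on different sides of 0. *)
pose X := (S `^ qmax)%R.
have X0 : (0 <= X)%R by exact: powR_ge0.
exists (1 + (W * S + X * W * W + 3))%R; split.
  rewrite lerDl; apply: addr_ge0 => //; apply: addr_ge0; first exact: mulr_ge0.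
  by apply: mulr_ge0 => //; exact: mulr_ge0.
move=> x x0 xS sx.
have xq0 k l : 0 <= (x l `^ qs k)%:E :> \bar R by rewrite lee_fin powR_ge0.
have t0 k : 0 <= (2 ^- `|k|%N)%:E :> \bar R by rewrite lee_fin invr_ge0 exprn_ge0.
pose a k l : \bar R := (w ^+ `|(k - l)%R|%N)%:E * (x l `^ qs k)%:E.
have a0 k l : 0 <= a k l by exact: mule_ge0.
(* The summable extra term makes [Z] positive and the inequality [zt] strict, which later feeds the
   strict hypothesis of [rearrangement_lt]. *)
pose Z k := zsum (a k) + (2 ^- `|k|%N)%:E.
have Z0 k : 0 <= Z k by rewrite adde_ge0// zsum_ge0.
have absE (k l : int) : ((k < 0) != (l < 0))%R -> `|(k - l)%R|%N = (`|k| + `|l|)%N.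
  by case: k => i; case: l => j//= _; rewrite ?NegzE; lia.
have abound k l : a k l <= (x l `^ qs l)%:E * (w ^+ `|(k - l)%R|%N)%:E +
    (X * w ^+ `|k|%N)%:E * (w ^+ `|l|%N)%:E.
  have r0 : 0 <= (X * w ^+ `|k|%N)%:E * (w ^+ `|l|%N)%:E.
    by apply: mule_ge0; rewrite lee_fin// mulr_ge0.
  have l0 : 0 <= (x l `^ qs l)%:E * (w ^+ `|(k - l)%R|%N)%:E by exact: mule_ge0.
  have [kl|kl] := eqVneq (k < 0)%R (l < 0)%R.
    have -> : a k l = (x l `^ qs l)%:E * (w ^+ `|(k - l)%R|%N)%:E.
      by rewrite /a muleC; congr (_ * _); rewrite /side kl.
    exact: leeDl.
  rewrite -[leLHS]add0e; apply: leeD => //.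
  rewrite /a -!EFinM lee_fin mulrC -mulrA ler_pM ?powR_ge0//.
    rewrite /X; apply: (@le_trans _ _ (S `^ qs k)%R); last exact: ler_powR.
    apply: ge0_ler_powR; rewrite ?nnegrE//; first exact/ltW/(lt_trans ltr01).
  by rewrite -exprD -(absE _ _ kl).
have sumZ : zsum Z <= (W * S + X * W * W + 3)%:E.
  rewrite zsumD//; last by move=> k; exact: zsum_ge0.
  rewrite zsum_half [leRHS]EFinD leeD2r//.
  pose b k l := (x l `^ qs l)%:E * (w ^+ `|(k - l)%R|%N)%:E : \bar R.
  pose c k l := (X * w ^+ `|k|%N)%:E * (w ^+ `|l|%N)%:E : \bar R.
  have b0 k l : 0 <= b k l by exact: mule_ge0.
  have Xw k : (0 <= X * w ^+ `|k|%N)%R by exact: mulr_ge0.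
  have c0 k l : 0 <= c k l by apply: mule_ge0; rewrite lee_fin.
  apply: (@le_trans _ _ (zsum (fun k => zsum (b k) + zsum (c k)))).
    apply: zsum_le => k; first exact: zsum_ge0.
    by rewrite -zsumD//; apply: zsum_le.
  rewrite zsumD; try by move=> k; exact: zsum_ge0.
  rewrite [leRHS]EFinD; apply: leeD.
    rewrite zsum_interchange//.
    rewrite (eq_zsum (b := fun l => W%:E * (x l `^ qs l)%:E)); last first.
      by move=> l; rewrite /b zsumZ ?powR_ge0// sumw muleC.
    by rewrite zsumZ// [leRHS]EFinM lee_wpmul2l ?lee_fin.
  rewrite (eq_zsum (b := fun k => (X * W)%:E * (w ^+ `|k|%N)%:E)); last first.
    move=> k; rewrite /c zsumZ// zsum_geometric// -/W -!EFinM; congr EFin; ring.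
  rewrite zsumZ; [|exact: mulr_ge0|by move=> k].
  by rewrite zsum_geometric// -EFinM.
have Zfin k : Z k \is a fin_num.
  rewrite ge0_fin_numE//; apply: le_lt_trans (zsum_ge_term k Z0) _.
  by apply: (le_lt_trans sumZ); exact: ltry.
pose z k := fine (Z k).
have zE i : Z i = (z i)%:E.
  exact: (esym (fineK (Zfin i))).
have zt k l : (w ^+ `|(k - l)%R|%N * x l `^ qs k < z k)%R.
  rewrite -lte_fin -zE EFinM; apply: (@le_lt_trans _ _ (zsum (a k))); first exact: zsum_ge_term.
  rewrite /Z lteDl ?lte_fin ?invr_gt0 ?exprn_gt0// ge0_fin_numE ?zsum_ge0//.
  by rewrite (@le_lt_trans _ _ (Z k)) ?leeDl// zE ltry.
have z0 k : (0 < z k)%R.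
  by apply: le_lt_trans (zt k k); rewrite mulr_ge0 ?powR_ge0.
have qs0 k : (0 < qs k)%R by exact: lt_trans ltr01 (qs1 k).
exists (fun k => z k `^ (qs k)^-1)%R; split.
- by move=> k; exact: powR_gt0.
- move=> k l; rewrite wE.
  have y0 : (0 <= x l * w ^+ `|(k - l)%R|%N)%R by exact: mulr_ge0.
  rewrite ltNge; apply/negP => H.
  have := zt k l; rewrite ltNge => /negP; apply.
  have := ge0_ler_powR (ltW (qs0 k)) _ _ H; rewrite !nnegrE powR_ge0 y0 => /(_ isT isT).
  rewrite -powRrM mulVf ?gt_eqF// powRr1 ?(ltW (z0 k))// => /le_trans; apply.
  (* As [qs k >= 1] and [w <= 1], raising the kernel to the power [qs k] only decreases it. *)
  rewrite powRM// mulrC ler_wpM2r ?powR_ge0//.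
  by apply: ge1r_powR; [rewrite exprn_gt0//= exprn_ile1 ?(ltW w0) ?(ltW w1)|exact: ltW].
rewrite (eq_zsum (b := Z)).
  by apply: (le_trans sumZ); rewrite lee_fin lerDr.
by move=> k; rewrite -powRrM mulVf ?gt_eqF// powRr1 ?(ltW (z0 k))// -zE.
Qed.

(** On block [k], [g] is at most [g (2 ^ k)]. Since [Q >= 1], dividing by [M >= 1] gains at least a
    factor [M] in the modular, so [M] need only exceed the bound [K] obtained without it. *)
Lemma modular_upper (S : R) : (1 <= S)%R -> exists M : R, (1 <= M)%R /\
  forall g (Y : int -> R), nonincr g -> (forall k, 0 <= Y k)%R ->
    (forall k, g (2 ^ k)%R <= (2 `^ (- psi k) * Y k / M)%:E) ->
    zsum (fun k => (Y k `^ qs k)%:E) <= S%:E ->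
  modular g <= 1.
Proof.
move=> S1; have cp0 := tamec tP; have cq0 := tamec tQ.
have S0 : (0 <= S)%R by exact: le_trans S1.
pose D := (2 `^ (1 + cp))%R.
have D1 : (1 <= D)%R by rewrite -(@powRr0 R 2) ler_powR ?ler1n// addr_ge0.
have D0 : (0 < D)%R by exact: lt_le_trans D1.
pose E := (D `^ (qmax + cq))%R.
have E0 : (0 <= E)%R by exact: powR_ge0.
pose B := ((S * 2) `^ cq)%R.
have B0 : (0 <= B)%R by exact: powR_ge0.
pose K := (E * (B * S + 3))%R.
have K0 : (0 <= K)%R by rewrite mulr_ge0// addr_ge0// mulr_ge0.
exists (1 + K)%R; split; first by rewrite lerDl.
move=> g Y gn Y0 gY sY; set M := (1 + K)%R.
have M1 : (1 <= M)%R by rewrite lerDl.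
have M0 : (0 < M)%R by exact: lt_le_trans M1.
have YqS k : (Y k `^ qs k <= S)%R.
  rewrite -lee_fin; apply: le_trans sY.
  by apply: (@zsum_ge_term _ (fun k => (Y k `^ qs k)%:E)) => l; rewrite lee_fin powR_ge0.
have YS k : (Y k <= S)%R.
  have [y1|y1] := leP (Y k) 1%R; first exact: le_trans S1.
  by apply: le_trans (YqS k); apply: le1r_powR; exact: ltW.
pose V k := (E / M * (B * Y k `^ qs k + 2 ^- `|k|%N))%R.
have V0 k : (0 <= V k)%R.
  rewrite mulr_ge0 ?divr_ge0 ?(ltW M0)// addr_ge0 ?invr_ge0 ?exprn_ge0// mulr_ge0 ?powR_ge0//.
have main k : modularD g k <= (V k)%:E.
  have mD := @measurable_dyad R k.
  have p2 : (0 < 2 ^ k :> R)%R by rewrite exprz_gt0.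
  have Ic (z : R) : \int[lebR]_(t in dyad k) z%:E = (z * 2 ^ k)%:E.
    by rewrite (integral_cst _ mD) EFinM; congr (_ * _); exact: lebR_dyad.
  rewrite [X in _ <= X%:E](_ : _ = V k / 2 ^ k * 2 ^ k)%R; last by rewrite divfK ?gt_eqF.
  rewrite -Ic; apply: ae_ge0_le_integral.
  - exact: mD.
  - by move=> t _; exact: integrand_ge0.
  - exact: (measurable_integrand_dyad tP tQ).
  - by move=> t _; rewrite lee_fin divr_ge0// ltW.
  - exact: measurable_cst.
  move: (tame_ae tP) (tame_ae tQ); apply: filterS2 => t Pt Qt kt.
  have t0 := dyad_gt0 kt; have {}Pt := Pt t0; have {}Qt := Qt t0.
  have win := dyad_window kt.
  have /andP[_ it] := dyad_inv kt.
  have /andP[_ sc] := tame_scale tP win Pt.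
  have k2t : (2 ^ k <= (t : R))%R by move: kt; rewrite /dyad/= in_itv/= => /andP[].
  have Q0 : (0 <= Q t)%R by exact: le_trans ler01 Qt.
  have W := tame_window tQ win.
  have Qmax : (Q t <= qmax + cq)%R.
    have := le_trans (ler_norm _) W; rewrite lerBlDr => /le_trans; apply.
    rewrite addrC lerD ?qsmax// ler_pdivrMr ?ltr_pwDl// ler_peMr// lerDl//.
  rewrite integrandE// /V mulrC EFinM.
  apply: lee_pmul; rewrite ?lee_fin ?invr_ge0 ?(ltW t0) ?poweR_ge0//.
  apply: (@le_trans _ _ ((D * Y k / M) `^ Q t)%:E).
    rewrite -[leRHS]poweR_EFin; apply: poweR_le => //.
      by apply: mule_ge0; [rewrite lee_fin powR_ge0|exact: gn.1].
    apply: (@le_trans _ _ ((2 `^ (psi k + (1 + cp)))%:E * (2 `^ (- psi k) * Y k / M)%:E)).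
      apply: lee_pmul; rewrite ?lee_fin ?powR_ge0 ?gn.1//.
      by apply: le_trans (gY k); apply: gn.2.
    rewrite -EFinM lee_fin /D !mulrA -powRD; last by rewrite pnatr_eq0 implybT.
    by rewrite (_ : psi k + (1 + cp) + - psi k = 1 + cp)%R//; ring.
  rewrite lee_fin powR_div ?mulr_ge0 ?(ltW D0) ?(ltW M0)// powRM ?(ltW D0)//.
  apply: (@le_trans _ _ (E * (B * Y k `^ qs k + 2 ^- `|k|%N) / M)%R); last by rewrite mulrAC.
  apply: ler_pM.
  - by rewrite mulr_ge0 ?powR_ge0.
  - by rewrite invr_ge0 powR_ge0.
  - apply: ler_pM; rewrite ?powR_ge0//; first exact: ler_powR.
    exact: powR_compare.
  - by rewrite lef_pV2 ?posrE ?powR_gt0//; exact: le1r_powR.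
rewrite (modularE tP tQ gn).
apply: (@le_trans _ _ (zsum (fun k => (V k)%:E))).
  by apply: zsum_le => k; [exact: modularD_ge0|exact: main].
have t0 k : 0 <= (2 ^- `|k|%N)%:E :> \bar R by rewrite lee_fin invr_ge0 exprn_ge0.
have u0 k : 0 <= (Y k `^ qs k)%:E :> \bar R by rewrite lee_fin powR_ge0.
rewrite (eq_zsum (b := fun k => (E / M)%:E * (B%:E * (Y k `^ qs k)%:E + (2 ^- `|k|%N)%:E))); last first.
  by move=> k; rewrite /V EFinM EFinD EFinM.
have EM0 : (0 <= E / M)%R by rewrite divr_ge0// ltW.
have v0 k : 0 <= B%:E * (Y k `^ qs k)%:E.
  by apply: mule_ge0; rewrite ?lee_fin ?powR_ge0.
rewrite zsumZ//; last by move=> k; exact: adde_ge0.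
rewrite zsumD// zsum_half zsumZ//.
apply: (@le_trans _ _ ((E / M)%:E * (B%:E * S%:E + 3%:E))).
  by rewrite lee_wpmul2l ?lee_fin// leeD2r// lee_wpmul2l ?lee_fin.
rewrite (_ : _ * _ = (E / M * (B * S + 3))%:E)// lee_fin mulrAC ler_pdivrMr// mul1r.
by rewrite -/K lerDr.
Qed.

End modular_bounds.

(** * From level sets to the Lorentz norm *)

Section rearrangement_lemmas.
Context (R : realType) (n : nat).
Implicit Types (f : euclid R n -> \bar R) (y t lam : R).

Lemma nonincr_rearrangement f : nonincr (rearrangement f).
Proof.
split=> [t|s t _ st].
  by apply: le_ereal_inf_tmp => _ [s [s0 _] <-]; rewrite lee_fin.
apply: le_ereal_inf => _ [s' [s0 H] <-]; exists s' => //; split => //.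
by apply: (le_trans H); rewrite lee_fin.
Qed.

Lemma rearrangement_lt f t y : rearrangement f t < y%:E ->
  leb [set x | y%:E < `|f x|] <= t%:E.
Proof.
move=> /ereal_inf_lt[_ [s [s0 H] <-]]; rewrite lte_fin => sy.
by apply: le_trans H; apply: le_leb => x /=; apply: lt_trans; rewrite lte_fin.
Qed.

Lemma rearrangement_le f t y : (0 <= y)%R -> leb [set x | y%:E < `|f x|] <= t%:E ->
  rearrangement f t <= y%:E.
Proof. by move=> y0 H; apply: ereal_inf_lbound; exists y. Qed.

Lemma level_scale lam y (z : \bar R) : (0 < lam)%R -> 0 <= z ->
  (y%:E < `|z / lam%:E|) = ((lam * y)%:E < z).
Proof.
move=> lam0 z0; rewrite inver gt_eqF// gee0_abs; last first.
  by apply: mule_ge0 => //; rewrite lee_fin invr_ge0 ltW.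
by rewrite lte_pdivlMr// -EFinM mulrC.
Qed.

End rearrangement_lemmas.

Section lorentz_maximal.
Context (R : realType) (n : nat).
Hypothesis n0 : (0 < n)%N.
Implicit Types (f : nat -> euclid R n -> \bar R).

(** [psi] is linear on each side of 0 with the two reciprocal limits as slopes, and both branches
    vanish at 0, so a step across 0 splits without a jump. *)
Lemma psi_slope (p0 poo lo hi : R) (k : int) (i : nat) :
  (lo <= p0^-1 <= hi)%R -> (lo <= poo^-1 <= hi)%R ->
  (lo * i%:R <= psi p0 poo (k + i%:Z) - psi p0 poo k <= hi * i%:R)%R.
Proof.
move=> /andP[lu uh] /andP[lv vh]; rewrite /psi /side rmorphD/= -pmulrn.
set K : R := k%:~R; set I : R := i%:R.
have I0 : (0 <= I)%R by exact: ler0n.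
have [k0|k0] := ltP k 0%R.
  have K0 : (K < 0)%R by rewrite ltrz0.
  have [ki|ki] := ltP (k + i%:Z)%R 0%R.
    move: p0^-1%R lu uh => u lu uh.
    by apply/andP; split; nra.
  have KI : (0 <= K + I)%R by rewrite /K /I [i%:R]pmulrn -rmorphD/= ler0z.
  move: p0^-1%R poo^-1%R lu uh lv vh => u v lu uh lv vh.
  by apply/andP; split; nra.
have -> : (k + i%:Z < 0)%R = false by rewrite ltNge addr_ge0.
move: poo^-1%R lv vh => v lv vh.
by apply/andP; split; nra.
Qed.

(** Turns the kernel bound between two indices into a comparison of the levels there; [u] and [v]
    stand for the values of [psi]. *)
Lemma scaled_lt (x Y e u v c : R) : (x * 2 `^ (- e) < Y -> 0 < Y -> e - v <= c - u ->
  2 `^ (- v) * x < 2 `^ (- u) * Y * 2 `^ c)%R.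
Proof.
move=> xY Y0 H.
have two : (2 != 0 :> R)%R by rewrite pnatr_eq0.
have -> : (2 `^ (- v) * x = x * 2 `^ (- e) * 2 `^ (e - v))%R.
  by rewrite -mulrA -powRD ?two ?implybT// mulrC; congr (_ * 2 `^ _)%R; ring.
have -> : (2 `^ (- u) * Y * 2 `^ c = Y * 2 `^ (c - u))%R.
  by rewrite [(c - u)%R]addrC powRD ?two ?implybT//; ring.
apply: (@lt_le_trans _ _ (Y * 2 `^ (e - v))%R).
  by rewrite ltr_pM2r// powR_gt0.
by rewrite ler_wpM2l ?(ltW Y0)// ler_powR// ler1n.
Qed.

Lemma modular_maximal (P Q : R -> R) (p0 poo cp q0 qoo cq r : R) :
  tame P p0 poo cp -> tame Q q0 qoo cq -> (1 < r)%R ->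
  exists C : R, (0 < C)%R /\ forall f (lam : R),
    (forall j, measurable_fun [set: euclid R n] (f j)) -> (0 < lam)%R ->
    lorentz_modular P Q (fun x => lrnorm r (fun j => `|f j x|) / lam%:E) <= 1 ->
    lorentz_modular P Q (fun x => lrnorm r (fun j => maximal (f j) x) / (C * lam)%:E) <= 1.
Proof.
move=> tP tQ r1; have p1 := tame0 tP; have poo1 := tameoo tP.
pose lo := Num.min p0^-1%R poo^-1%R; pose hi := Num.max p0^-1%R poo^-1%R.
have lo0 : (0 < lo)%R by rewrite lt_min !invr_gt0 !(lt_trans ltr01).
have hi0 : (0 < hi)%R by rewrite lt_max !invr_gt0 (lt_trans ltr01 p1).
have hi1 : (hi < 1)%R by rewrite gt_max !invf_lt1 ?p1 ?poo1 ?(lt_trans ltr01).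
have slope k i : (lo * i%:R <= psi p0 poo (k + i%:Z) - psi p0 poo k <= hi * i%:R)%R.
  by apply: psi_slope; rewrite /lo /hi ge_min le_max lexx ?orbT.
(* The kernel costs slope [e]: [hi + e < 1] keeps [a < 2], and [lo - e >= e] leaves the decay
   [b = 2 ^ e]. *)
pose e := Num.min (lo / 2)%R ((1 - hi) / 2)%R.
have e0 : (0 < e)%R by rewrite lt_min !divr_gt0 ?subr_gt0.
have elo : (e + e <= lo)%R by rewrite [leRHS]splitr lerD// ge_min lexx.
have ehi : (hi + e < 1)%R.
  have : (e <= (1 - hi) / 2)%R by rewrite ge_min lexx orbT.
  lra.
have lt_pow (c d : R) : (c < d)%R -> (2 `^ c < 2 `^ d)%R.
  by move=> cd; rewrite /powR pnatr_eq0/= ltr_expR ltr_pM2r// ln_gt0// ltr1n.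
pose a : R := (2 `^ (hi + e))%R; pose b : R := (2 `^ e)%R.
have a1 : (1 < a)%R by rewrite -(powRr0 2) lt_pow// addr_gt0.
have a2 : (a < 2)%R by rewrite -[ltRHS]powRr1// lt_pow.
have b1 : (1 < b)%R by rewrite -(powRr0 2) lt_pow.
have [C [C0 HC]] := maximal_distribution n0 r1 a1 a2 b1.
have [S [S1 HS]] := modular_lower tP tQ.
have [S' [S'1 HS']] := kernel_bound tQ e0 S1.
have [M [M1 HM]] := modular_upper tP tQ S'1.
have M0 : (0 < M)%R by exact: lt_le_trans M1.
exists (C * M)%R; split; first exact: mulr_gt0.
move=> f lam mf lam0 Hh.
set F := (fun x => lrnorm r (fun j => `|f j x|)) in Hh *.
set G := (fun x => lrnorm r (fun j => maximal (f j) x)).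
have F0 x : 0 <= F x by exact: lrnorm_ge0.
have G0 x : 0 <= G x by exact: lrnorm_ge0.
have [x [x0 hx xS sx]] := HS _ (nonincr_rearrangement (fun x => F x / lam%:E)) Hh.
have [Y [Y0 xY sY]] := HS' x x0 xS sx.
apply: HM (nonincr_rearrangement (fun x => G x / (C * M * lam)%:E)) _ _ sY => k.
  exact/ltW.
pose B : R := (2 `^ (- psi p0 poo k) * Y k)%R.
have B0 : (0 < B)%R by rewrite mulr_gt0 ?powR_gt0.
have t0 : (0 < 2 ^ k :> R)%R by rewrite exprz_gt0.
have level l c : (e * `|(k - l)%R|%N%:R - psi p0 poo l <= c - psi p0 poo k)%R ->
    leb [set x | (lam * (B * 2 `^ c))%:E < F x] <= (2 ^ l)%:E.
  move=> H; have := @rearrangement_lt _ _ (fun x => F x / lam%:E) (2 ^ l)%R (B * 2 `^ c)%R.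
  rewrite hx lte_fin => /(_ (scaled_lt (xY k l) (Y0 k) H)).
  apply: le_trans; apply: le_leb => z /=.
  by rewrite level_scale.
(* Going back [i] blocks, [psi] drops by at most [hi * i] and the kernel adds [e * i]. *)
have up i : leb [set x | (lam * B * a ^+ i)%:E < F x] <= (2 ^ k / 2 ^+ i)%:E.
  have := level (k - i%:Z)%R ((hi + e) * i%:R)%R.
  rewrite (_ : k - (k - i%:Z) = i%:Z)%R; last by ring.
  rewrite absz_nat powRrM powR_mulrn ?powR_ge0// mulrA.
  rewrite expfzDr ?pnatr_eq0// -exprnN; apply.
  by have /andP[_] := slope (k - i%:Z)%R i; rewrite subrK; lra.
(* Going forward [i] blocks, [psi] gains at least [lo * i]; the kernel takes [e * i] of it and at
   least [e * i] remains. *)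
have dn i : leb [set x | (lam * B / b ^+ i)%:E < F x] <= (2 ^ k * 2 ^+ i)%:E.
  have := level (k + i%:Z)%R (- (e * i%:R))%R.
  rewrite (_ : k - (k + i%:Z) = - i%:Z)%R; last by ring.
  rewrite abszN absz_nat powRN powRrM powR_mulrn ?powR_ge0// mulrA.
  rewrite expfzDr ?pnatr_eq0//; apply.
  have /andP[+ _] := slope k i; have : ((e + e) * i%:R <= lo * i%:R)%R by rewrite ler_wpM2r.
  lra.
have := HC f (lam * B)%R (2 ^ k)%R mf (mulr_gt0 lam0 B0) t0 up dn.
move=> H; apply: rearrangement_le; first by rewrite divr_ge0 ?ltW.
apply: le_trans H; apply: le_leb => z /=.
have CM0 : (0 < C * M * lam)%R by do !apply: mulr_gt0 => //.
(* The factor [M] in the constant cancels the division by [M] demanded by [modular_upper]. *)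
rewrite level_scale// -/B (_ : C * M * lam * (B / M) = C * (lam * B))%R//.
by field; rewrite gt_eqF.
Qed.

End lorentz_maximal.

(** Each [lam] admissible for [F] makes [C * lam] admissible for [G]; if none exists, the right side
    is infinite. *)
Lemma lorentz_norm_le (R : realType) (n : nat) (p q : R -> R) (F G : euclid R n -> \bar R) (C : R) :
  (0 < C)%R ->
  (forall lam, (0 < lam)%R -> lorentz_modular p q (fun x => F x / lam%:E) <= 1 ->
     lorentz_modular p q (fun x => G x / (C * lam)%:E) <= 1) ->
  lorentz_norm p q G <= C%:E * lorentz_norm p q F.
Proof.
move=> C0 H; rewrite -(lee_pdivrMl _ _ C0); apply: le_ereal_inf_tmp => _ [lam [lam0 Hl] <-].
rewrite (lee_pdivrMl _ _ C0) -EFinM; apply: ereal_inf_lbound; exists (C * lam)%R; last by [].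
exact: conj (mulr_gt0 C0 lam0) (H _ lam0 Hl).
Qed.

Theorem proposition19 (R : realType) (n : nat) (hn : (0 < n)%N)
    (p q : R -> R) (hp : class_P0 p) (hq : class_P0 q)
    (r : R) (hr : (1 < r)%R) (tau : R) (htau0 : (0 < tau)%R)
    (htau : tau%:E < mine 1 (mine (exponent_inf p) (exponent_inf q))) :
  exists C : R, (0 < C)%R /\
    forall f : nat -> euclid R n -> \bar R,
      (forall j, measurable_fun [set: euclid R n] (f j)) ->
      lorentz_norm (fun t => p t / tau)%R (fun t => q t / tau)%R
        (fun x => (\sum_(0 <= j <oo) maximal (f j) x `^ r) `^ r^-1)
      <= C%:E * lorentz_norm (fun t => p t / tau)%R (fun t => q t / tau)%R
        (fun x => (\sum_(0 <= j <oo) `|f j x| `^ r) `^ r^-1).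
Proof.
move: htau; rewrite !lt_min => /and3P[_ tp tq].
have [p0 [poo [cp tP]]] := class_P0_tame hp htau0 tp.
have [q0 [qoo [cq tQ]]] := class_P0_tame hq htau0 tq.
have [C [C0 H]] := modular_maximal hn tP tQ hr.
exists C; split; first exact: C0.
move=> f mf; apply: (lorentz_norm_le C0) => lam lam0.
exact: H mf lam0.
Qed.
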